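(* Assume that $\gamma \in [0,1/2)$. Consider the general algorithm described in the context and assume that, almost surely, for all $(x,a)\in \mathcal{Z}$, $$\lim_{k\to \infty} \varepsilon_k(x)=0,\qquad \sum_{k\geq 1} \alpha_k(x,a)\mathbf{1}_{\{\tau^{k+1}_{x,a}<\infty\}}=\infty,\qquad \sum_{k\geq 1} (\alpha_k(x,a))^2\mathbf{1}_{\{\tau^{k+1}_{x,a}<\infty\}}<\infty.$$ Then almost surely, $\lim_{k\to \infty} V_{\hat\pi^k}(x)=V^*(x)$ for all $x\in\mathcal{X}$.
   Context: Setting: $\mathcal{X}$ is a non-empty finite state space; for each $x\in\mathcal{X}$, $\mathcal{A}_x$ is a non-empty finite set of actions; $\mathcal{Z}=\{(x,a): x\in\mathcal{X}, a\in\mathcal{A}_x\}$. For $(x,a)\in\mathcal{Z}$, $P(x,a,\cdot)$ is a probability measure on $\mathcal{X}$ (transition law), and for $y\in\mathcal{X}$, $S(x,a,y,\cdot)$ is a probability measure on $\mathbb{R}$ (reward law) with $\int z^2 S(x,a,y,dz)<\infty$. The discount factor is $\gamma\in[0,1)$. Given a starting state and a stationary Markov (SM) policy $\pi$ (a family of probability measures $\pi(x,\cdot)$ on $\mathcal{A}_x$), one builds $X_0=x$, $A_t\sim\pi(X_t,\cdot)$, $X_{t+1}\sim P(X_t,A_t,\cdot)$, and rewards $R_{t+1}\sim S(X_t,A_t,X_{t+1},\cdot)$ (conditionally independent given the state/action process); the total reward is $G=\sum_{t\ge0}\gamma^t R_{t+1}$, $V_\pi(x)=\mathbb{E}_{x,\pi}[G]$,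 and $V^*(x)=\sup_\Pi V_\Pi(x)$ over all (possibly history-dependent) policies $\Pi$. General algorithm: start with a deterministic $\hat Q^0:\mathcal{Z}\to\mathbb{R}$. Having built $k$ episodes $(X^i_0,A^i_0,X^i_1,R^i_1,A^i_1,\dots)$, $i=1,\dots,k$, let $\mathcal{F}^k$ be the $\sigma$-field they generate ($\mathcal{F}^0$ trivial) and $\mathcal{G}^i_n=\sigma(X^i_0,A^i_0,X^i_1,R^i_1,A^i_1,\dots,X^i_n,R^i_n,A^i_n)$. Given an $\mathcal{F}^k$-measurable $\hat Q^k:\mathcal{Z}\to\mathbb{R}$ and an $\mathcal{F}^k$-measurable $\varepsilon_k:\mathcal{X}\to[0,1]$, define the SM policy $$\hat\pi^k(x,a)=\frac{\varepsilon_k(x)}{|\mathcal{A}_x|}+\mathbf{1}_{\{a\in\arg\max \hat Q^k(x,\cdot)\}}\frac{1-\varepsilon_k(x)}{|\arg\max \hat Q^k(x,\cdot)|}.$$ The $(k+1)$-th episode is built with $(X^{k+1}_0,A^{k+1}_0)\sim\nu_k$, for some $\mathcal{F}^k$-measurable probability $\nu_k$ on $\mathcal{Z}$, and then using $\hat\pi^k$. Let $\tau^{k+1}_{x,a}=\inf\{t\ge0:(X^{k+1}_t,A^{k+1}_t)=(x,a)\}$ ($\inf\emptyset=\infty$), $G^{k+1}_{x,a}=\sum_{t\ge0}\gamma^t R^{k+1}_{\tau^{k+1}_{x,a}+t+1}$ (and $0$ if $\tau^{k+1}_{x,a}=\infty$). For some $\mathcal{F}^k\vee\mathcal{G}^{k+1}_{\tau^{k+1}_{x,a}}$-measurable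 $\alpha_k(x,a)\in[0,1]$ (learning rate), set $$\hat Q^{k+1}(x,a)=(1-\alpha_k(x,a)\mathbf{1}_{\{\tau^{k+1}_{x,a}<\infty\}})\hat Q^k(x,a)+\alpha_k(x,a)\mathbf{1}_{\{\tau^{k+1}_{x,a}<\infty\}}G^{k+1}_{x,a}.$$ *)

(* Defs.v *)
From HB Require Import structures.
From mathcomp Require Import all_boot all_order all_algebra.
From mathcomp Require Import all_classical all_reals all_analysis.
Set Implicit Arguments. Unset Strict Implicit. Unset Printing Implicit Defensive.
Import Order.TTheory GRing.Theory Num.Theory numFieldNormedType.Exports.
Local Open Scope classical_set_scope.
Local Open Scope ring_scope.

(* States: finite type [st]; actions: a finite type [ac] together with, for
   each state x, the non-empty admissible set A_x = acts x.
   Z = {(x,a) | a \in acts x}. trans x a = P(x,a,.), rew x a y = S(x,a,y,.);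
   their properties are only required on Z. *)
Record mdp (R : realType) := MDP {
  st : finType;
  ac : finType;
  acts : st -> {set ac};
  acts_ne : forall x, acts x != finset.set0;
  trans : st -> ac -> st -> R;
  trans_ge0 : forall x a y, a \in acts x -> 0 <= trans x a y;
  trans_sum1 : forall x a, a \in acts x -> \sum_y trans x a y = 1;
  rew : st -> ac -> st -> probability R R;
  rew_L2 : forall x a y, a \in acts x ->
     (rew x a y).-integrable setT (fun z => (z ^+ 2)%:E)
}.

Section Defs.
Variable R : realType.

Section Gen.
Context {d : measure_display} {Omega : measurableType d}.

Definition gen_fin (T : finType) (f : Omega -> T) : set (set Omega) :=
  [set f @^-1` B | B in [set: set T]].

Definition gen_real (f : Omega -> R) : set (set Omega) :=
  [set f @^-1` D | D in [set D : set R | measurable D]].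

(* generators of sigma(X_0..X_{nx-1}, A_0..A_{na-1}, R_1..R_{nr});
   Rs t stands for the reward R_{t+1}. *)
Definition traj_gen (S A : finType) (Xs : nat -> Omega -> S)
    (As : nat -> Omega -> A) (Rs : nat -> Omega -> R) (nx na nr : nat)
    : set (set Omega) :=
  [set E | (exists2 t, (t < nx)%N & gen_fin (Xs t) E)
        \/ (exists2 t, (t < na)%N & gen_fin (As t) E)
        \/ (exists2 t, (t < nr)%N & gen_real (Rs t) E)].

Definition meas_wrt (F : set (set Omega)) (f : Omega -> R) : Prop :=
  forall D : set R, measurable D -> F (f @^-1` D).

Definition cond_law_fin (P : probability Omega R) (Gs : set (set Omega))
    (T : finType) (Y : Omega -> T) (p : Omega -> T -> R) : Prop :=
  forall (B : set Omega) (y : T), <<s Gs >> B ->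
    P (B `&` Y @^-1` [set y]) = (\int[P]_(w in B) (p w y)%:E)%E.

Definition cond_law_real (P : probability Omega R) (Gs : set (set Omega))
    (Y : Omega -> R) (k : Omega -> probability R R) : Prop :=
  forall (B : set Omega) (D : set R), <<s Gs >> B -> measurable D ->
    P (B `&` Y @^-1` D) = (\int[P]_(w in B) k w D)%E.

Definition ret (gamma : R) (Rs : nat -> Omega -> R) (w : Omega) : R :=
  limn (fun n => \sum_(t < n) gamma ^+ t * Rs t w).

Definition tau (S A : finType) (Xs : nat -> Omega -> S) (As : nat -> Omega -> A)
    (x : S) (a : A) (w : Omega) : option nat :=
  match pselect (exists t, (Xs t w, As t w) == (x, a)) with
  | left H => Some (ex_minn H)
  | right _ => None
  end.

Definition stop_sigma (Fn : nat -> set (set Omega)) (Finf : set (set Omega))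
    (T : Omega -> option nat) : set (set Omega) :=
  [set B | <<s Finf >> B /\
     forall n, <<s Fn n >> (B `&` [set w | exists2 m, T w = Some m & (m <= n)%N])].
End Gen.

Section MDPdefs.
Variable M : mdp R.
Local Notation X := (st M).
Local Notation A := (ac M).

(* A (possibly history-dependent, randomized) policy: given the past
   [:: (x_0,a_0,r_1); ...; (x_{t-1},a_{t-1},r_t)] and the current state x_t,
   a probability vector on A_{x_t}. *)
Definition hpolicy := seq (X * A * R) -> X -> A -> R.

Definition valid_hpolicy (Pi : hpolicy) : Prop :=
  forall h x, (forall a, 0 <= Pi h x a) /\ (forall a, a \notin acts x -> Pi h x a = 0)
              /\ \sum_(a in acts x) Pi h x a = 1.

Definition sm (pi : X -> A -> R) : hpolicy := fun _ x a => pi x a.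

Definition hist d (Omega : measurableType d) (Xs : nat -> Omega -> X)
  (As : nat -> Omega -> A) (Rs : nat -> Omega -> R) (t : nat) (w : Omega)
  : seq (X * A * R) := [seq (Xs i w, As i w, Rs i w) | i <- iota 0 t].

Definition realizes (Pi : hpolicy) (x : X) d (Omega : measurableType d)
    (P : probability Omega R) (Xs : nat -> Omega -> X) (As : nat -> Omega -> A)
    (Rs : nat -> Omega -> R) : Prop :=
  (forall t y, measurable (Xs t @^-1` [set y])) /\
  (forall t a, measurable (As t @^-1` [set a])) /\
  (forall t, measurable_fun setT (Rs t)) /\
  (forall t a, measurable_fun setT (fun w => Pi (hist Xs As Rs t w) (Xs t w) a)) /\
  P (Xs 0 @^-1` [set x]) = 1%E /\
  (forall t, cond_law_fin P (traj_gen Xs As Rs t.+1 t t) (As t)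
               (fun w a => Pi (hist Xs As Rs t w) (Xs t w) a)) /\
  (forall t, cond_law_fin P (traj_gen Xs As Rs t.+1 t.+1 t) (Xs t.+1)
               (fun w y => trans (Xs t w) (As t w) y)) /\
  (forall t, cond_law_real P (traj_gen Xs As Rs t.+2 t.+1 t) (Rs t)
               (fun w => rew (Xs t w) (As t w) (Xs t.+1 w))).

(* V_Pi(x) = E_{x,Pi}[G]; the law of the process (hence E[G]) does not depend
   on the realization, and the supremum below is over all realizations. *)
Definition Vpol (gamma : R) (Pi : hpolicy) (x : X) : \bar R :=
  ereal_sup [set v | exists (d : measure_display) (Omega : measurableType d)
     (P : probability Omega R) (Xs : nat -> Omega -> X) (As : nat -> Omega -> A)
     (Rs : nat -> Omega -> R),
     realizes Pi x P Xs As Rs /\ v = (\int[P]_w (ret gamma Rs w)%:E)%E].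

Definition Vstar (gamma : R) (x : X) : \bar R :=
  ereal_sup [set Vpol gamma Pi x | Pi in valid_hpolicy].

Definition amax (Q : X -> A -> R) (x : X) : {set A} :=
  [set a in acts x | [forall b in acts x, Q x b <= Q x a]].

Definition pihat (e : X -> R) (Q : X -> A -> R) (x : X) (a : A) : R :=
  (a \in acts x)%:R * (e x / #|acts x|%:R)
  + (a \in amax Q x)%:R * ((1 - e x) / #|amax Q x|%:R).

Section Alg.
Context {d : measure_display} {Omega : measurableType d}.
Variable gamma : R.
(* Episode number k+1 of the paper is indexed by k here:
   Xe k t = X^{k+1}_t, Ae k t = A^{k+1}_t, Re k t = R^{k+1}_{t+1}. *)
Variables (Xe : nat -> nat -> Omega -> X) (Ae : nat -> nat -> Omega -> A)
          (Re : nat -> nat -> Omega -> R).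
Variable Q0 : X -> A -> R.
Variables (eps : nat -> Omega -> X -> R) (nu : nat -> Omega -> X -> A -> R)
          (alpha : nat -> Omega -> X -> A -> R).

Fixpoint Qhat (k : nat) (w : Omega) : X -> A -> R :=
  match k with
  | 0 => Q0
  | k'.+1 => fun x a =>
      match tau (Xe k') (Ae k') x a w with
      | Some t => (1 - alpha k' w x a) * Qhat k' w x a
                  + alpha k' w x a * ret gamma (fun n => Re k' (t + n)%N) w
      | None => Qhat k' w x a
      end
  end.

Definition past_gen (k : nat) : set (set Omega) :=
  [set E | exists2 j, (j < k)%N & exists n, traj_gen (Xe j) (Ae j) (Re j) n n n E].

Definition epi_gen (k n : nat) : set (set Omega) :=
  past_gen k `|` traj_gen (Xe k) (Ae k) (Re k) n.+1 n.+1 n.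

Definition alg_run (P : probability Omega R) : Prop :=
  (forall k t y, measurable (Xe k t @^-1` [set y])) /\
  (forall k t a, measurable (Ae k t @^-1` [set a])) /\
  (forall k t, measurable_fun setT (Re k t)) /\
  (forall k w x, 0 <= eps k w x <= 1) /\
  (forall k x, meas_wrt (<<s past_gen k >>) (fun w => eps k w x)) /\
  (forall k w x a, 0 <= nu k w x a) /\
  (forall k w x a, a \notin acts x -> nu k w x a = 0) /\
  (forall k w, \sum_x \sum_(a in acts x) nu k w x a = 1) /\
  (forall k x a, meas_wrt (<<s past_gen k >>) (fun w => nu k w x a)) /\
  (forall k w x a, 0 <= alpha k w x a <= 1) /\
  (forall k x a, meas_wrt
      (stop_sigma (epi_gen k) (past_gen k.+1) (tau (Xe k) (Ae k) x a))
      (fun w => alpha k w x a)) /\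
  (forall k, cond_law_fin P (past_gen k) (fun w => (Xe k 0 w, Ae k 0 w))
               (fun w z => nu k w z.1 z.2)) /\
  (forall k t, cond_law_fin P (past_gen k `|` traj_gen (Xe k) (Ae k) (Re k) t.+2 t.+1 t.+1)
               (Ae k t.+1) (fun w a => pihat (eps k w) (Qhat k w) (Xe k t.+1 w) a)) /\
  (forall k t, cond_law_fin P (epi_gen k t) (Xe k t.+1)
               (fun w y => trans (Xe k t w) (Ae k t w) y)) /\
  (forall k t, cond_law_real P (past_gen k `|` traj_gen (Xe k) (Ae k) (Re k) t.+2 t.+1 t)
               (Re k t) (fun w => rew (Xe k t w) (Ae k t w) (Xe k t.+1 w))).

Definition visited (k : nat) (w : Omega) (x : X) (a : A) : R :=
  if tau (Xe k) (Ae k) x a w is Some _ then 1 else 0.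
End Alg.
End MDPdefs.
End Defs.

(* Main.v *)
(* The value [vpi pi] of a stationary policy and the optimal value [vopt] are
   fixed points of Bellman contractions, and [Q^k] is a stochastic approximation
     Q^{k+1} = (1 - b_k) Q^k + b_k (q_k + noise),   b_k = alpha_k 1_{tau < oo},
   where [q_k] is the action value of the policy used in episode k+1 and the
   noise is centered given the stopped sigma-field, with bounded variance.  The
   square-summability of [b_k] makes the noise series converge almost surely,
   so everything else is deterministic.  Since [q_k <= q*], averaging gives
   limsup Q^k <= q*.  Conversely, if Q^k >= q* - D asymptotically, a greedy
   action loses at most D, whence vopt - vpi <= D / (1 - gamma) in the limit,
   q_k >= q* - D gamma / (1 - gamma), and averaging improves D by the factor
   gamma / (1 - gamma), which is less than 1 exactly when gamma < 1/2.

   [Vpol] is a supremum over realizations; to identify it with [vpi] one of them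
   is built on [0, 1] from the binary digits of a uniform variable. *)
Require Import Defs.
From HB Require Import structures.
From mathcomp Require Import all_boot all_order all_algebra.
From mathcomp Require Import all_classical all_reals all_analysis.
From mathcomp Require Import measurable_realfun lra ring zify.
Import Order.TTheory GRing.Theory Num.Theory numFieldNormedType.Exports.
Local Open Scope classical_set_scope.
Local Open Scope ring_scope.
Set Implicit Arguments. Unset Strict Implicit. Unset Printing Implicit Defensive.

(** * Averaging recursions *)

(** No conditional expectation is formed. Conditional mean 0, or conditional second moment at most
    [C], is stated through integrals over the events of the sigma-field, and bounded measurable
    multipliers are brought in by discretising them. This boundedness shapes the noise argument:
    sums of squared weights are only almost surely finite and partial sums are unbounded, so weights
    are cut off at a level [K] and the walk is frozen when it leaves an interval before any second
    moment is computed. The policy of an episode is random but known from the past, so the return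
    identities carry a random value function [v], measurable for a base family [G0]. With [G0] the
    past episodes they serve the algorithm, with [G0] empty they serve any history-dependent policy.
    A return is a [limn], which takes a default value where the series diverges: identities about
    returns come from almost sure convergence, whereas measurability must hold everywhere and rests
    on the measurability of the convergence set. *)

Lemma contraction_fixpoint (R : realType) (X : finType) (g : R)
    (T : (X -> R) -> X -> R) (u : X -> R) :
  0 <= g < 1 ->
  (forall v w c, (forall x, `|v x - w x| <= c) ->
     forall x, `|T v x - T w x| <= g * c) ->
  (forall x, cvgn (fun n => iter n T u x)) /\
  T (fun x => limn (fun n => iter n T u x))
    =1 (fun x => limn (fun n => iter n T u x)).
Proof.
move=> /andP[g0 g1] Tg; set v := fun x => limn _.
pose C := \sum_x `|T u x - u x|.
have uC n x : `|iter n.+1 T u x - iter n T u x| <= g ^+ n * C.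
  elim: n x => [|n IH] x.
    by rewrite expr0 mul1r /C (bigD1 x) //= lerDl sumr_ge0.
  by rewrite exprS -mulrA; apply: Tg.
have cv x : cvgn (fun n => iter n T u x).
  pose w n := iter n T u x.
  have -> : (fun n => iter n T u x) = (fun n => w 0%N + series (telescope w) n).
    by apply/funext => n; rewrite -eq_sum_telescope.
  apply: is_cvgD; first exact: is_cvg_cst.
  apply: normed_cvg; apply: (series_le_cvg (v_ := geometric C g)) => //.
  - by move=> n; exact: normr_ge0.
  - by move=> n; rewrite /= mulr_ge0 ?exprn_ge0// sumr_ge0.
  - by move=> n /=; rewrite mulrC; exact: uC.
  - by apply: is_cvg_geometric_series; rewrite ger0_norm.
split=> // x; apply/eqP; rewrite -subr_eq0 -normr_le0.
apply/ler_addgt0Pl => e e0; rewrite addr0.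
(* One half of [e] pays for iterate [N.+1] against the limit, the other for [T] of iterate [N]
   against [T] of the limit. One rank [N] serves all states because [X] is finite. *)
have e2 : 0 < e / 2 by rewrite divr_gt0.
have : \forall n \near \oo, forall y, `|iter n T u y - v y| <= e / 2.
  apply: filter_forall => y.
  have /cvgrPdist_le/(_ _ e2) := cv y.
  by apply: filterS => n; rewrite distrC.
move=> [N _ HN].
have h1 := HN N (leqnn N); have h2 := HN N.+1 (leqnSn N) x.
have h3 := Tg _ _ _ h1 x.
rewrite (_ : T v x - v x = (iter N.+1 T u x - v x) - (T (iter N T u) x - T v x)).
  apply: (le_trans (ler_normB _ _)); rewrite [leRHS]splitr lerD//.
  by apply: (le_trans h3); rewrite ger_pMl// ltW.
by rewrite /=; ring.
Qed.

(* Robbins-Monro averaging with weights of infinite mass forgets its initial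
   value, hence is asymptotically dominated by what it averages. *)
Lemma averaging_limsup_le (R : realType) (u b : nat -> R) (l : R) :
  (forall k, 0 <= b k <= 1) ->
  (forall k A, exists n, A <= \sum_(k <= i < k + n) b i) ->
  (forall e, 0 < e -> \forall k \near \oo,
     u k.+1 <= (1 - b k) * u k + b k * (l + e)) ->
  forall e, 0 < e -> \forall k \near \oo, u k <= l + e.
Proof.
move=> b01 bdiv urec e e0; have e2 : 0 < e / 2 by rewrite divr_gt0.
have [N _ HN] := urec _ e2.
(* The excess over [l + e / 2]: since the target is below that level, a step shrinks the excess by
   the factor [1 - b k]. It never increases past [N], so one small value is enough. *)
pose p k := Num.max 0 (u k - (l + e / 2)).
have p0 k : 0 <= p k by rewrite /p le_max lexx.
have prec k : (N <= k)%N -> p k.+1 <= (1 - b k) * p k.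
  move=> /HN /= h; have /andP[b0 b1] := b01 k.
  rewrite {1}/p ge_max mulr_ge0 ?subr_ge0//=.
  have : u k - (l + e / 2) <= p k by rewrite /p le_max lexx orbT.
  move=> /(ler_wpM2l (_ : 0 <= 1 - b k)); rewrite subr_ge0 => /(_ b1).
  by move: h; lra.
have pdec k n : (N <= k)%N -> p (k + n)%N <= p k.
  move=> Nk; elim: n => [|n IH]; first by rewrite addn0.
  rewrite addnS; apply: le_trans IH.
  have := prec (k + n)%N (leq_trans Nk (leq_addr _ _)).
  have /andP[b0 b1] := b01 (k + n)%N.
  by have := mulr_ge0 b0 (p0 (k + n)%N); lra.
suff [k Nk pk] : exists2 k, (N <= k)%N & p k <= e / 2.
  exists k => // n /= kn; have := pdec k (n - k)%N Nk; rewrite subnKC// => pn.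
  have : u n - (l + e / 2) <= p n by rewrite /p le_max lexx orbT.
  by lra.
(* An excess staying above [e / 2] would lose at least [b k * (e / 2)] at each step, and the
   infinite mass of [b] would make it negative. *)
apply: contrapT => np.
have pe k : (N <= k)%N -> e / 2 <= p k.
  by move=> Nk; rewrite leNgt; apply/negP => /ltW pk; apply: np; exists k.
have psum n : p (N + n)%N <= p N - e / 2 * \sum_(N <= i < N + n) b i.
  elim: n => [|n IH]; first by rewrite addn0 big_geq// mulr0 subr0.
  have Nn : (N <= N + n)%N by exact: leq_addr.
  rewrite addnS big_nat_recr//=.
  have := prec _ Nn; have := pe _ Nn; have /andP[b0 b1] := b01 (N + n)%N.
  by move=> /(ler_wpM2l b0); move: IH; lra.
have [n Hn] := bdiv N ((p N + 1) / (e / 2)).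
have := psum n; have := p0 (N + n)%N.
rewrite ler_pdivrMr// mulrC in Hn.
by move: Hn; lra.
Qed.

(* Kronecker-type lemma: subtracting the remainder of the convergent series
   turns the noise recursion into an averaging of a null sequence. *)
Lemma averaged_noise_cvg0 (R : realType) (W b m : nat -> R) :
  (forall k, 0 <= b k <= 1) ->
  (forall k A, exists n, A <= \sum_(k <= i < k + n) b i) ->
  (forall k, W k.+1 = (1 - b k) * W k + b k * m k) ->
  cvgn (series (fun k => b k * m k)) -> W @ \oo --> 0.
Proof.
move=> b01 bdiv Wrec cvS; pose S := series (fun k => b k * m k).
pose l := limn S; pose Y k := W k - S k + l.
have Sl : S @ \oo --> l by [].
have Yrec k : Y k.+1 = (1 - b k) * Y k + b k * (l - S k).
  by rewrite /Y /S seriesSr Wrec; ring.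
have Y0 : Y @ \oo --> 0.
  apply/cvgr0Pnorm_le => e e0.
  suff /(averaging_limsup_le b01 bdiv)/(_ _ e0) : forall d, 0 < d ->
      \forall k \near \oo, `|Y k.+1| <= (1 - b k) * `|Y k| + b k * (0 + d).
    by apply: filterS => k; rewrite add0r.
  move=> d d0; have /cvgrPdist_le/(_ _ d0) := Sl.
  apply: filterS => k Hk; rewrite Yrec add0r.
  have /andP[b0 b1] := b01 k.
  apply: (le_trans (ler_normD _ _)).
  rewrite !normrM (ger0_norm b0) (ger0_norm (_ : 0 <= 1 - b k)) ?subr_ge0//.
  by rewrite lerD2l ler_wpM2l.
have -> : W = (fun k => Y k + (S k - l)) by apply/funext => k; rewrite /Y; ring.
rewrite -[X in _ --> X](addr0 (0 : R)) -{2}(subrr l).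
by apply: cvgD => //; apply: cvgB => //; exact: cvg_cst.
Qed.

(** * Bellman operators and greedy policies *)

Section Bellman.
Variables (R : realType) (M : mdp R) (gamma : R).
Local Notation X := (st M).
Local Notation A := (ac M).
Hypothesis gamma01 : 0 <= gamma < 1.

Definition policy (pi : X -> A -> R) : Prop :=
  forall x, (forall a, 0 <= pi x a) /\ (forall a, a \notin acts x -> pi x a = 0)
            /\ \sum_(a in acts x) pi x a = 1.

Definition mean_rew (x : X) (a : A) : R :=
  \sum_y trans x a y * \int[rew x a y]_z z.

Definition qval (v : X -> R) (x : X) (a : A) : R :=
  mean_rew x a + gamma * \sum_y trans x a y * v y.

Definition bellman (pi : X -> A -> R) (v : X -> R) (x : X) : R :=
  \sum_(a in acts x) pi x a * qval v x a.

Definition some_act (x : X) : A := xchoose (set0Pn _ (acts_ne x)).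

Definition best_act (v : X -> R) (x : X) : A :=
  [arg max_(a > some_act x in acts x) qval v x a]%O.

Definition bellman_opt (v : X -> R) (x : X) : R := qval v x (best_act v x).

Definition vpi (pi : X -> A -> R) (x : X) : R :=
  limn (fun n => iter n (bellman pi) (fun=> 0) x).

Definition vopt (x : X) : R :=
  limn (fun n => iter n bellman_opt (fun=> 0) x).

Lemma some_act_in x : some_act x \in acts x.
Proof. exact: xchooseP. Qed.

Lemma best_actP v x :
  best_act v x \in acts x /\ forall a, a \in acts x -> qval v x a <= bellman_opt v x.
Proof.
rewrite /bellman_opt /best_act; case: arg_maxP; first exact: some_act_in.
by move=> a aA amax; split.
Qed.

(** The one-sided form, with [c] of any sign, is what the comparisons of values use; [norm_lip]
    recovers the two-sided contraction from it. *)
Lemma qval_lip v w c x a : a \in acts x -> (forall y, v y - w y <= c) ->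
  qval v x a - qval w x a <= gamma * c.
Proof.
move=> aA vw; have /andP[g0 g1] := gamma01.
rewrite /qval opprD addrACA subrr add0r -mulrBr ler_wpM2l// -sumrB.
rewrite -[leRHS]mul1r -(trans_sum1 aA) mulr_suml ler_sum// => y _.
by rewrite -mulrBr ler_wpM2l// trans_ge0.
Qed.

Lemma bellman_lip pi v w c x : policy pi -> (forall y, v y - w y <= c) ->
  bellman pi v x - bellman pi w x <= gamma * c.
Proof.
move=> /(_ x)[pi0 [_ pi1]] vw; rewrite /bellman -sumrB.
rewrite -[leRHS]mul1r -pi1 mulr_suml ler_sum// => a aA.
by rewrite -mulrBr ler_wpM2l// qval_lip.
Qed.

Lemma bellman_opt_lip v w c x : (forall y, v y - w y <= c) ->
  bellman_opt v x - bellman_opt w x <= gamma * c.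
Proof.
move=> vw; have [aA _] := best_actP v x; have [_ wmax] := best_actP w x.
apply: le_trans (qval_lip aA vw); rewrite /bellman_opt.
by rewrite lerB// wmax.
Qed.

Lemma norm_lip (T : (X -> R) -> X -> R) :
  (forall v w c x, (forall y, v y - w y <= c) -> T v x - T w x <= gamma * c) ->
  forall v w c, (forall x, `|v x - w x| <= c) ->
     forall x, `|T v x - T w x| <= gamma * c.
Proof.
move=> lip v w c vw x; rewrite ler_norml lerNl opprB.
apply/andP; split; apply: lip => y; have := vw y; rewrite ler_norml.
- by rewrite lerNl opprB => /andP[].
- by move=> /andP[].
Qed.

Lemma vpi_cvg pi x : policy pi ->
  (fun n => iter n (bellman pi) (fun=> 0) x) @ \oo --> vpi pi x.
Proof.
move=> ppi; have lip v w c y := @bellman_lip pi v w c y ppi.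
by have [+ _] := contraction_fixpoint (fun=> 0) gamma01 (norm_lip lip); exact.
Qed.

Lemma vpiE pi x : policy pi ->
  vpi pi x = \sum_(a in acts x) pi x a * qval (vpi pi) x a.
Proof.
move=> ppi; have lip v w c y := @bellman_lip pi v w c y ppi.
by have [_ /(_ x)/esym] := contraction_fixpoint (fun=> 0) gamma01 (norm_lip lip).
Qed.

Lemma voptE x : vopt x = bellman_opt vopt x.
Proof.
by have [_ /(_ x)/esym] := contraction_fixpoint (fun=> 0) gamma01 (norm_lip bellman_opt_lip).
Qed.

Lemma qval_le_vopt x a : a \in acts x -> qval vopt x a <= vopt x.
Proof. by move=> aA; rewrite [leRHS]voptE; apply: (best_actP _ _).2. Qed.

Lemma bellman_vopt_le pi x : policy pi -> bellman pi vopt x <= vopt x.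
Proof.
move=> /(_ x)[pi0 [_ pi1]]; rewrite -[leRHS]mul1r -pi1 mulr_suml ler_sum// => a aA.
by rewrite ler_wpM2l// qval_le_vopt.
Qed.

(** Take for [D] the maximum of [u], attained because [X] is finite: then [D <= gamma * D + c]. *)
Lemma le_of_contraction (u : X -> R) c :
  (forall D, (forall x, u x <= D) -> forall x, u x <= gamma * D + c) ->
  forall x, u x <= c / (1 - gamma).
Proof.
move=> H x0; have /andP[g0 g1] := gamma01.
pose x1 := [arg max_(x > x0) u x]%O.
have umax x : u x <= u x1 by rewrite /x1; case: arg_maxP => // y _; exact.
apply: (le_trans (umax x0)); rewrite ler_pdivlMr ?subr_gt0//.
by have := H _ umax x1; lra.
Qed.

Lemma vpi_le_vopt pi x : policy pi -> vpi pi x <= vopt x.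
Proof.
move=> ppi; rewrite -subr_le0 -(mul0r (1 - gamma)^-1).
apply: (le_of_contraction (u := fun x => vpi pi x - vopt x)) => D HD y.
have := bellman_lip y ppi HD; have := bellman_vopt_le y ppi.
by rewrite [in X in _ -> _ -> X](vpiE _ ppi) -/(bellman _ _ _); lra.
Qed.

(** One-step losses add up geometrically: [vopt - vpi] is the loss of one step of [pi] followed by
    [vopt], plus a Bellman image of the same difference. *)
Lemma vopt_vpi_le pi c : policy pi ->
  (forall x, vopt x - bellman pi vopt x <= c) ->
  forall x, vopt x - vpi pi x <= c / (1 - gamma).
Proof.
move=> ppi Hc; apply: (le_of_contraction (u := fun x => vopt x - vpi pi x)) => D HD y.
have := bellman_lip y ppi HD; have := Hc y.
by rewrite [in X in _ -> _ -> X](vpiE _ ppi) -/(bellman _ _ _); lra.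
Qed.

Lemma amaxP (Q : X -> A -> R) x a :
  reflect (a \in acts x /\ forall b, b \in acts x -> Q x b <= Q x a)
    (a \in amax Q x).
Proof.
rewrite inE; apply: (iffP andP) => -[aA h]; split => //.
  by move=> b bA; move/forall_inP: h; exact.
by apply/forall_inP.
Qed.

Lemma card_amax_gt0 (Q : X -> A -> R) x : (0 < #|amax Q x|)%N.
Proof.
apply/card_gt0P; exists [arg max_(a > some_act x in acts x) Q x a]%O.
by apply/amaxP; case: arg_maxP; first exact: some_act_in.
Qed.

Lemma card_acts_gt0 (x : X) : (0 < #|acts x|)%N.
Proof. by apply/card_gt0P; exists (some_act x); exact: some_act_in. Qed.

Lemma sum_pihat e Q x (f : A -> R) :
  \sum_(a in acts x) pihat e Q x a * f a =
  e x / #|acts x|%:R * (\sum_(a in acts x) f a)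
  + (1 - e x) / #|amax Q x|%:R * (\sum_(a in amax Q x) f a).
Proof.
rewrite 2!mulr_sumr [in X in _ + X]big_mkcond/= big_mkcond/= [in X in X + _]big_mkcond/=.
rewrite -big_split/=; apply: eq_bigr => a _; rewrite /pihat.
case: (boolP (a \in acts x)) => aA.
  by case: ifP => _; rewrite ?mul1r ?mul0r ?addr0 ?mulrDl.
by case: ifPn => [/amaxP[]|_]; [rewrite (negbTE aA)|rewrite addr0].
Qed.

Lemma pihat_policy e Q : (forall x, 0 <= e x <= 1) -> policy (pihat e Q).
Proof.
move=> e01 x; have /andP[e0 e1] := e01 x; split => [a|].
  by rewrite /pihat addr_ge0// mulr_ge0 ?ler0n// divr_ge0 ?ler0n ?subr_ge0.
split => [a aA|].
  rewrite /pihat (negbTE aA) mul0r add0r.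
  by case: (boolP (a \in amax _ _)) => [/amaxP[]|]; rewrite ?(negbTE aA)// mul0r.
have := sum_pihat e Q x (fun=> 1).
under eq_bigr do rewrite mulr1.
move=> ->; rewrite !sumr_const !divfK ?pnatr_eq0 -?lt0n ?card_acts_gt0 ?card_amax_gt0//.
by ring.
Qed.

(* One-sided bounds suffice: an action greedy for [Q] loses at most [D + h],
   not twice the distance between [Q] and the optimal action values. *)
Lemma pihat_greedy e Q h D K x : 0 <= e x <= 1 ->
  (forall a, a \in acts x -> Q x a <= qval vopt x a + h) ->
  (forall a, a \in acts x -> qval vopt x a <= Q x a + D) ->
  0 <= D + h -> 0 <= K -> (forall a, a \in acts x -> vopt x - qval vopt x a <= K) ->
  vopt x - bellman (pihat e Q) vopt x <= D + h + e x * K.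
Proof.
move=> e01 Qle Qge Dh K0 HK; have /andP[e0 e1] := e01.
have cA : 0 < (#|acts x|%:R : R) by rewrite ltr0n card_acts_gt0.
have cm : 0 < (#|amax Q x|%:R : R) by rewrite ltr0n card_amax_gt0.
have h1 : (vopt x - K) * #|acts x|%:R <= \sum_(a in acts x) qval vopt x a.
  by rewrite mulr_natr -sumr_const ler_sum// => a aA; have := HK a aA; lra.
have h2 : (vopt x - D - h) * #|amax Q x|%:R <= \sum_(a in amax Q x) qval vopt x a.
  rewrite mulr_natr -sumr_const ler_sum// => a /amaxP[aA am].
  (* The optimal action is the competitor: [Q] underrates it by at most [D], overrates the greedy
     action by at most [h], and ranks the greedy one no lower. *)
  have [bA _] := best_actP vopt x.
  have := am _ bA; have := Qge _ bA; have := Qle _ aA.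
  by rewrite -/(bellman_opt vopt x) -voptE; lra.
rewrite /bellman sum_pihat.
have e3 : 0 <= e x / #|acts x|%:R by rewrite divr_ge0// ltW.
have e4 : 0 <= (1 - e x) / #|amax Q x|%:R by rewrite divr_ge0 ?subr_ge0// ltW.
move: (ler_wpM2l e3 h1) (ler_wpM2l e4 h2).
have cancel (p n v : R) : 0 < n -> p / n * (v * n) = p * v.
  by move=> n0; rewrite (mulrC v) mulrA divfK// gt_eqF.
rewrite !cancel//.
(* The greedy loss carries the weight [1 - e x], rounded up to 1 in the bound; this is where [D + h]
   must be nonnegative. *)
have := mulr_ge0 e0 Dh.
by lra.
Qed.

Lemma near_acts (P : nat -> X -> A -> Prop) :
  (forall x a, a \in acts x -> \forall k \near \oo, P k x a) ->
  \forall k \near \oo, forall x a, a \in acts x -> P k x a.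
Proof.
move=> H; apply: filter_forall => x; apply: filter_forall => a.
case: (boolP (a \in acts x)) => aA; last by apply: nearW.
by apply: filterS (H _ _ aA) => k.
Qed.

Lemma averaging_near_le (U G b : nat -> X -> A -> R) (L : X -> A -> R) :
  (forall k x a, a \in acts x -> 0 <= b k x a <= 1) ->
  (forall x a, a \in acts x ->
     forall k (B : R), exists n, B <= \sum_(k <= i < k + n) b i x a) ->
  (forall k x a, a \in acts x ->
     U k.+1 x a = (1 - b k x a) * U k x a + b k x a * G k x a) ->
  (forall h : R, 0 < h -> \forall k \near \oo, forall x a, a \in acts x ->
     G k x a <= L x a + h) ->
  forall h : R, 0 < h -> \forall k \near \oo, forall x a, a \in acts x ->
     U k x a <= L x a + h.
Proof.
move=> b01 bdiv Urec GL h h0; apply: near_acts => x a aA.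
have b01' k : 0 <= b k x a <= 1 by exact: b01.
apply: (averaging_limsup_le (u := fun k => U k x a) b01' (bdiv x a aA)) => // d d0.
apply: filterS (GL d d0) => k /(_ x a aA) Hk; rewrite Urec//.
by rewrite lerD2l ler_wpM2l//; case/andP: (b01' k).
Qed.

(** * Deterministic convergence of the greedy iteration *)

Section GreedyIteration.
Variables (Q m b : nat -> X -> A -> R) (e : nat -> X -> R).
Hypothesis gamma_half : gamma < 1 / 2.
Hypothesis e01 : forall k x, 0 <= e k x <= 1.
Hypothesis e_cvg0 : forall x, (fun k => e k x) @ \oo --> 0.
Hypothesis b01 : forall k x a, a \in acts x -> 0 <= b k x a <= 1.
Hypothesis bdiv : forall x a, a \in acts x ->
  forall k (B : R), exists n, B <= \sum_(k <= i < k + n) b i x a.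
Let pi k := pihat (e k) (Q k).
Hypothesis Qrec : forall k x a, a \in acts x ->
  Q k.+1 x a = (1 - b k x a) * Q k x a
               + b k x a * (qval (vpi (pi k)) x a + m k x a).
Hypothesis noise_cvg : forall x a, a \in acts x ->
  cvgn (series (fun k => b k x a * m k x a)).

(** The response of the averaging recursion to the noise alone. Both recursions are linear with the
    same weights, so [Q - noise] averages the true action values. *)
Fixpoint noise (k : nat) (x : X) (a : A) : R :=
  if k is k'.+1 then (1 - b k' x a) * noise k' x a + b k' x a * m k' x a else 0.

Lemma noise_near_le h : 0 < h ->
  \forall k \near \oo, forall x a, a \in acts x -> `|noise k x a| <= h.
Proof.
move=> h0; apply: near_acts => x a aA.
have : (fun k => noise k x a) @ \oo --> 0.
  apply: (averaged_noise_cvg0 (b := fun k => b k x a) (m := fun k => m k x a)) => //.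
  - by move=> k; exact: b01.
  - exact: bdiv.
  - exact: noise_cvg.
by move=> /cvgr0Pnorm_le; exact.
Qed.

Let U k x a := Q k x a - noise k x a.

Let Urec k x a : a \in acts x ->
  U k.+1 x a = (1 - b k x a) * U k x a + b k x a * qval (vpi (pi k)) x a.
Proof. by move=> aA; rewrite /U Qrec//=; ring. Qed.

Let NUrec k x a : a \in acts x ->
  - U k.+1 x a = (1 - b k x a) * - U k x a + b k x a * - qval (vpi (pi k)) x a.
Proof. by move=> aA; rewrite Urec//; ring. Qed.

Let pi_policy k : policy (pi k).
Proof. by apply: pihat_policy => x; exact: e01. Qed.

Lemma greedy_upper h : 0 < h ->
  \forall k \near \oo, forall x a, a \in acts x -> Q k x a <= qval vopt x a + h.
Proof.
move=> h0; have h2 : 0 < h / 2 by rewrite divr_gt0.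
have HU : \forall k \near \oo, forall x a, a \in acts x ->
    U k x a <= qval vopt x a + h / 2.
  apply: (averaging_near_le b01 bdiv Urec) => // d d0.
  apply: nearW => k x a aA.
  have : forall y, vpi (pi k) y - vopt y <= 0.
    by move=> y; rewrite subr_le0 vpi_le_vopt.
  by move=> /(qval_lip aA); rewrite mulr0; lra.
apply: filterS2 HU (noise_near_le h2) => k H1 H2 x a aA.
have := H1 x a aA; have := H2 x a aA; rewrite /U ler_norml => /andP[_].
by lra.
Qed.

(** Every gap is nonnegative, so the sum is a common bound on the loss of an admissible action. *)
Let K := \sum_x \sum_(a in acts x) (vopt x - qval vopt x a).

Let K_ge x a : a \in acts x -> vopt x - qval vopt x a <= K.
Proof.
move=> aA; rewrite /K (bigD1 x)//= (bigD1 a)//= -addrA lerDl addr_ge0//.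
  by apply: sumr_ge0 => c /andP[cA _]; rewrite subr_ge0 qval_le_vopt.
by apply: sumr_ge0 => y _; apply: sumr_ge0 => c cA; rewrite subr_ge0 qval_le_vopt.
Qed.

Let K0 : 0 <= K.
Proof.
by apply: sumr_ge0 => y _; apply: sumr_ge0 => c cA; rewrite subr_ge0 qval_le_vopt.
Qed.

(** Here [D] bounds the limsup of the amount by which [Q] underrates an action; the slack [h]
    absorbs the vanishing noise and exploration. *)
Let asymp_lower (D : R) := forall h : R, 0 < h ->
  \forall k \near \oo, forall x a, a \in acts x -> qval vopt x a <= Q k x a + (D + h).

Lemma greedy_value_near D h : asymp_lower D -> 0 <= D -> 0 < h ->
  \forall k \near \oo, forall x, vopt x - vpi (pi k) x <= (D + h) / (1 - gamma).
Proof.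
(* Three shares of [h]: exploration, overrating by [Q], underrating by [Q]. *)
move=> low D0 h0; have h3 : 0 < h / 3 by rewrite divr_gt0.
have eK : \forall k \near \oo, forall x, e k x * K <= h / 3.
  apply: filter_forall => x.
  have /cvgr0Pnorm_le/(_ _ h3) : (fun k => e k x * K) @ \oo --> 0.
    by rewrite -(mul0r K); apply: cvgM; [exact: e_cvg0|exact: cvg_cst].
  by apply: filterS => k; apply: le_trans; exact: ler_norm.
apply: filterS3 eK (greedy_upper h3) (low _ h3) => k H1 H2 H3.
apply: vopt_vpi_le => // x.
have Dh : 0 <= D + h / 3 + h / 3 by lra.
have := pihat_greedy (@e01 k x) (H2 x) (H3 x) Dh K0 (@K_ge x).
by have := H1 x; rewrite -/(pi k); lra.
Qed.

Lemma greedy_lower_step D : 0 <= D -> asymp_lower D ->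
  asymp_lower (gamma / (1 - gamma) * D).
Proof.
move=> D0 low h h0; have h2 : 0 < h / 2 by rewrite divr_gt0.
have HU : \forall k \near \oo, forall x a, a \in acts x ->
    - U k x a <= (- qval vopt x a + gamma / (1 - gamma) * D) + h / 2.
  apply: (averaging_near_le b01 bdiv NUrec) => // d d0.
  apply: filterS (greedy_value_near low D0 d0) => k Hk x a aA.
  have := qval_lip aA Hk.
  have g0 : 0 < 1 - gamma by rewrite subr_gt0; case/andP: gamma01.
  have : gamma * ((D + d) / (1 - gamma)) <= gamma / (1 - gamma) * D + d.
    (* At this point the bound on [gamma] only prevents the slack [d] from being amplified; the
       strict inequality acts when the step is iterated. *)
    have c1 : gamma / (1 - gamma) <= 1 by rewrite ler_pdivrMr//; move: gamma_half; lra.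
    have -> : gamma * ((D + d) / (1 - gamma))
      = gamma / (1 - gamma) * D + gamma / (1 - gamma) * d by ring.
    by rewrite lerD2l ler_piMl// ltW.
  by lra.
apply: filterS2 HU (noise_near_le h2) => k H1 H2 x a aA.
have := H1 x a aA; have := H2 x a aA; rewrite /U ler_norml => /andP[+ _].
by lra.
Qed.

(** A crude start valid for every policy: one step loses at most [K], hence the value at most
    [K / (1 - gamma)]. *)
Lemma greedy_lower_base : asymp_lower (K / (1 - gamma)).
Proof.
move=> h h0; have h2 : 0 < h / 2 by rewrite divr_gt0.
have g0 : 0 < 1 - gamma by rewrite subr_gt0; case/andP: gamma01.
have HU : \forall k \near \oo, forall x a, a \in acts x ->
    - U k x a <= (- qval vopt x a + K / (1 - gamma)) + h / 2.
  apply: (averaging_near_le b01 bdiv NUrec) => // d d0.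
  apply: nearW => k x a aA.
  have : forall y, vopt y - vpi (pi k) y <= K / (1 - gamma).
    apply: vopt_vpi_le => // y.
    have [pi0 [_ pi1]] := pi_policy k y.
    rewrite -[X in X - _]mul1r -pi1 mulr_suml -sumrB -[leRHS]mul1r -pi1 mulr_suml.
    by apply: ler_sum => c cA; rewrite -mulrBr ler_wpM2l// K_ge.
  move=> /(qval_lip aA).
  have : gamma * (K / (1 - gamma)) <= K / (1 - gamma).
    apply: ler_piMl; first by rewrite divr_ge0// ltW.
    by apply: ltW; case/andP: gamma01.
  by lra.
apply: filterS2 HU (noise_near_le h2) => k H1 H2 x a aA.
have := H1 x a aA; have := H2 x a aA; rewrite /U ler_norml => /andP[+ _].
by lra.
Qed.

Lemma greedy_iteration_cvg x : (fun k => vpi (pi k) x) @ \oo --> vopt x.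
Proof.
have /andP[g0 g1] := gamma01; have g2 : 0 < 1 - gamma by lra.
have c0 : 0 <= gamma / (1 - gamma) by rewrite divr_ge0// ltW.
have c1 : gamma / (1 - gamma) < 1 by rewrite ltr_pdivrMr//; move: gamma_half; lra.
have B0 : 0 <= K / (1 - gamma) by rewrite divr_ge0// ltW.
have lown n : asymp_lower ((gamma / (1 - gamma)) ^+ n * (K / (1 - gamma))).
  elim: n => [|n IH]; first by rewrite expr0 mul1r; exact: greedy_lower_base.
  by rewrite exprS -mulrA; apply: greedy_lower_step => //; rewrite mulr_ge0// exprn_ge0.
(* For a given tolerance, finitely many improvements bring the bound below [h / 2], so only one of
   the asymptotic bounds is used at a time. *)
have low0 : asymp_lower 0.
  move=> h h0; have h2 : 0 < h / 2 by rewrite divr_gt0.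
  have : geometric (K / (1 - gamma)) (gamma / (1 - gamma)) @ \oo --> 0.
    by apply: cvg_geometric; rewrite ger0_norm.
  move=> /cvgr0Pnorm_le/(_ _ h2)[N _ /(_ N (leqnn N))] /=.
  rewrite mulrC => /(le_trans (ler_norm _)) HN.
  apply: filterS (lown N _ h2) => k Hk y a aA.
  by have := Hk y a aA; lra.
apply/cvgrPdist_le => d d0.
have dg : 0 < d * (1 - gamma) by rewrite mulr_gt0.
apply: filterS (greedy_value_near low0 (lexx 0) dg) => k /(_ x).
rewrite add0r mulfK ?gt_eqF// ger0_norm//.
by rewrite subr_ge0 vpi_le_vopt.
Qed.

End GreedyIteration.
End Bellman.

(** * Expectations *)

Section MeasWrt.
Context {R : realType} {d : measure_display} {Omega : measurableType d}.
Implicit Types (F G : set (set Omega)) (f g : Omega -> R).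

(** Reading [F] as the sigma-algebra of [g_sigma_algebraType F] makes the closure properties of
    measurable functions available for every sub-sigma-algebra. *)
Lemma meas_wrtP F f : sigma_algebra setT F ->
  meas_wrt F f <-> measurable_fun setT (f : g_sigma_algebraType F -> R).
Proof.
move=> sF; split=> [mf _ D mD|mf D mD].
  by rewrite setTI; apply: sub_sigma_algebra; exact: mf.
by rewrite -(sigma_algebra_id sF) -[_ @^-1` _]setTI; exact: mf.
Qed.

Lemma meas_wrt_measurable f :
  meas_wrt (@measurable _ Omega) f <-> measurable_fun setT f.
Proof.
split=> [mf _ D mD|mf D mD]; first by rewrite setTI; exact: mf.
by rewrite -[_ @^-1` _]setTI; exact: mf.
Qed.

Lemma meas_wrtS F G f : F `<=` G -> meas_wrt F f -> meas_wrt G f.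
Proof. by move=> FG mf D mD; apply: FG; exact: mf. Qed.

Section Closure.
Variable F : set (set Omega).
Hypothesis sF : sigma_algebra setT F.

Lemma sigma_setT : F setT.
Proof. by case: sF => F0 FC _; rewrite -(setD0 setT); exact: FC. Qed.

Lemma sigma_setC A : F A -> F (~` A).
Proof. by case: sF => _ FC _ /FC; rewrite setTD. Qed.

Lemma sigma_setI A B : F A -> F B -> F (A `&` B).
Proof.
rewrite -(sigma_algebra_id sF) => FA FB.
exact: (@measurableI _ (g_sigma_algebraType F)).
Qed.

Lemma sigma_setU A B : F A -> F B -> F (A `|` B).
Proof.
rewrite -(sigma_algebra_id sF) => FA FB.
exact: (@measurableU _ (g_sigma_algebraType F)).
Qed.

Lemma sigma_setD A B : F A -> F B -> F (A `\` B).
Proof. by rewrite setDE => FA FB; apply: sigma_setI => //; exact: sigma_setC. Qed.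

Lemma meas_wrt_cst (c : R) : meas_wrt F (fun=> c).
Proof. by apply/(meas_wrtP _ sF). Qed.

Lemma meas_wrtD f g : meas_wrt F f -> meas_wrt F g -> meas_wrt F (fun w => f w + g w).
Proof.
by move=> /(meas_wrtP _ sF) mf /(meas_wrtP _ sF) mg; apply/(meas_wrtP _ sF)/measurable_funD.
Qed.

Lemma meas_wrtB f g : meas_wrt F f -> meas_wrt F g -> meas_wrt F (fun w => f w - g w).
Proof.
by move=> /(meas_wrtP _ sF) mf /(meas_wrtP _ sF) mg; apply/(meas_wrtP _ sF)/measurable_funB.
Qed.

Lemma meas_wrtM f g : meas_wrt F f -> meas_wrt F g -> meas_wrt F (fun w => f w * g w).
Proof.
by move=> /(meas_wrtP _ sF) mf /(meas_wrtP _ sF) mg; apply/(meas_wrtP _ sF)/measurable_funM.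
Qed.

Lemma meas_wrt_indic A : F A -> meas_wrt F (\1_A : Omega -> R).
Proof.
move=> FA; apply/(meas_wrtP _ sF); apply: measurable_indic.
exact: sub_sigma_algebra.
Qed.

Lemma meas_wrt_sum I (s : seq I) (p : pred I) (h : I -> Omega -> R) :
  (forall i, p i -> meas_wrt F (h i)) ->
  meas_wrt F (fun w => \sum_(i <- s | p i) h i w).
Proof.
move=> mh; elim: s => [|i s IH].
  by under eq_fun do rewrite big_nil; exact: meas_wrt_cst.
under eq_fun do rewrite big_cons.
by have := mh i; case: (p i) => // /(_ isT) mhi; apply: meas_wrtD.
Qed.

Lemma meas_wrt_cvg (h : nat -> Omega -> R) f : (forall n, meas_wrt F (h n)) ->
  (forall w, (fun n => h n w) @ \oo --> f w) -> meas_wrt F f.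
Proof.
move=> mh hf; apply/(meas_wrtP _ sF); apply: (@measurable_fun_cvg _ (g_sigma_algebraType F) R setT h f).
  by move=> n; apply/(meas_wrtP _ sF).
by move=> w _; exact: hf.
Qed.

Lemma meas_wrt_ler f g : meas_wrt F f -> meas_wrt F g -> F [set w | f w <= g w].
Proof.
move=> mf mg; have : F ((fun w => g w - f w) @^-1` `[0, +oo[%classic).
  by apply: (meas_wrtB mg mf).
congr (F _); apply/seteqP; split=> w /=; by rewrite in_itv/= andbT subr_ge0.
Qed.

Lemma meas_wrt_ltr f g : meas_wrt F f -> meas_wrt F g -> F [set w | f w < g w].
Proof.
move=> mf mg; rewrite (_ : [set _ | _] = ~` [set w | g w <= f w]).
  by apply: sigma_setC; exact: meas_wrt_ler.
by apply/seteqP; split=> w /=; rewrite ltNge => /negP.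
Qed.

Lemma meas_wrt_norm f : meas_wrt F f -> meas_wrt F (fun w => `|f w|).
Proof.
move=> /(meas_wrtP _ sF) mf; apply/(meas_wrtP _ sF).
exact: (measurableT_comp (@normr_measurable R setT) mf).
Qed.

End Closure.

Lemma sigma_algebra_gen (G : set (set Omega)) : sigma_algebra setT <<s G >>.
Proof. exact: smallest_sigma_algebra. Qed.

End MeasWrt.

(** * Integrals against bounded multipliers *)

Section Expectation.
Context {R : realType} {d : measure_display} {Omega : measurableType d}.
Variable P : probability Omega R.
Implicit Types (F : set (set Omega)) (f g M Z : Omega -> R).

Definition L1 f := P.-integrable setT (EFin \o f).
Definition bnd f := exists c, forall w, `|f w| <= c.

Lemma bnd_cst c : bnd (fun=> c). Proof. by exists `|c|. Qed.

Lemma bndM f g : bnd f -> bnd g -> bnd (fun w => f w * g w).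
Proof.
move=> [a fa] [b gb]; exists (a * b) => w; rewrite normrM ler_pM//.
Qed.

Lemma bndD f g : bnd f -> bnd g -> bnd (fun w => f w + g w).
Proof.
move=> [a fa] [b gb]; exists (a + b) => w.
by rewrite (le_trans (ler_normD _ _))// lerD.
Qed.

Lemma bnd_sum I (s : seq I) (p : pred I) (h : I -> Omega -> R) :
  (forall i, p i -> bnd (h i)) -> bnd (fun w => \sum_(i <- s | p i) h i w).
Proof.
move=> mh; elim: s => [|i s IH].
  by under eq_fun do rewrite big_nil; exact: bnd_cst.
under eq_fun do rewrite big_cons.
by have := mh i; case: (p i) => // /(_ isT) mhi; apply: bndD.
Qed.

Lemma bnd_indic A : bnd (\1_A : Omega -> R).
Proof. by exists 1 => w; rewrite indicE; case: (w \in A); rewrite ?normr1 ?normr0. Qed.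

Lemma bnd_bounded f : bnd f -> [bounded f x | x in [set: Omega]].
Proof.
move=> [c fc]; exists c; split; first exact: num_real.
by move=> x cx w _; exact: (le_trans (fc w) (ltW cx)).
Qed.

Lemma L1_measurable f : L1 f -> measurable_fun setT f.
Proof. by move=> /measurable_int /measurable_EFinP. Qed.

Lemma L1_bnd f : measurable_fun setT f -> bnd f -> L1 f.
Proof.
move=> mf bf; apply: measurable_bounded_integrable => //.
  by rewrite [X in (X < _)%E](@probability_setT _ _ _ P) ltry.
exact: bnd_bounded.
Qed.

Lemma L1M f g : measurable_fun setT f -> bnd f -> L1 g -> L1 (fun w => f w * g w).
Proof.
move=> mf bf ig; have := integrableMr measurableT mf (bnd_bounded bf) ig.
by apply: eq_integrable => // w _.
Qed.

Lemma L1D f g : L1 f -> L1 g -> L1 (fun w => f w + g w).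
Proof. by move=> f1 g1; have := integrableD measurableT f1 g1; apply: eq_integrable. Qed.

Lemma L1B f g : L1 f -> L1 g -> L1 (fun w => f w - g w).
Proof. by move=> f1 g1; have := integrableB measurableT f1 g1; apply: eq_integrable. Qed.

Lemma L1Z c f : L1 f -> L1 (fun w => c * f w).
Proof. by move=> f1; have := integrableZl measurableT c f1; apply: eq_integrable. Qed.

Lemma L1_sum I (s : seq I) (p : pred I) (h : I -> Omega -> R) :
  (forall i, p i -> L1 (h i)) -> L1 (fun w => \sum_(i <- s | p i) h i w).
Proof.
move=> mh; elim: s => [|i s IH].
  by under eq_fun do rewrite big_nil; apply: L1_bnd => //; exact: bnd_cst.
under eq_fun do rewrite big_cons.
by have := mh i; case: (p i) => // /(_ isT) mhi; apply: L1D.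
Qed.

Lemma L1_norm f : L1 f -> L1 (fun w => `|f w|).
Proof. exact: integrable_norm. Qed.

Lemma L1_le f g : measurable_fun setT f -> (forall w, `|f w| <= g w) -> L1 g -> L1 f.
Proof.
move=> mf fg; apply: le_integrable => //; first exact/measurable_EFinP.
by move=> w _ /=; rewrite lee_fin (le_trans (fg w)) ?ler_norm.
Qed.

Lemma Rint_sum I (s : seq I) (p : pred I) (h : I -> Omega -> R) :
  (forall i, p i -> L1 (h i)) ->
  \int[P]_w (\sum_(i <- s | p i) h i w) = \sum_(i <- s | p i) \int[P]_w h i w.
Proof.
move=> mh; elim: s => [|i s IH].
  under eq_fun do rewrite big_nil.
  by rewrite big_nil Rintegral_cst// mul0r.
under eq_fun do rewrite big_cons.
rewrite big_cons; have := mh i; case: (p i) => // /(_ isT) mhi.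
by rewrite RintegralD// ?IH//; exact: L1_sum.
Qed.

Lemma Rint_cst (c : R) : \int[P]_w c = c.
Proof. by rewrite Rintegral_cst// [X in fine X](@probability_setT _ _ _ P) mulr1. Qed.

Lemma Rint_indic A f : measurable A ->
  \int[P]_w (\1_A w * f w) = \int[P]_(w in A) f w.
Proof.
move=> mA; rewrite [RHS]Rintegral_mkcond; congr Rintegral; apply/funext => w.
by rewrite patchE indicE; case: ifP => _; rewrite ?mul1r ?mul0r.
Qed.

Lemma Rint_indic1 A : measurable A -> \int[P]_w \1_A w = fine (P A).
Proof.
move=> mA; have := Rint_indic (fun=> 1) mA.
by under eq_Rintegral do rewrite mulr1; move=> ->; rewrite Rintegral_cst// mul1r.
Qed.

(* Layer-cake discretisation of [z] with mesh [h]. *)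
Lemma discretize (z h : R) (N : nat) : 0 <= z -> 0 < h -> z <= N%:R * h ->
  `|z - h * \sum_(i < N) (i.+1%:R * h <= z)%R%:R| <= h.
Proof.
move=> z0 h0 zN; pose S n : R := \sum_(i < n) (i.+1%:R * h <= z)%R%:R.
have Sle n : S n <= n%:R.
  rewrite /S -[n in leRHS]card_ord -sumr_const ler_sum// => i _.
  by case: (_ <= z).
have Srec n : S n.+1 = S n + (n.+1%:R * h <= z)%R%:R by rewrite /S big_ord_recr.
(* Either the first [n] levels all lie below [z], or the sum is already within [h] of [z]. *)
have H n : h * S n <= z /\ (n%:R * h <= h * S n \/ z - h <= h * S n).
  elim: n => [|n [IH1 IH2]].
    by rewrite /S big_ord0 mulr0; split => //; left; rewrite mul0r.
  have Sn : h * S n <= h * n%:R by rewrite ler_wpM2l// ltW.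
  rewrite Srec; case: (leP (n.+1%:R * h) z) => nz; rewrite /= ?mulr1n ?mulr0n.
    rewrite -(natr1 n) in nz *; split; first by lra.
    by left; case: IH2; lra.
  by rewrite addr0; split => //; right; rewrite -(natr1 n) in nz; case: IH2; lra.
rewrite -/(S N); have [H1 H2] := H N.
by rewrite ger0_norm ?subr_ge0//; case: H2; lra.
Qed.

(** The inequality passes from events to nonnegative combinations of indicators of level sets of
    [Z]; these approximate [Z] uniformly within [h], at a cost of [h] times the integral of
    [|M|]. *)
Lemma Rint_mul_le0 F Z M : sigma_algebra setT F -> F `<=` measurable ->
  meas_wrt F Z -> (forall w, 0 <= Z w) -> bnd Z -> L1 M ->
  (forall B, F B -> \int[P]_(w in B) M w <= 0) ->
  \int[P]_w (Z w * M w) <= 0.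
Proof.
move=> sF Fm mZ Z0 [c Zc] M1 M0.
have c0 : 0 <= c by apply: le_trans (Zc point).
have mZ' : measurable_fun setT Z by apply/meas_wrt_measurable; exact: meas_wrtS mZ.
pose K := \int[P]_w `|M w|.
have K0 : 0 <= K by apply: Rintegral_ge0.
apply/ler_addgt0Pl => e e0; rewrite addr0.
pose h := e / (K + 1).
have h0 : 0 < h by rewrite divr_gt0// ltr_wpDl.
pose N := Num.bound (c / h).
have zN : c <= N%:R * h.
  by rewrite -ler_pdivrMr//; apply: ltW; apply: archi_boundP; rewrite divr_ge0// ltW.
pose A i := [set w | i.+1%:R * h <= Z w].
have FA i : F (A i) by apply: meas_wrt_ler => //; exact: meas_wrt_cst.
have mA i : measurable (A i) by apply: Fm; exact: FA.
have iA i : L1 (fun w => \1_(A i) w * M w) by apply: L1M => //; exact: bnd_indic.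
pose Zh w := h * \sum_(i < N) \1_(A i) w.
have ZhE w : Zh w = h * \sum_(i < N) (i.+1%:R * h <= Z w)%R%:R.
  congr (_ * _); apply: eq_bigr => i _; rewrite indicE.
  by case: (boolP (_ <= _)) => H; [rewrite mem_set|rewrite memNset//; apply/negP].
have Zhd w : `|Z w - Zh w| <= h.
  rewrite ZhE; apply: discretize => //.
  exact: le_trans (ler_norm _) (le_trans (Zc w) zN).
have I0 : \int[P]_w (Zh w * M w) <= 0.
  rewrite /Zh; under eq_Rintegral do rewrite -mulrA mulr_suml.
  rewrite RintegralZl//; last by apply: L1_sum => i _; exact: iA.
  rewrite Rint_sum// mulr_ge0_le0 ?(ltW h0)// sumr_le0// => i _.
  by rewrite Rint_indic// M0.
have mZh : measurable_fun setT Zh.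
  by apply: measurable_funM => //; apply: measurable_sum => i; exact: measurable_indic.
have bZh : bnd Zh.
  by apply: bndM; [exact: bnd_cst|apply: bnd_sum => i _; exact: bnd_indic].
have LZ : L1 (fun w => Z w * M w) by apply: L1M => //; exists c.
have LZh : L1 (fun w => Zh w * M w) by exact: L1M.
have LhM : L1 (fun w => h * `|M w|) by apply: L1Z; exact: L1_norm.
have : \int[P]_w (Z w * M w) <= \int[P]_w (Zh w * M w + h * `|M w|).
  apply: le_Rintegral => //; first exact: L1D.
  move=> w _; rewrite -lerBlDl -mulrBl (le_trans (ler_norm _))// normrM.
  by rewrite ler_wpM2r.
rewrite RintegralD// RintegralZl//; last exact: L1_norm.
rewrite -/K => /le_trans; apply; rewrite -[leRHS]add0r lerD//.
rewrite /h mulrAC ler_pdivrMr ?ltr_wpDl// ler_wpM2l ?ltW//.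
by rewrite ltrDl.
Qed.

(** Adding its bound [c] makes [Z] nonnegative and changes nothing, because [M] integrates to 0 over
    the whole space; the one-sided lemma then applies to [M] and to [- M]. *)
Lemma Rint_mul_eq0 F Z M : sigma_algebra setT F -> F `<=` measurable ->
  meas_wrt F Z -> bnd Z -> L1 M ->
  (forall B, F B -> \int[P]_(w in B) M w = 0) ->
  \int[P]_w (Z w * M w) = 0.
Proof.
move=> sF Fm mZ bZ M1 M0; have [c Zc] := bZ.
have mZc : meas_wrt F (fun w => Z w + c).
  by apply: meas_wrtD => //; exact: meas_wrt_cst.
have Zc0 w : 0 <= Z w + c by have := Zc w; rewrite ler_norml; lra.
have bZc : bnd (fun w => Z w + c) by apply: bndD => //; exact: bnd_cst.
have mZ' : measurable_fun setT Z by apply/meas_wrt_measurable; exact: meas_wrtS mZ.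
have MT : \int[P]_w M w = 0 by apply: M0; exact: sigma_setT.
have ZM s : \int[P]_w ((Z w + c) * (s * M w)) = s * \int[P]_w (Z w * M w).
  transitivity (\int[P]_w (s * (Z w * M w) + (s * c) * M w)).
    by apply: eq_Rintegral => w _; ring.
  by rewrite RintegralD ?RintegralZl ?MT ?mulr0 ?addr0//; do ?[exact: L1Z|exact: L1M|apply: L1Z].
have Zs s : s * \int[P]_w (Z w * M w) <= 0.
  rewrite -ZM; apply: (Rint_mul_le0 sF) => //; first exact: L1Z.
  move=> B FB; rewrite RintegralZl ?M0 ?mulr0//; first exact: Fm.
  by apply: integrableS M1 => //; exact: Fm.
by apply/eqP; rewrite eq_le; have := Zs 1; have := Zs (-1); rewrite mul1r mulN1r oppr_le0 => -> ->.
Qed.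

Lemma Rint_mul_le F Z M C : sigma_algebra setT F -> F `<=` measurable ->
  meas_wrt F Z -> (forall w, 0 <= Z w) -> bnd Z -> L1 M ->
  (forall B, F B -> \int[P]_(w in B) M w <= C * fine (P B)) ->
  \int[P]_w (Z w * M w) <= C * \int[P]_w Z w.
Proof.
move=> sF Fm mZ Z0 bZ M1 MC.
have mZ' : measurable_fun setT Z by apply/meas_wrt_measurable; exact: meas_wrtS mZ.
have LC : L1 (fun=> C) by apply: L1_bnd => //; exact: bnd_cst.
have := @Rint_mul_le0 F Z (fun w => M w - C) sF Fm mZ Z0 bZ (L1B M1 LC).
have -> : \int[P]_w (Z w * (M w - C)) = \int[P]_w (Z w * M w) - C * \int[P]_w Z w.
  transitivity (\int[P]_w (Z w * M w - C * Z w)).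
    by apply: eq_Rintegral => w _; ring.
  rewrite RintegralB ?RintegralZl//.
  - exact: L1_bnd.
  - exact: L1M.
  - by apply: L1Z; exact: L1_bnd.
rewrite subr_le0; apply => B FB; have mB := Fm _ FB.
rewrite RintegralB//.
- by rewrite Rintegral_cst// subr_le0 MC.
- by apply: integrableS M1.
- by apply: integrableS LC.
Qed.

End Expectation.

(** * Convergence of martingale transforms *)

Section MartingaleTransform.
Context {R : realType} {d : measure_display} {Omega : measurableType d}.
Variable P : probability Omega R.
(** [H k] lies between [F k] and [F k.+1] and is what the weight of step [k] may depend on. In the
    application [F k] is the past and [H k] adds the current episode up to its visit. *)
Variables (F H : nat -> set (set Omega)) (M : nat -> Omega -> R) (C : R).
Hypothesis sF : forall k, sigma_algebra setT (F k).
Hypothesis sH : forall k, sigma_algebra setT (H k).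
Hypothesis Fm : forall k, F k `<=` measurable.
Hypothesis FH : forall k, F k `<=` H k.
Hypothesis HF : forall k, H k `<=` F k.+1.
Hypothesis MF : forall k, meas_wrt (F k.+1) (M k).
Hypothesis M1 : forall k, L1 P (M k).
Hypothesis M2 : forall k, L1 P (fun w => M k w ^+ 2).
Hypothesis M_centered : forall k B, H k B -> \int[P]_(w in B) M k w = 0.
Hypothesis M_var : forall k B, H k B ->
  \int[P]_(w in B) M k w ^+ 2 <= C * fine (P B).

Let Hm k : H k `<=` measurable.
Proof. by apply: subset_trans (@Fm k.+1); exact: HF. Qed.

Let FS k : F k `<=` F k.+1.
Proof. by apply: subset_trans (@HF k); exact: FH. Qed.

Section Truncated.
Variables (c : nat -> Omega -> R) (K : R).
Hypothesis cH : forall k, meas_wrt (H k) (c k).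
Hypothesis c01 : forall k w, 0 <= c k w <= 1.
Hypothesis cK : forall n w, \sum_(i < n) c i w ^+ 2 <= K.

(* The transform started at time [m] and frozen once it leaves [-e, e]: the
   multiplier of each increment is then bounded, and the frozen walk ends
   outside [-e, e] as soon as the original one ever does. *)
Fixpoint walk (m : nat) (e : R) (n : nat) (w : Omega) : R :=
  if n is n'.+1 then
    walk m e n' w + (`|walk m e n' w| < e)%R%:R * (c (m + n') w * M (m + n') w)
  else 0.

Let frozen m e n w : R := (`|walk m e n w| < e)%R%:R.

Let frozen_indic m e n : frozen m e n = \1_[set w | `|walk m e n w| < e].
Proof.
apply/funext => w; rewrite /frozen indicE.
by case: (boolP (_ < _)) => h; [rewrite mem_set|rewrite memNset//; exact/negP].
Qed.

Let frozen_meas m e n k : meas_wrt (F k) (walk m e n) -> meas_wrt (F k) (frozen m e n).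
Proof.
move=> mw; rewrite frozen_indic; apply: meas_wrt_indic => //.
by apply: meas_wrt_ltr => //; [exact: meas_wrt_norm|exact: meas_wrt_cst].
Qed.

Let cF k : meas_wrt (F k.+1) (c k).
Proof. exact: meas_wrtS (@HF k) _. Qed.

Lemma walk_meas m e n : meas_wrt (F (m + n)) (walk m e n).
Proof.
elim: n => [|n IH]; first by apply: meas_wrt_cst.
rewrite addnS; have IH' := meas_wrtS (@FS _) IH.
apply: meas_wrtD => //; apply: meas_wrtM => //; first exact: frozen_meas.
by apply: meas_wrtM => //.
Qed.

Let meas_F k (f : Omega -> R) : meas_wrt (F k) f -> measurable_fun setT f.
Proof. by move=> mf; apply/meas_wrt_measurable; apply: meas_wrtS mf; exact: Fm. Qed.

Let c_bnd k : bnd (c k).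
Proof. by exists 1 => w; have /andP[c0 c1] := c01 k w; rewrite ger0_norm. Qed.

Let frozen_bnd m e n : bnd (frozen m e n).
Proof. by rewrite frozen_indic; exact: bnd_indic. Qed.

Let frozen_walk_bnd m e n : bnd (fun w => walk m e n w * frozen m e n w).
Proof.
exists `|e| => w; rewrite /frozen; case: ltP => h; last by rewrite mulr0 normr0.
by rewrite mulr1 (le_trans (ltW h))// ler_norm.
Qed.

(** Orthogonality of the increments: the cross term has the [H k]-measurable multiplier [Z], bounded
    because the walk is at most [e] in absolute value wherever it still moves. *)
Lemma walk_square m e n : L1 P (fun w => walk m e n w ^+ 2) /\
  \int[P]_w walk m e n w ^+ 2
    <= C * \sum_(i < n) \int[P]_w c (m + i) w ^+ 2.
Proof.
elim: n => [|n [IH1 IH2]].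
  rewrite big_ord0 mulr0 /=; under eq_Rintegral do rewrite expr0n/=.
  under eq_fun do rewrite expr0n/=.
  by split; [apply: L1_bnd => //; exact: bnd_cst|rewrite Rintegral_cst// mul0r].
set k := (m + n)%N.
have mwk := walk_meas m e n; have mfr := frozen_meas mwk.
pose Z w := 2 * (walk m e n w * frozen m e n w * c k w).
pose Y w := (frozen m e n w * c k w) * (frozen m e n w * c k w).
have mZ : meas_wrt (H k) Z.
  apply: meas_wrtM => //; first exact: meas_wrt_cst.
  apply: meas_wrtM => //; apply: meas_wrtS (@FH _) _.
  by apply: meas_wrtM.
have mY : meas_wrt (H k) Y.
  have : meas_wrt (H k) (fun w => frozen m e n w * c k w).
    by apply: meas_wrtM => //; apply: meas_wrtS (@FH _) _.
  by move=> h; apply: meas_wrtM.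
have bZ : bnd Z by apply: bndM; [exact: bnd_cst|apply: bndM].
have bY : bnd Y by apply: bndM; apply: bndM.
have mZ' : measurable_fun setT Z by exact: meas_F (meas_wrtS (@HF _) mZ).
have mY' : measurable_fun setT Y by exact: meas_F (meas_wrtS (@HF _) mY).
have LZ : L1 P (fun w => Z w * M k w) by exact: L1M.
have LY : L1 P (fun w => Y w * M k w ^+ 2) by exact: L1M.
have wE : (fun w => walk m e n.+1 w ^+ 2) =
    (fun w => walk m e n w ^+ 2 + (Z w * M k w + Y w * M k w ^+ 2)).
  by apply/funext => w; rewrite /= -/(frozen m e n w) -/k /Z /Y; ring.
rewrite wE; split; first by apply: L1D => //; exact: L1D.
rewrite RintegralD//; last exact: L1D.
rewrite RintegralD// (Rint_mul_eq0 (sH k) (@Hm k) mZ bZ (M1 k) (@M_centered k)) add0r.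
rewrite big_ord_recr/= mulrDr lerD//.
have Y0 w : 0 <= Y w by rewrite /Y -expr2 sqr_ge0.
apply: le_trans (Rint_mul_le (sH k) (@Hm k) mY Y0 bY (M2 k) (@M_var k)) _.
have C0 : 0 <= C.
  have := M_var (sigma_setT (sH 0)); rewrite probability_setT mulr1; apply: le_trans.
  by apply: Rintegral_ge0 => w _; exact: sqr_ge0.
have mc : measurable_fun setT (c k) by exact: meas_F (cF k).
rewrite ler_wpM2l//; apply: le_Rintegral => //.
- exact: L1_bnd.
- apply: L1_bnd; first exact: measurable_funX.
  by apply: bndM.
- move=> w _; rewrite /Y -expr2 exprMn ler_piMl ?sqr_ge0//.
  by rewrite /frozen; case: ltP => _; rewrite ?expr1n// expr0n.
Qed.

Let S n w := \sum_(i < n) c i w * M i w.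

Lemma walk_unfrozen m e w : (forall n, `|walk m e n w| < e) ->
  forall n, walk m e n w = S (m + n) w - S m w.
Proof.
move=> h; elim=> [|n IH]; first by rewrite addn0 subrr.
by rewrite /= h mul1r IH addnS [S _.+1 w]big_ord_recr/= -/(S _ w); ring.
Qed.

Let a n := \int[P]_w \sum_(i < n) c i w ^+ 2.

Let Lc2 i : L1 P (fun w => c i w ^+ 2).
Proof.
apply: L1_bnd; last exact: bndM.
by apply: measurable_funX; exact: meas_F (cF i).
Qed.

Let aE n : a n = \sum_(i < n) \int[P]_w c i w ^+ 2.
Proof. by rewrite /a Rint_sum. Qed.

Let a_nd : nondecreasing_seq a.
Proof.
apply/nondecreasing_seqP => n; rewrite !aE big_ord_recr/= lerDl.
by apply: Rintegral_ge0 => w _; exact: sqr_ge0.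
Qed.

Let a_cvg : cvgn a.
Proof.
apply: nondecreasing_is_cvgn => //; exists K => _ [n _ <-].
have LK : L1 P (fun=> K) by apply: L1_bnd => //; exact: bnd_cst.
have LS : L1 P (fun w => \sum_(i < n) c i w ^+ 2) by apply: L1_sum => i _; exact: Lc2.
have := le_Rintegral measurableT LS LK (fun w _ => cK n w).
by rewrite Rint_cst.
Qed.

Let exits m e n := [set w | e <= `|walk m e n w|].

Let exits_meas m e n : measurable (exits m e n).
Proof.
apply: (@Fm (m + n)); apply: meas_wrt_ler => //; first exact: meas_wrt_cst.
by apply: meas_wrt_norm => //; exact: walk_meas.
Qed.

Let exits_nd m e : nondecreasing_seq (exits m e).
Proof.
apply/nondecreasing_seqP => n; apply/subsetPset => w /= h.
by rewrite /exits/= (ltNge _ e) h mul0r addr0.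
Qed.

(** Freezing turns a maximal inequality into Chebyshev's: once out, the walk stays out, so the exit
    events increase with [n] and the probability of their union is a limit of one-time bounds. *)
Lemma walk_exits_le m e : 0 < e ->
  (P (\bigcup_n exits m e n) <= (C * (limn a - a m) / e ^+ 2)%:E)%E.
Proof.
move=> e0; have mU : measurable (\bigcup_n exits m e n) by exact: bigcup_measurable.
have cv := nondecreasing_cvg_mu (mu := P) (@exits_meas m e) mU (@exits_nd m e).
rewrite -(cvg_lim _ cv)//; apply: lime_le; first by apply/cvg_ex; eexists; exact: cv.
apply: nearW => n /=; have mE := @exits_meas m e n.
rewrite -[P _]fineK ?fin_num_measure// lee_fin ler_pdivlMr ?exprn_gt0//.
have [W1 W2] := walk_square m e n.
have C0 : 0 <= C.
  have := M_var (sigma_setT (sH 0)); rewrite probability_setT mulr1; apply: le_trans.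
  by apply: Rintegral_ge0 => w _; exact: sqr_ge0.
apply: (@le_trans _ _ (C * \sum_(i < n) \int[P]_w c (m + i) w ^+ 2)).
  apply: le_trans W2; rewrite mulrC -Rint_indic1// -RintegralZl//; last first.
    by apply: L1_bnd; [exact: measurable_indic|exact: bnd_indic].
  apply: le_Rintegral => //.
    by apply: L1Z; apply: L1_bnd; [exact: measurable_indic|exact: bnd_indic].
  move=> w _; rewrite indicE; case: (boolP (w \in _)) => [|_]; last by rewrite mulr0 sqr_ge0.
  rewrite inE /exits/= mulr1 => h.
  by rewrite -(ger0_norm (sqr_ge0 (walk m e n w))) normrX ler_sqr ?nnegrE// ltW.
rewrite ler_wpM2l// lerBrDl; apply: le_trans (nondecreasing_cvgn_le a_nd a_cvg (m + n)%N).
by rewrite !aE big_split_ord/= lerD2l lexx.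
Qed.

(** A path fails to be Cauchy only if, for some scale [1 / (j + 1)], the walk exits from every
    starting time [m]. That probability is at most a tail of the convergent sequence [a], up to a
    constant. *)
Lemma transform_cvg_bounded : {ae P, forall w, cvgn (fun n => S n w)}.
Proof.
pose N e := \bigcap_m \bigcup_n exits m e n.
have mN e : measurable (N e).
  by apply: bigcap_measurable => // m _; apply: bigcup_measurable.
have N0 e : 0 < e -> P.-negligible (N e).
  move=> e0; apply/negligibleP => //; apply/eqP; rewrite eq_le measure_ge0 andbT.
  apply/lee_addgt0Pr => r r0; rewrite add0e.
  have : (fun m => C * (limn a - a m) / e ^+ 2) @ \oo --> 0.
    rewrite [X in _ --> X](_ : 0 = C * (limn a - limn a) / e ^+ 2); last first.
      by rewrite subrr mulr0 mul0r.
    apply: cvgM; last exact: cvg_cst.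
    apply: cvgM; first exact: cvg_cst.
    by apply: cvgB; [exact: cvg_cst|exact: a_cvg].
  move=> /cvgr0Pnorm_le/(_ _ r0)[m _ /(_ m (leqnn m))]/= => hm.
  apply: (@le_trans _ _ (P (\bigcup_n exits m e n))).
    apply: le_measure; rewrite ?inE//; first exact: bigcup_measurable.
    by move=> w; apply.
  apply: le_trans (walk_exits_le m e0) _; rewrite lee_fin.
  exact: le_trans (ler_norm _) hm.
have : P.-negligible (\bigcup_j N j.+1%:R^-1).
  by apply: negligible_bigcup => j; apply: N0; rewrite invr_gt0.
apply: negligibleS => w; apply: contra_notP => nw.
apply/cauchy_cvgP/cauchy_exP => e e0.
have [j _ je] : \forall j \near \oo, j.+1%:R^-1 < e by exact: near_infty_natSinv_lt (PosNum e0).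
have {je} je := je j (leqnn j).
have : ~ N j.+1%:R^-1 w by move=> h; apply: nw; exists j.
move=> /existsNP[m /not_implyP[_ hm]].
have {}hm n : `|walk m j.+1%:R^-1 n w| < j.+1%:R^-1.
  by rewrite ltNge; apply/negP => h; apply: hm; exists n.
exists (S m w); exists m => // n /= mn.
have := walk_unfrozen hm (n - m)%N; rewrite subnKC// /ball/= distrC => <-.
exact: lt_trans (hm _) je.
Qed.

End Truncated.

(** Localisation: cutting the weights once their sum of squares passes [K] gives a convergent
    transform for every integer [K], and a path with finite sum is untouched by the cut for [K]
    large. *)
Lemma transform_cvg (b : nat -> Omega -> R) :
  (forall k, meas_wrt (H k) (b k)) -> (forall k w, 0 <= b k w <= 1) ->
  {ae P, forall w, (exists K, forall n, \sum_(i < n) b i w ^+ 2 <= K) ->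
     cvgn (series (fun k => b k w * M k w))}.
Proof.
move=> bH b01; pose q n w := \sum_(i < n) b i w ^+ 2.
have FS' k j : (k <= j)%N -> F k `<=` F j.
  move=> /subnK <-; elim: (j - k)%N => // n IH.
  by apply: subset_trans IH _; exact: FS.
have mq k : meas_wrt (H k) (q k.+1).
  rewrite /q; under eq_fun do under eq_bigr do rewrite expr2.
  apply: meas_wrt_sum => // i _.
  have bi : meas_wrt (H k) (b i).
    have := ltn_ord i; rewrite ltnS leq_eqVlt => /predU1P[->//|ik].
    apply: meas_wrtS (bH i); apply: subset_trans (@HF i) _.
    by apply: subset_trans (@FH k); exact: FS'.
  exact: meas_wrtM.
(* The test includes the current square. [q k.+1] is already [H k]-measurable, and this is what
   keeps the truncated sum below [K]. *)
pose c (K : nat) k w := b k w * \1_[set w | q k.+1 w <= K%:R] w.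
have cE K k w : c K k w = if q k.+1 w <= K%:R then b k w else 0.
  rewrite /c indicE; case: ifPn => h; first by rewrite mem_set// mulr1.
  by rewrite memNset ?mulr0//; exact/negP.
have cH K k : meas_wrt (H k) (c K k).
  apply: meas_wrtM => //; apply: meas_wrt_indic => //.
  by apply: meas_wrt_ler => //; exact: meas_wrt_cst.
have c01 K k w : 0 <= c K k w <= 1.
  by rewrite cE; case: ifP => _; rewrite ?b01// lexx ler01.
have cK K n w : \sum_(i < n) c K i w ^+ 2 <= K%:R.
  have : \sum_(i < n) c K i w ^+ 2 <= q n w.
    by apply: ler_sum => i _; rewrite cE; case: ifP => // _; rewrite expr0n sqr_ge0.
  elim: n => [|n IH] h; first by rewrite big_ord0.
  case: (leP (q n.+1 w) K%:R) => [/(le_trans h)//|qn].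
  rewrite big_ord_recr/= cE (leNgt (q n.+1 w)) qn/= expr0n addr0 IH//.
  by apply: ler_sum => i _; rewrite cE; case: ifP => // _; rewrite expr0n sqr_ge0.
have := ae_foralln (fun K => transform_cvg_bounded (cH K) (c01 K) (cK K)).
apply: filterS => w hw [K bK].
pose N := Num.bound `|K|.
have qN n : q n w <= N%:R.
  apply: le_trans (bK n) _; apply: le_trans (ler_norm _) _.
  exact/ltW/archi_boundP.
rewrite (_ : series _ = (fun n => \sum_(i < n) c N i w * M i w)); first exact: hw.
by rewrite seriesEord; apply/funext => n; apply: eq_bigr => i _; rewrite cE qN.
Qed.

End MartingaleTransform.

(** * Measurability of limits and returns *)

Section MeasLim.
Context {R : realType} {d : measure_display} {Omega : measurableType d}.
Variable F : set (set Omega).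
Hypothesis sF : sigma_algebra setT F.

Lemma sigma_bigcup (A : nat -> set Omega) : (forall n, F (A n)) -> F (\bigcup_n A n).
Proof. by move=> FA; case: sF => _ _; apply. Qed.

Lemma sigma_bigcap (A : nat -> set Omega) : (forall n, F (A n)) -> F (\bigcap_n A n).
Proof.
move=> FA; rewrite -[X in F X]setCK setC_bigcap; apply: sigma_setC => //.
by apply: sigma_bigcup => n; exact: sigma_setC.
Qed.

(** The Cauchy criterion, written with countable unions and intersections. *)
Lemma sigma_cvg_set (f : nat -> Omega -> R) : (forall n, meas_wrt F (f n)) ->
  F [set w | cvgn (fun n => f n w)].
Proof.
move=> mf.
rewrite (_ : [set _ | _] = \bigcap_j \bigcup_m \bigcap_n
    [set w | `|f (m + n)%N w - f m w| <= j.+1%:R^-1]).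
  apply: sigma_bigcap => j; apply: sigma_bigcup => m; apply: sigma_bigcap => n.
  apply: meas_wrt_ler => //; last exact: meas_wrt_cst.
  by apply: meas_wrt_norm => //; exact: meas_wrtB.
apply/seteqP; split => w /=.
  move=> cw j _; have j0 : 0 < (j.+1%:R^-1 / 2 : R) by rewrite divr_gt0 ?invr_gt0.
  have /cvgrPdist_le/(_ _ j0)[m _ hm] := cw.
  exists m => // n _ /=; have := hm _ (leqnn m); have := hm _ (leq_addr n m).
  move=> /= h1 h2.
  rewrite (_ : _ - _ = (limn (f ^~ w) - f m w) - (limn (f ^~ w) - f (m + n)%N w)); last by ring.
  by rewrite (le_trans (ler_normB _ _))// [leRHS]splitr lerD.
move=> h; apply/cauchy_cvgP/cauchy_exP => e e0.
have [j _ je] : \forall j \near \oo, j.+1%:R^-1 < e by exact: near_infty_natSinv_lt (PosNum e0).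
have {je} je := je j (leqnn j).
have [m _ hm] := h j I.
exists (f m w); exists m => // n /= mn.
have := hm (n - m)%N I; rewrite /= subnKC// /ball/= distrC => /le_lt_trans; exact.
Qed.

(** Off the convergence set [limn] is the constant [point]; multiplied by the indicator of that set,
    the sequence converges everywhere. *)
Lemma meas_wrt_limn (f : nat -> Omega -> R) : (forall n, meas_wrt F (f n)) ->
  meas_wrt F (fun w => limn (fun n => f n w)).
Proof.
move=> mf; have FC := sigma_cvg_set mf; set Cv := [set _ | _] in FC.
rewrite (_ : (fun w => _) = (fun w => limn (fun n => \1_Cv w * f n w) + (point : R) * \1_(~` Cv) w)).
  apply: meas_wrtD => //; last first.
    apply: meas_wrtM => //; first exact: meas_wrt_cst.
    by apply: meas_wrt_indic => //; exact: sigma_setC.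
  apply: (@meas_wrt_cvg _ _ _ _ sF (fun n w => \1_Cv w * f n w)).
    by move=> n; apply: meas_wrtM => //; exact: meas_wrt_indic.
  move=> w; have [cw|ncw] := pselect (Cv w).
    by apply: is_cvgM => //; exact: is_cvg_cst.
  under eq_fun do rewrite indicE memNset// mul0r.
  exact: is_cvg_cst.
apply/funext => w; rewrite !indicE in_setC; have [cw|ncw] := pselect (Cv w).
  rewrite mem_set//= mulr0 addr0; congr (limn _); apply/funext => n.
  by rewrite mul1r.
rewrite memNset//= mulr1 dvgP//.
under eq_fun do rewrite mul0r.
by rewrite lim_cst// add0r.
Qed.

Lemma meas_wrt_ret (gamma : R) (Rs : nat -> Omega -> R) :
  (forall n, meas_wrt F (Rs n)) -> meas_wrt F (ret gamma Rs).
Proof.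
move=> mR; apply: meas_wrt_limn => n; apply: meas_wrt_sum => // i _.
by apply: meas_wrtM => //; exact: meas_wrt_cst.
Qed.

End MeasLim.

(** * Almost sure equality and restricted laws *)

Section AlmostEverywhere.
Context {R : realType} {d : measure_display} {Omega : measurableType d}.
Variable P : probability Omega R.

Lemma L1_ae (f g : Omega -> R) : measurable_fun setT g -> {ae P, forall w, f w = g w} ->
  L1 P f -> L1 P g.
Proof.
move=> mg fg lf; have mf := L1_measurable lf.
apply/integrableP; split; first exact/measurable_EFinP.
have [_ ] := integrableP _ _ _ lf; apply: le_lt_trans.
rewrite le_eqVlt; apply/orP; left; apply/eqP.
apply: ge0_ae_eq_integral => //.
- by apply: measurableT_comp => //; exact/measurable_EFinP.
- by apply: measurableT_comp => //; exact/measurable_EFinP.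
- by apply: filterS fg => w fgw _ /=; rewrite fgw.
Qed.

Lemma Rint_ae (f g : Omega -> R) B : measurable B -> measurable_fun setT f ->
  measurable_fun setT g -> {ae P, forall w, f w = g w} ->
  \int[P]_(w in B) f w = \int[P]_(w in B) g w.
Proof.
move=> mB mf mg fg; congr fine; apply: ae_eq_integral => //.
- by apply/measurable_EFinP; apply: measurable_funTS.
- by apply/measurable_EFinP; apply: measurable_funTS.
- by apply: filterS fg => w fgw _ /=; rewrite fgw.
Qed.

Section Restricted.
Variables (Y : Omega -> R) (mu : probability R R) (B : set Omega).
Hypothesis mY : measurable_fun setT Y.
Hypothesis mB : measurable B.
Hypothesis lawY : forall D, measurable D -> P (B `&` Y @^-1` D) = (P B * mu D)%E.

(** The restriction of [P] to [B], pushed forward by [Y], is [mu] scaled by [P B]. *)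
Lemma ge0_integral_restricted_law (g : R -> \bar R) : measurable_fun setT g ->
  (forall z, 0 <= g z)%E ->
  (\int[P]_(w in B) g (Y w) = P B * \int[mu]_z g z)%E.
Proof.
move=> mg g0.
have mgY : measurable_fun setT (g \o Y) by exact: measurableT_comp.
pose m1 := mrestr P mB.
have m1P A : measurable A -> A `<=` B -> P A = m1 A.
  by move=> mA AB; rewrite /m1 /mrestr; congr (P _); apply/esym/setIidl.
rewrite (eq_measure_integral m1); last by move=> A mA AB; exact: m1P.
have -> : (\int[m1]_(w in B) g (Y w) = \int[m1]_w g (Y w))%E.
  rewrite [RHS](ge0_negligible_integral (measurableC mB))//.
    by rewrite setTD setCK.
  by rewrite /m1 /= /mrestr setICl measure0.
pose mY' := isMeasurableFun.Build _ _ _ _ _ mY.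
pose Y' : {mfun Omega >-> R} := HB.pack Y mY'.
have r0 : 0 <= fine (P B) by exact: fine_ge0.
transitivity (\int[pushforward m1 Y']_z g z)%E.
  by rewrite ge0_integral_pushforward.
rewrite (eq_measure_integral (mscale (NngNum r0) mu)).
  by rewrite ge0_integral_mscale//= fineK// fin_num_measure.
move=> D mD _ /=; rewrite /pushforward /m1 /= /mrestr setIC lawY//.
by rewrite /mscale/= fineK// fin_num_measure.
Qed.

Lemma integral_restricted_law (f : R -> R) : mu.-integrable setT (EFin \o f) ->
  L1 P (fun w => \1_B w * f (Y w)) /\
  \int[P]_w (\1_B w * f (Y w)) = fine (P B) * \int[mu]_z f z.
Proof.
move=> fi; have mf : measurable_fun setT f.
  by apply/measurable_EFinP; exact: measurable_int fi.
have mfY : measurable_fun setT (f \o Y) by exact: measurableT_comp.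
have mfi : measurable_fun setT (fun w => \1_B w * f (Y w)).
  by apply: measurable_funM => //; exact: measurable_indic.
split.
  apply/integrableP; split; first exact/measurable_EFinP.
  rewrite (_ : (\int[P]_w _ = \int[P]_(w in B) `|f (Y w)|%:E)%E); last first.
    rewrite [RHS]integral_mkcond; apply: eq_integral => w _.
    rewrite patchE /= indicE; case: ifP => _; first by rewrite mul1r.
    by rewrite mul0r normr0.
  rewrite (ge0_integral_restricted_law (g := fun z => `|f z|%:E))//; last first.
    by apply/measurable_EFinP; exact: measurableT_comp.
  have [_ fin] := integrableP _ _ _ fi.
  have hf : (\int[mu]_z `|f z|%:E \is a fin_num)%E.
    by rewrite ge0_fin_numE// integral_ge0.
  by rewrite -(fineK hf) -[P B]fineK ?fin_num_measure// -EFinM ltry.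
rewrite Rint_indic// /Rintegral integralE [in RHS]integralE.
rewrite (_ : (fun w => (f (Y w))%:E)^\+%E = (fun w => (EFin \o f)^\+%E (Y w))); last first.
  by apply/funext => w; rewrite !funeposE.
rewrite (_ : (fun w => (f (Y w))%:E)^\-%E = (fun w => (EFin \o f)^\-%E (Y w))); last by apply/funext => w; rewrite !funenegE.
rewrite !ge0_integral_restricted_law//; last 2 first.
- by apply: measurable_funeneg; exact/measurable_EFinP.
- by apply: measurable_funepos; exact/measurable_EFinP.
have f1 := integrable_pos_fin_num measurableT fi.
have f2 := integrable_neg_fin_num measurableT fi.
rewrite -[P B]fineK ?fin_num_measure// -(fineK f1) -(fineK f2).
by rewrite -!EFinM -!EFinB /= mulrBr.
Qed.

End Restricted.
End AlmostEverywhere.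

(** * Limit theorems for real integrals *)

Section RealConvergence.
Context {R : realType} {d : measure_display} {Omega : measurableType d}.
Variable P : probability Omega R.

Lemma measurable_limn_real (u : nat -> Omega -> R) : (forall n, measurable_fun setT (u n)) ->
  measurable_fun setT (fun w => limn (fun n => u n w)).
Proof.
move=> mu; apply/meas_wrt_measurable; apply: meas_wrt_limn.
  exact: sigma_algebra_measurable.
by move=> n; apply/meas_wrt_measurable.
Qed.

Lemma L1S (f : Omega -> R) B : measurable B -> L1 P f -> P.-integrable B (EFin \o f).
Proof. by move=> mB; apply: integrableS. Qed.

Lemma EFin_Rint (f : Omega -> R) B : measurable B -> L1 P f ->
  (\int[P]_(w in B) (f w)%:E = (\int[P]_(w in B) f w)%R%:E)%E.
Proof.
move=> mB lf; rewrite /Rintegral fineK//; apply: integrable_fin_num => //.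
exact: L1S.
Qed.

(** The extended limit is integrable, hence finite almost everywhere, and there it agrees with the
    real [limn]. The last clause keeps bounds event by event, as conditional variance bounds
    require. *)
Lemma beppo_levi (u : nat -> Omega -> R) (K : R) :
  (forall n, L1 P (u n)) -> (forall n w, 0 <= u n w) ->
  (forall n w, u n w <= u n.+1 w) -> (forall n, \int[P]_w u n w <= K) ->
  [/\ {ae P, forall w, cvgn (fun n => u n w)},
      L1 P (fun w => limn (fun n => u n w)) &
      forall B KB, measurable B -> (forall n, \int[P]_(w in B) u n w <= KB) ->
        \int[P]_(w in B) limn (fun n => u n w) <= KB].
Proof.
move=> Lu u0 uS uK; have mu n := L1_measurable (Lu n).
have und w : nondecreasing_seq (fun n => u n w) by apply/nondecreasing_seqP.
pose f w := limn (fun n => (u n w)%:E).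
have fcv w : (fun n => (u n w)%:E) @ \oo --> f w.
  apply: ereal_nondecreasing_is_cvgn => a b ab.
  by rewrite lee_fin; exact: und.
have f0 w : (0 <= f w)%E.
  by apply: lime_ge; [exact: fcv|apply: nearW => n; rewrite lee_fin].
have mf : measurable_fun setT f.
  apply: (emeasurable_fun_cvg (fun n w => (u n w)%:E)) => // n.
  exact/measurable_EFinP.
have fB B KB : measurable B -> (forall n, \int[P]_(w in B) u n w <= KB) ->
    (\int[P]_(w in B) f w <= KB%:E)%E.
  move=> mB uKB; rewrite monotone_convergence//.
  - apply: lime_le.
      apply: ereal_nondecreasing_is_cvgn => a b ab.
      apply: ge0_le_integral => //;
        do ?[by move=> w _; rewrite lee_fin | by move=> w _; rewrite lee_fin; exact: und
            | by apply/measurable_EFinP; apply: measurable_funTS].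
    by apply: nearW => n; rewrite EFin_Rint// lee_fin.
  - by move=> n; apply/measurable_EFinP; apply: measurable_funTS.
  - by move=> n w _; rewrite lee_fin.
  - by move=> w _ a b ab; rewrite lee_fin; exact: und.
have If : P.-integrable setT f.
  apply/integrableP; split => //.
  under eq_integral do rewrite gee0_abs//.
  by apply: le_lt_trans (fB setT K measurableT uK) _; rewrite ltry.
have ffin : {ae P, forall w, f w \is a fin_num}.
  by apply: filterS (integrable_ae measurableT If) => w; apply.
have ucv w : f w \is a fin_num -> (fun n => u n w) @ \oo --> fine (f w).
  move=> fw; have := fcv w; rewrite -[X in _ --> X -> _]fineK// => /fine_cvg.
  by [].
have mlu := measurable_limn_real mu.
have ulim : {ae P, forall w, (limn (fun n => u n w))%:E = f w}.
  by apply: filterS ffin => w fw; rewrite (cvg_lim _ (ucv w fw))// fineK.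
have lu0 w : 0 <= limn (fun n => u n w).
  have [cw|ncw] := pselect (cvgn (fun n => u n w)).
    by apply: limr_ge => //; apply: nearW.
  by rewrite dvgP.
have luf B : measurable B -> (\int[P]_(w in B) (limn (fun n => u n w))%:E = \int[P]_(w in B) f w)%E.
  move=> mB; apply: ge0_ae_eq_integral => //.
  - by apply/measurable_EFinP; apply: measurable_funTS.
  - exact: measurable_funTS.
  - by move=> w _; rewrite lee_fin.
  - by apply: filterS ulim.
have Llu : L1 P (fun w => limn (fun n => u n w)).
  apply/integrableP; split; first exact/measurable_EFinP.
  under eq_integral do rewrite gee0_abs ?lee_fin//=.
  rewrite luf//.
  by apply: le_lt_trans (fB setT K measurableT uK) _; rewrite ltry.
split=> //.
- by apply: filterS ffin => w fw; apply/cvg_ex; exists (fine (f w)); exact: ucv.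
- by move=> B KB mB uKB; rewrite -lee_fin -EFin_Rint// luf// fB.
Qed.

Lemma Rint_dominated (f_ : nat -> Omega -> R) (f g : Omega -> R) :
  (forall n, measurable_fun setT (f_ n)) -> measurable_fun setT f ->
  {ae P, forall w, (fun n => f_ n w) @ \oo --> f w} ->
  L1 P g -> {ae P, forall w, forall n, `|f_ n w| <= g w} ->
  L1 P f /\ forall B, measurable B ->
    (fun n => \int[P]_(w in B) f_ n w) @ \oo --> \int[P]_(w in B) f w.
Proof.
move=> mf_ mf cf Lg fg.
have dct B : measurable B -> P.-integrable B (EFin \o f) /\
    (fun n => \int[P]_(w in B) (f_ n w)%:E)%E @ \oo --> (\int[P]_(w in B) (f w)%:E)%E.
  move=> mB; have [|||||h1 _ h3] := @dominated_convergence _ _ _ P B mB (fun n => EFin \o f_ n)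
      (EFin \o f) (EFin \o g).
  - by move=> n; apply/measurable_EFinP; apply: measurable_funTS.
  - by apply/measurable_EFinP; apply: measurable_funTS.
  - by apply: filterS cf => w cw _; apply: cvg_EFin; [exact: nearW|exact: cw].
  - exact: L1S.
  - by apply: filterS fg => w gw n _ /=; rewrite lee_fin.
  - by split.
have Lf : L1 P f by have [] := dct setT measurableT.
split=> // B mB; have [_ +] := dct B mB.
by rewrite EFin_Rint// => /fine_cvg.
Qed.

End RealConvergence.

(** * Conditional laws as integral identities *)

Section FiniteValued.
Context {R : realType} {d : measure_display} {Omega : measurableType d}.
Variable P : probability Omega R.

(** Splitting over the values of [Y] turns a random index into finitely many fixed ones;
    measurability, boundedness and conditioning are all reduced this way. *)
Lemma sum_fin_comp (T : finType) (Y : Omega -> T) (h : T -> Omega -> R) w :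
  \sum_y \1_(Y @^-1` [set y]) w * h y w = h (Y w) w.
Proof.
rewrite (bigD1 (Y w))//= indicE mem_set//= mul1r big1 ?addr0// => y yw.
by rewrite indicE memNset ?mul0r//= => /esym/eqP; rewrite (negbTE yw).
Qed.

Lemma meas_wrt_fin_comp F (T : finType) (Y : Omega -> T) (h : T -> Omega -> R) :
  sigma_algebra setT F -> (forall y, F (Y @^-1` [set y])) ->
  (forall y, meas_wrt F (h y)) -> meas_wrt F (fun w => h (Y w) w).
Proof.
move=> sF FY mh; under eq_fun do rewrite -sum_fin_comp.
by apply: meas_wrt_sum => // y _; apply: meas_wrtM => //; exact: meas_wrt_indic.
Qed.

Lemma bnd_fin_comp (T : finType) (Y : Omega -> T) (h : T -> Omega -> R) :
  (forall y, bnd (h y)) -> bnd (fun w => h (Y w) w).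
Proof.
move=> bh; under eq_fun do rewrite -sum_fin_comp.
by apply: bnd_sum => y _; apply: bndM => //; exact: bnd_indic.
Qed.

Section FiniteCondLaw.
Variables (Gs : set (set Omega)) (T : finType) (Y : Omega -> T) (p : Omega -> T -> R).
Hypothesis Gm : <<s Gs >> `<=` measurable.
Hypothesis mY : forall y, measurable (Y @^-1` [set y]).
Hypothesis mp : forall y, measurable_fun setT (fun w => p w y).
Hypothesis bp : forall y, bnd (fun w => p w y).
Hypothesis law : cond_law_fin P Gs Y p.

Lemma cond_fin_int (Z : Omega -> R) y : meas_wrt <<s Gs >> Z -> bnd Z ->
  \int[P]_w (Z w * \1_(Y @^-1` [set y]) w) = \int[P]_w (Z w * p w y).
Proof.
move=> mZ bZ; have mZ' : measurable_fun setT Z.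
  by apply/meas_wrt_measurable; exact: meas_wrtS mZ.
have L1i : L1 P (\1_(Y @^-1` [set y])).
  by apply: L1_bnd; [exact: measurable_indic|exact: bnd_indic].
have L1p : L1 P (fun w => p w y) by exact: L1_bnd.
apply/eqP; rewrite -subr_eq0 -RintegralB//; [|exact: L1M|exact: L1M].
under eq_Rintegral do rewrite -mulrBr.
apply/eqP; apply: (Rint_mul_eq0 (sigma_algebra_gen Gs) Gm mZ bZ); first exact: L1B.
move=> B GB; have mB := Gm GB.
rewrite RintegralB//; [|exact: L1S|exact: L1S].
apply/eqP; rewrite subr_eq0; apply/eqP; apply: EFin_inj.
rewrite -!EFin_Rint//= -law//.
by rewrite integral_indic// setIC.
Qed.

Lemma cond_fin_comp (Z : T -> Omega -> R) :
  (forall y, meas_wrt <<s Gs >> (Z y)) -> (forall y, bnd (Z y)) ->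
  \int[P]_w Z (Y w) w = \int[P]_w \sum_y p w y * Z y w.
Proof.
move=> mZ bZ.
have mZ' y : measurable_fun setT (Z y) by apply/meas_wrt_measurable; exact: meas_wrtS (mZ y).
under eq_Rintegral do rewrite -sum_fin_comp.
rewrite !Rint_sum//.
- apply: eq_bigr => y _; under eq_Rintegral do rewrite mulrC.
  by rewrite cond_fin_int//; apply: eq_Rintegral => w _; rewrite mulrC.
- by move=> y _; apply: L1M => //; exact: L1_bnd.
- move=> y _; apply: L1M; [exact: measurable_indic|exact: bnd_indic|exact: L1_bnd].
Qed.

End FiniteCondLaw.

Section RealCondLaw.
Variables (Gs : set (set Omega)) (Y : Omega -> R) (k : Omega -> probability R R).
Variables (E : set Omega) (mu : probability R R).
Hypothesis Gm : <<s Gs >> `<=` measurable.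
Hypothesis mY : measurable_fun setT Y.
Hypothesis law : cond_law_real P Gs Y k.
Hypothesis GE : <<s Gs >> E.
Hypothesis kE : forall w, E w -> k w = mu.

(** On [E] the kernel is the single law [mu], so conditioning becomes a plain product formula to
    which the restricted-law lemmas apply. *)
Let law_restr B : <<s Gs >> B -> forall D, measurable D ->
  P ((B `&` E) `&` Y @^-1` D) = (P (B `&` E) * mu D)%E.
Proof.
move=> GB D mD; have GBE : <<s Gs >> (B `&` E).
  by exact: (sigma_setI (sigma_algebra_gen Gs)).
rewrite law// (eq_integral (fun=> mu D)); last first.
  by move=> w; rewrite inE => -[_ Ew]; rewrite kE.
have mBE := Gm GBE.
by rewrite (integral_cst P mBE (mu D)) muleC.
Qed.

Lemma cond_real_L1 (f : R -> R) : mu.-integrable setT (EFin \o f) ->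
  L1 P (fun w => \1_E w * f (Y w)).
Proof.
move=> fi; have mE := Gm GE.
have law' D : measurable D -> P (E `&` Y @^-1` D) = (P E * mu D)%E.
  by move=> mD; have := law_restr GE mD; rewrite setIid.
by have [] := integral_restricted_law mY mE law' fi.
Qed.

Lemma cond_real_int (f : R -> R) (Z : Omega -> R) :
  mu.-integrable setT (EFin \o f) -> meas_wrt <<s Gs >> Z -> bnd Z ->
  \int[P]_w (Z w * (\1_E w * f (Y w))) = \int[P]_w (Z w * (\1_E w * \int[mu]_z f z)).
Proof.
move=> fi mZ bZ; have mE := Gm GE; set m := \int[mu]_z f z.
have mZ' : measurable_fun setT Z by apply/meas_wrt_measurable; exact: meas_wrtS mZ.
have L1f := cond_real_L1 fi.
have L1m : L1 P (fun w => \1_E w * m).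
  by apply: L1M; [exact: measurable_indic|exact: bnd_indic|apply: L1_bnd => //; exact: bnd_cst].
apply/eqP; rewrite -subr_eq0 -RintegralB//; [|exact: L1M|exact: L1M].
under eq_Rintegral do rewrite -mulrBr.
apply/eqP; apply: (Rint_mul_eq0 (sigma_algebra_gen Gs) Gm mZ bZ); first exact: L1B.
move=> B GB; have mB := Gm GB.
have GBE : <<s Gs >> (B `&` E) by exact: (sigma_setI (sigma_algebra_gen Gs)).
have mBE := Gm GBE.
rewrite RintegralB//; [|exact: L1S|exact: L1S].
rewrite -[X in X - _]Rint_indic// -[X in _ - X]Rint_indic//.
have iBE w (x : R) : \1_B w * (\1_E w * x) = \1_(B `&` E) w * x.
  by rewrite indicI mulrA.
under eq_Rintegral do rewrite iBE.
under [X in _ - X]eq_Rintegral do rewrite iBE.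
have [_ ->] := integral_restricted_law mY mBE (law_restr GB) fi.
rewrite -/m RintegralZr//; last by apply: L1_bnd; [exact: measurable_indic|exact: bnd_indic].
by rewrite Rint_indic1// subrr.
Qed.

End RealCondLaw.
End FiniteValued.

(** * Returns *)

Section Trajectory.
Context {R : realType} {d : measure_display} {Omega : measurableType d}.
Variables (S A : finType) (Xs : nat -> Omega -> S) (As : nat -> Omega -> A)
          (Rs : nat -> Omega -> R).

Lemma traj_genS nx na nr nx' na' nr' : (nx <= nx')%N -> (na <= na')%N -> (nr <= nr')%N ->
  traj_gen Xs As Rs nx na nr `<=` traj_gen Xs As Rs nx' na' nr'.
Proof.
move=> hx ha hr E [[t tn Et]|[[t tn Et]|[t tn Et]]].
- by left; exists t => //; exact: leq_trans hx.
- by right; left; exists t => //; exact: leq_trans ha.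
- by right; right; exists t => //; exact: leq_trans hr.
Qed.

Hypothesis mX : forall t y, measurable (Xs t @^-1` [set y]).
Hypothesis mA : forall t a, measurable (As t @^-1` [set a]).
Hypothesis mR : forall t, measurable_fun setT (Rs t).

Lemma measurable_fin_preimage (T : finType) (Y : Omega -> T) B :
  (forall y, measurable (Y @^-1` [set y])) -> measurable (Y @^-1` B).
Proof.
move=> mY; rewrite (_ : Y @^-1` B = \big[setU/set0]_(y | y \in B) (Y @^-1` [set y])).
  by apply: bigsetU_measurable.
apply/seteqP; split => w /=.
  by move=> Bw; rewrite -bigcup_seq_cond; exists (Y w) => //=; rewrite mem_index_enum mem_set.
by rewrite -bigcup_seq_cond => -[y /= /andP[_]]; rewrite inE => By ->.
Qed.

Lemma traj_gen_measurable nx na nr : traj_gen Xs As Rs nx na nr `<=` measurable.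
Proof.
move=> E [[t _ [B _ <-]]|[[t _ [B _ <-]]|[t _ [B mB <-]]]].
- exact: measurable_fin_preimage.
- exact: measurable_fin_preimage.
- by rewrite -[_ @^-1` _]setTI; exact: mR.
Qed.

Lemma gen_sigma_measurable (G : set (set Omega)) : G `<=` measurable ->
  <<s G >> `<=` measurable.
Proof. by move=> Gm; apply: smallest_sub => //; exact: sigma_algebra_measurable. Qed.

Section Generated.
Variables (G0 : set (set Omega)) (nx na nr : nat).
Let F := <<s G0 `|` traj_gen Xs As Rs nx na nr >>.

Lemma gen_X t y : (t < nx)%N -> F (Xs t @^-1` [set y]).
Proof.
by move=> tn; apply: sub_sigma_algebra; right; left; exists t => //; exists [set y].
Qed.

Lemma gen_A t a : (t < na)%N -> F (As t @^-1` [set a]).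
Proof.
by move=> tn; apply: sub_sigma_algebra; right; right; left; exists t => //; exists [set a].
Qed.

Lemma gen_R t : (t < nr)%N -> meas_wrt F (Rs t).
Proof.
move=> tn D mD; apply: sub_sigma_algebra; right; right; right; exists t => //.
by exists D.
Qed.

Lemma gen_base B : <<s G0 >> B -> F B.
Proof. by apply: sub_sigma_algebra2 => E GE; left. Qed.

End Generated.
End Trajectory.

Lemma measurable_sum_cond {R : realType} {d : measure_display} {Omega : measurableType d}
    I (s : seq I) (p : pred I) (h : I -> Omega -> R) :
  (forall i, p i -> measurable_fun setT (h i)) ->
  measurable_fun setT (fun w => \sum_(i <- s | p i) h i w).
Proof.
move=> mh; apply/meas_wrt_measurable; apply: meas_wrt_sum.
  exact: sigma_algebra_measurable.
by move=> i /mh mi; apply/meas_wrt_measurable.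
Qed.

(** * Rewards and returns of a controlled process *)

Section MDPProcess.
Context {R : realType} {d : measure_display} {Omega : measurableType d}.
Variables (M : mdp R) (gamma : R) (P : probability Omega R).
Hypothesis gamma01 : 0 <= gamma < 1.
Local Notation X := (st M).
Local Notation A := (ac M).

Lemma rew_integrable (x : X) a y : a \in acts x ->
  (rew x a y).-integrable setT (EFin \o id).
Proof.
move=> aA; have h := rew_L2 y aA.
apply: (@L1_le _ _ _ (rew x a y) id (fun z : R => 1 + z ^+ 2)) => //.
  move=> z; rewrite ler_norml; apply/andP; split; nra.
by apply: L1D => //; apply: L1_bnd => //; exact: bnd_cst.
Qed.

Definition rew_var : R :=
  \sum_(x : X) \sum_(a in acts x) \sum_(y : X) \int[rew x a y]_z z ^+ 2.

Lemma rew_var_ge0 : 0 <= rew_var.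
Proof.
by apply: sumr_ge0 => x _; apply: sumr_ge0 => a _; apply: sumr_ge0 => y _;
  apply: Rintegral_ge0 => z _; exact: sqr_ge0.
Qed.

Lemma rew_var_ge (x : X) a y : a \in acts x -> \int[rew x a y]_z z ^+ 2 <= rew_var.
Proof.
have m2 (x' : X) a' y' : 0 <= \int[rew x' a' y']_z z ^+ 2.
  by apply: Rintegral_ge0 => z _; exact: sqr_ge0.
move=> aA; rewrite /rew_var (bigD1 x)//= (bigD1 a)//= (bigD1 y)//= -!addrA lerDl.
by rewrite !addr_ge0//; do ?[apply: sumr_ge0 => *].
Qed.

Variables (Xs : nat -> Omega -> X) (As : nat -> Omega -> A) (Rs : nat -> Omega -> R).
Variables (G0 : set (set Omega)) (p : nat -> Omega -> A -> R).
Hypothesis G0m : G0 `<=` measurable.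
Hypothesis mX : forall t y, measurable (Xs t @^-1` [set y]).
Hypothesis mA : forall t a, measurable (As t @^-1` [set a]).
Hypothesis mR : forall t, measurable_fun setT (Rs t).
Hypothesis mp : forall t a, measurable_fun setT (fun w => p t w a).
Hypothesis bp : forall t a, bnd (fun w => p t w a).
Hypothesis p_acts : forall t w a, a \notin acts (Xs t w) -> p t w a = 0.
Hypothesis A0_acts : {ae P, forall w, As 0 w \in acts (Xs 0 w)}.

(** Information just after the action at time [t], then with the next state, then with the reward:
    the three sigma-fields given which [lawX], [lawR] and [lawA] hold. *)
Let Fs t := <<s G0 `|` traj_gen Xs As Rs t.+1 t.+1 t >>.
Let Gx t := <<s G0 `|` traj_gen Xs As Rs t.+2 t.+1 t >>.
Let Ga t := <<s G0 `|` traj_gen Xs As Rs t.+2 t.+1 t.+1 >>.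

Hypothesis lawA : forall t, cond_law_fin P (G0 `|` traj_gen Xs As Rs t.+2 t.+1 t.+1)
  (As t.+1) (p t.+1).
Hypothesis lawX : forall t, cond_law_fin P (G0 `|` traj_gen Xs As Rs t.+1 t.+1 t)
  (Xs t.+1) (fun w y => trans (Xs t w) (As t w) y).
Hypothesis lawR : forall t, cond_law_real P (G0 `|` traj_gen Xs As Rs t.+2 t.+1 t)
  (Rs t) (fun w => rew (Xs t w) (As t w) (Xs t.+1 w)).

Let gen_m nx na nr : <<s G0 `|` traj_gen Xs As Rs nx na nr >> `<=` measurable.
Proof.
apply: gen_sigma_measurable => E [/G0m//|]; exact: traj_gen_measurable.
Qed.

Let gen_mono nx na nr nx' na' nr' : (nx <= nx')%N -> (na <= na')%N -> (nr <= nr')%N ->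
  <<s G0 `|` traj_gen Xs As Rs nx na nr >> `<=` <<s G0 `|` traj_gen Xs As Rs nx' na' nr' >>.
Proof.
by move=> hx ha hr; apply: sub_sigma_algebra2; apply: setUS; exact: traj_genS.
Qed.

(** Conditional laws exclude inadmissible actions only up to a null set, while reward moments are
    controlled only for admissible ones; the reward identities below pass through this event. *)
Lemma acts_ae : {ae P, forall w, forall t, As t w \in acts (Xs t w)}.
Proof.
apply/ae_foralln => -[//|t].
pose bad x a := Xs t.+1 @^-1` [set x] `&` As t.+1 @^-1` [set a].
have bad0 x a : a \notin acts x -> P.-negligible (bad x a).
  move=> aA; have FX : <<s G0 `|` traj_gen Xs As Rs t.+2 t.+1 t.+1 >> (Xs t.+1 @^-1` [set x]).
    exact: gen_X.
  apply/negligibleP; first exact: measurableI.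
  apply: etrans (@lawA t _ a FX) _; apply: integral0_eq => w /= Xw.
  by rewrite p_acts ?Xw.
have : P.-negligible (\big[setU/set0]_(z : X * A | z.2 \notin acts z.1) bad z.1 z.2).
  elim/big_ind: _ => //; first exact: negligible_set0.
    by move=> U V; exact: negligibleU.
  by move=> z; exact: bad0.
apply: negligibleS => w /= /negP aw; rewrite -bigcup_seq_cond.
by exists (Xs t.+1 w, As t.+1 w) => //=; rewrite mem_index_enum.
Qed.

(* Conditioning on the whole transition [z = (x, a, y)] makes the reward law
   constant. *)
Let Tr t w : X * A * X := (Xs t w, As t w, Xs t.+1 w).
Let good (z : X * A * X) : bool := z.1.2 \in acts z.1.1.

Let Tr_gen t z : Gx t (Tr t @^-1` [set z]).
Proof.
rewrite (_ : _ @^-1` _ = (Xs t @^-1` [set z.1.1] `&` As t @^-1` [set z.1.2])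
                          `&` Xs t.+1 @^-1` [set z.2]); last first.
  apply/seteqP; split => w /=; rewrite /Tr; first by move=> <-.
  by case: z => -[x a] y /= [[-> ->] ->].
have sG := sigma_algebra_gen (G0 `|` traj_gen Xs As Rs t.+2 t.+1 t).
apply: (sigma_setI sG); last exact: gen_X.
by apply: (sigma_setI sG); [exact: gen_X|exact: gen_A].
Qed.

Let Tr_rew t z w : (Tr t @^-1` [set z]) w ->
  rew (Xs t w) (As t w) (Xs t.+1 w) = rew z.1.1 z.1.2 z.2.
Proof. by move=> <-. Qed.

Let good_sum t (f : X * A * X -> Omega -> R) :
  {ae P, forall w, \sum_(z | good z) \1_(Tr t @^-1` [set z]) w * f z w = f (Tr t w) w}.
Proof.
apply: filterS acts_ae => w /(_ t) gw.
rewrite -(sum_fin_comp (Tr t)) [RHS](bigID good)/= [X in _ = _ + X]big1 ?addr0//.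
move=> z bz; rewrite indicE memNset ?mul0r//= => Tz.
by move: bz; rewrite -Tz /good/= gw.
Qed.

Let L1_good t (f : R -> R) : (forall z, good z ->
    (rew z.1.1 z.1.2 z.2).-integrable setT (EFin \o f)) -> measurable_fun setT f ->
  L1 P (fun w => f (Rs t w)).
Proof.
move=> fi mf; apply: (L1_ae _ (good_sum t (fun _ w => f (Rs t w)))).
  exact: measurableT_comp.
apply: L1_sum => z gz.
exact: (cond_real_L1 (@gen_m _ _ _) (mR t) (@lawR t) (@Tr_gen t z) (@Tr_rew t z) (fi z gz)).
Qed.

Let L1_Rs t : L1 P (Rs t).
Proof. by apply: (@L1_good t id) => // -[[x a] y] gz; exact: rew_integrable. Qed.

Let L1_Rs2 t : L1 P (fun w => Rs t w ^+ 2).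
Proof.
apply: (@L1_good t (fun u => u ^+ 2)); last exact: measurable_funX.
by move=> -[[x a] y] gz; exact: rew_L2.
Qed.

Let Rint_good t (f : R -> R) (Z : Omega -> R) : (forall z, good z ->
    (rew z.1.1 z.1.2 z.2).-integrable setT (EFin \o f)) -> measurable_fun setT f ->
  meas_wrt (Gx t) Z -> bnd Z ->
  \int[P]_w (Z w * f (Rs t w)) =
  \int[P]_w (Z w * \int[rew (Xs t w) (As t w) (Xs t.+1 w)]_u f u).
Proof.
move=> fi mf mZ bZ.
have mZ' : measurable_fun setT Z.
  by apply/meas_wrt_measurable; apply: meas_wrtS mZ; exact: gen_m.
pose mf' (z : X * A * X) := \int[rew z.1.1 z.1.2 z.2]_u f u.
have mI z : measurable_fun setT (\1_(Tr t @^-1` [set z]) : Omega -> R).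
  by apply: measurable_indic; apply: gen_m; exact: Tr_gen.
have mmf : measurable_fun setT (fun w => mf' (Tr t w)).
  apply/meas_wrt_measurable; apply: (meas_wrt_fin_comp (h := fun z _ => mf' z)).
  - exact: sigma_algebra_measurable.
  - by move=> z; apply: gen_m; exact: Tr_gen.
  - by move=> z; apply/meas_wrt_measurable.
rewrite (Rint_ae (g := fun w => \sum_(z | good z) Z w * (\1_(Tr t @^-1` [set z]) w * f (Rs t w))))//;
  last 3 first.
- by apply: measurable_funM => //; exact: measurableT_comp.
- apply: measurable_sum_cond => z _; apply: measurable_funM => //; apply: measurable_funM => //.
  exact: measurableT_comp.
- apply: filterS (good_sum t (fun _ w => f (Rs t w))) => w h.
  by rewrite -mulr_sumr h.
rewrite Rint_sum; last first.
  move=> z gz; apply: L1M => //.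
  exact: (cond_real_L1 (@gen_m _ _ _) (mR t) (@lawR t) (@Tr_gen t z) (@Tr_rew t z) (fi z gz)).
transitivity (\sum_(z | good z) \int[P]_w (Z w * (\1_(Tr t @^-1` [set z]) w * mf' z))).
  apply: eq_bigr => z gz.
  exact: (cond_real_int (@gen_m _ _ _) (mR t) (@lawR t) (@Tr_gen t z) (@Tr_rew t z) (fi z gz)).
rewrite -Rint_sum; last first.
  move=> z gz; apply: L1M => //; apply: L1M => //; first exact: bnd_indic.
  by apply: L1_bnd => //; exact: bnd_cst.
apply: Rint_ae => //.
- apply: measurable_sum_cond => z _; apply: measurable_funM => //; exact: measurable_funM.
- exact: measurable_funM.
- apply: filterS (good_sum t (fun z _ => mf' z)) => w h.
  by rewrite -mulr_sumr h.
Qed.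

Lemma reward_sq_le t B : Gx t B ->
  \int[P]_(w in B) Rs t w ^+ 2 <= rew_var * fine (P B).
Proof.
move=> GB; have mB : measurable B by exact: gen_m GB.
rewrite -Rint_indic// (@Rint_good t (fun u => u ^+ 2) (\1_B)); first last.
- exact: bnd_indic.
- by apply: meas_wrt_indic => //; exact: sigma_algebra_gen.
- exact: measurable_funX.
- by move=> -[[x a] y] gz; exact: rew_L2.
pose m2 (z : X * A * X) := \int[rew z.1.1 z.1.2 z.2]_u u ^+ 2.
have mm2 : measurable_fun setT (fun w => m2 (Tr t w)).
  apply/meas_wrt_measurable; apply: (meas_wrt_fin_comp (h := fun z _ => m2 z)).
  - exact: sigma_algebra_measurable.
  - by move=> z; apply: gen_m; exact: Tr_gen.
  - by move=> z; apply/meas_wrt_measurable.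
have bm2 : bnd (fun w => m2 (Tr t w)).
  by apply: (@bnd_fin_comp _ _ _ _ (Tr t) (fun z _ => m2 z)) => z; exact: bnd_cst.
(* [rew_var] dominates only the admissible second moments; the others are replaced by 0, which
   changes nothing almost everywhere. *)
pose mm w := if good (Tr t w) then m2 (Tr t w) else 0.
have mmE : {ae P, forall w, \1_B w * m2 (Tr t w) = \1_B w * mm w}.
  by apply: filterS acts_ae => w /(_ t) gw; rewrite /mm /good/= gw.
have mmm : measurable_fun setT mm.
  apply/meas_wrt_measurable.
  apply: (meas_wrt_fin_comp (h := fun z _ => if good z then m2 z else 0)).
  - exact: sigma_algebra_measurable.
  - by move=> z; apply: gen_m; exact: Tr_gen.
  - by move=> z; apply/meas_wrt_measurable.
have bmm : bnd mm.
  apply: (@bnd_fin_comp _ _ _ _ (Tr t) (fun z _ => if good z then m2 z else 0)) => z.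
  exact: bnd_cst.
have mI : measurable_fun setT (\1_B : Omega -> R) by exact: measurable_indic.
rewrite (Rint_ae measurableT _ _ mmE); [|exact: measurable_funM|exact: measurable_funM].
rewrite mulrC -Rint_indic1// -RintegralZr//; last first.
  by apply: L1_bnd => //; exact: bnd_indic.
apply: le_Rintegral => //.
- by apply: L1_bnd; [exact: measurable_funM|apply: bndM => //; exact: bnd_indic].
- by apply: L1M => //; [exact: bnd_indic|apply: L1_bnd => //; exact: bnd_cst].
- move=> w _; apply: ler_wpM2l; first by rewrite indicE ler0n.
  rewrite /mm; case: ifP => gw; first exact: rew_var_ge.
  exact: rew_var_ge0.
Qed.

Let sFs t : sigma_algebra setT (Fs t). Proof. exact: sigma_algebra_gen. Qed.

Let Fs_mono t T : Fs t `<=` Fs (t + T).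
Proof. by apply: gen_mono; rewrite ?ltnS leq_addr. Qed.

Let Fs_Gx t : Fs t `<=` Gx t.
Proof. exact: gen_mono. Qed.

Let Fs_Ga t : Fs t `<=` Ga t.
Proof. exact: gen_mono. Qed.

Let fin_meas_F F (T : finType) (Y : Omega -> T) (h : T -> R) : sigma_algebra setT F ->
  (forall y, F (Y @^-1` [set y])) -> meas_wrt F (fun w => h (Y w)).
Proof.
move=> sF FY; apply: (@meas_wrt_fin_comp _ _ _ F _ Y (fun y _ => h y)) => // y.
exact: meas_wrt_cst.
Qed.

Let SA t w : X * A := (Xs t w, As t w).

Let SA_gen t z : Fs t (SA t @^-1` [set z]).
Proof.
rewrite (_ : _ @^-1` _ = Xs t @^-1` [set z.1] `&` As t @^-1` [set z.2]).
  by apply: (sigma_setI (@sFs t)); [exact: gen_X|exact: gen_A].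
apply/seteqP; split => w /=; rewrite /SA; first by move=> <-.
by case: z => x a /= [-> ->].
Qed.

(** The reward is averaged given the whole transition, then the next state given the current pair.
    [v] may depend on [w] because the policy in force depends on past episodes. *)
Lemma transition_value t (Z : Omega -> R) (v : Omega -> X -> R) :
  meas_wrt (Fs t) Z -> bnd Z ->
  (forall y, meas_wrt (Fs t) (fun w => v w y)) -> (forall y, bnd (fun w => v w y)) ->
  \int[P]_w (Z w * Rs t w) + gamma * \int[P]_w (Z w * v w (Xs t.+1 w)) =
  \int[P]_w (Z w * qval gamma (v w) (Xs t w) (As t w)).
Proof.
move=> mZ bZ mv bv.
have FsM (f : Omega -> R) : meas_wrt (Fs t) f -> measurable_fun setT f.
  by move=> mf; apply/meas_wrt_measurable; apply: meas_wrtS mf; exact: gen_m.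
have mZ' : measurable_fun setT Z by exact: FsM.
have mtr y : meas_wrt (Fs t) (fun w => trans (Xs t w) (As t w) y).
  by apply: (@fin_meas_F _ _ (SA t) (fun z => trans z.1 z.2 y)) => //.
have btr y : bnd (fun w => trans (Xs t w) (As t w) y).
  by apply: (@bnd_fin_comp _ _ _ _ (SA t) (fun z _ => trans z.1 z.2 y)) => z; exact: bnd_cst.
have stepX (V : X -> Omega -> R) : (forall y, meas_wrt (Fs t) (V y)) -> (forall y, bnd (V y)) ->
    \int[P]_w (Z w * V (Xs t.+1 w) w) =
    \int[P]_w (Z w * \sum_y trans (Xs t w) (As t w) y * V y w).
  move=> mV bV.
  rewrite (cond_fin_comp (Z := fun y w => Z w * V y w) (@gen_m _ _ _) (mX t.+1) _ _ (@lawX t)).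
  - by apply: eq_Rintegral => w _; rewrite mulr_sumr; apply: eq_bigr => y _; ring.
  - by move=> y; exact: FsM.
  - by [].
  - by move=> y; exact: meas_wrtM.
  - by move=> y; exact: bndM.
have -> : \int[P]_w (Z w * Rs t w) = \int[P]_w (Z w * mean_rew (Xs t w) (As t w)).
  rewrite (@Rint_good t id)//; last 2 first.
  - by move=> -[[x a] y] gz; exact: rew_integrable.
  - exact: meas_wrtS (@Fs_Gx t) mZ.
  apply: (stepX (fun y w => \int[rew (Xs t w) (As t w) y]_u u)).
    move=> y; apply: (@fin_meas_F _ _ (SA t) (fun z => \int[rew z.1 z.2 y]_u u)) => //.
  move=> y; apply: (@bnd_fin_comp _ _ _ _ (SA t) (fun z _ => \int[rew z.1 z.2 y]_u u)) => z.
  exact: bnd_cst.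
rewrite (stepX (fun y w => v w y))//.
have mmr : meas_wrt (Fs t) (fun w => mean_rew (Xs t w) (As t w)).
  by apply: (@fin_meas_F _ _ (SA t) (fun z => mean_rew z.1 z.2)) => //.
have bmr : bnd (fun w => mean_rew (Xs t w) (As t w)).
  by apply: (@bnd_fin_comp _ _ _ _ (SA t) (fun z _ => mean_rew z.1 z.2)) => z; exact: bnd_cst.
have mS : meas_wrt (Fs t) (fun w => \sum_y trans (Xs t w) (As t w) y * v w y).
  by apply: meas_wrt_sum => // y _; exact: meas_wrtM.
have bS : bnd (fun w => \sum_y trans (Xs t w) (As t w) y * v w y).
  by apply: bnd_sum => y _; exact: bndM.
have LbM (f : Omega -> R) : meas_wrt (Fs t) f -> bnd f -> L1 P f by move=> mf; apply: L1_bnd; exact: FsM.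
rewrite -RintegralZl//; last by apply: LbM; [exact: meas_wrtM|exact: bndM].
rewrite -RintegralD//.
- by apply: eq_Rintegral => w _; rewrite /qval; ring.
- by apply: LbM; [exact: meas_wrtM|exact: bndM].
- by apply: L1Z; apply: LbM; [exact: meas_wrtM|exact: bndM].
Qed.

Lemma action_value t (Z : Omega -> R) (q : Omega -> X -> A -> R) :
  meas_wrt (Fs t) Z -> bnd Z ->
  (forall x a, meas_wrt (Fs t) (fun w => q w x a)) -> (forall x a, bnd (fun w => q w x a)) ->
  \int[P]_w (Z w * q w (Xs t.+1 w) (As t.+1 w)) =
  \int[P]_w (Z w * \sum_a p t.+1 w a * q w (Xs t.+1 w) a).
Proof.
move=> mZ bZ mq bq.
have sGa : sigma_algebra setT (Ga t) by exact: sigma_algebra_gen.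
have mqX a : meas_wrt (Ga t) (fun w => q w (Xs t.+1 w) a).
  apply: (@meas_wrt_fin_comp _ _ _ _ _ (Xs t.+1) (fun x w => q w x a)) => //.
    by move=> x; exact: gen_X.
  by move=> x; apply: meas_wrtS (mq x a); exact: Fs_Ga.
have bqX a : bnd (fun w => q w (Xs t.+1 w) a).
  by apply: (@bnd_fin_comp _ _ _ _ (Xs t.+1) (fun x w => q w x a)) => x.
rewrite (cond_fin_comp (Z := fun a w => Z w * q w (Xs t.+1 w) a) (@gen_m _ _ _)
  (mA t.+1) (mp t.+1) (bp t.+1) (@lawA t)).
- by apply: eq_Rintegral => w _; rewrite mulr_sumr; apply: eq_bigr => a _; ring.
- by move=> a; apply: meas_wrtM => //; apply: meas_wrtS mZ; exact: Fs_Ga.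
- by move=> a; exact: bndM.
Qed.

(** * Discounted returns from a fixed time [n] *)

Section Returns.
Variable n : nat.

Let part T w : R := \sum_(t < T) gamma ^+ t * Rs (n + t) w.
Let sq T w : R := \sum_(t < T) gamma ^+ t * Rs (n + t) w ^+ 2.
Let G w : R := ret gamma (fun t => Rs (n + t)) w.

Let g0 : 0 <= gamma. Proof. by case/andP: gamma01. Qed.
Let g1 : 0 < 1 - gamma. Proof. by rewrite subr_gt0; case/andP: gamma01. Qed.

Let L1_part T : L1 P (part T).
Proof. by apply: L1_sum => t _; apply: L1Z. Qed.

Let L1_sq T : L1 P (sq T).
Proof. by apply: L1_sum => t _; apply: L1Z. Qed.

Lemma geometric_partial_le T : \sum_(t < T) gamma ^+ t <= (1 - gamma)^-1.
Proof.
have h : (1 - gamma) * \sum_(t < T) gamma ^+ t = 1 - gamma ^+ T.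
  by rewrite -[in RHS](expr1n _ T) subrXX; congr (_ * _); apply: eq_bigr => i _;
    rewrite expr1n mul1r.
rewrite -(ler_pM2l g1) h divff ?gt_eqF// lerBlDr lerDl.
exact: exprn_ge0.
Qed.

Let sq_le T B : Fs n B -> \int[P]_(w in B) sq T w <= rew_var / (1 - gamma) * fine (P B).
Proof.
move=> FB; have mB : measurable B by exact: gen_m FB.
have -> : \int[P]_(w in B) sq T w = \sum_(t < T) gamma ^+ t * \int[P]_(w in B) Rs (n + t) w ^+ 2.
  rewrite -Rint_indic// /sq; under eq_Rintegral do rewrite mulr_sumr.
  have mI : measurable_fun setT (\1_B : Omega -> R) by exact: measurable_indic.
  rewrite Rint_sum; last by move=> t _; apply: L1M => //; [exact: bnd_indic|exact: L1Z].
  apply: eq_bigr => t _; rewrite Rint_indic// RintegralZl//.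
  exact: L1S.
apply: (@le_trans _ _ (\sum_(t < T) gamma ^+ t * (rew_var * fine (P B)))).
  apply: ler_sum => t _; rewrite ler_wpM2l ?exprn_ge0//.
  by apply: reward_sq_le; apply: Fs_Gx; exact: Fs_mono FB.
rewrite -mulr_suml [leRHS]mulrAC [leRHS]mulrC; apply: ler_wpM2r.
  by rewrite mulr_ge0 ?rew_var_ge0// fine_ge0.
exact: geometric_partial_le.
Qed.

(* Convexity of the square: [u + gamma * s] is the mean of [u / (1 - gamma)]
   and [s] with weights [1 - gamma] and [gamma]. *)
Lemma discounted_sq_le (u : nat -> R) T :
  (\sum_(t < T) gamma ^+ t * u t) ^+ 2 <= (\sum_(t < T) gamma ^+ t * u t ^+ 2) / (1 - gamma).
Proof.
have rec (f : nat -> R) k :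
    \sum_(t < k.+1) gamma ^+ t * f t = f 0%N + gamma * \sum_(t < k) gamma ^+ t * f t.+1.
  rewrite big_ord_recl expr0 mul1r mulr_sumr; congr (_ + _).
  by apply: eq_bigr => i _; rewrite exprS mulrA.
elim: T u => [|T IH] u; first by rewrite !big_ord0 expr0n mul0r.
rewrite rec (rec (fun t => u t ^+ 2)); have := IH (fun t => u t.+1).
set s := \sum_(t < T) _; set r := \sum_(t < T) _; move=> sr.
rewrite ler_pdivlMr//; rewrite ler_pdivlMr// in sr.
have gs : gamma * (s ^+ 2 * (1 - gamma)) <= gamma * r by rewrite ler_wpM2l.
(* This term is exactly the gap in the convexity inequality multiplied by [1 - gamma]. *)
have := mulr_ge0 g0 (sqr_ge0 (u 0%N - (1 - gamma) * s)).
by move: gs; nra.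
Qed.

(** The dominating function of the section: it controls the squares of all partial returns and,
    through [|z| <= 1 + z ^+ 2], gives absolute convergence wherever its series converges. *)
Let sqL w := limn (fun T => sq T w).

Let sqP : [/\ {ae P, forall w, cvgn (fun T => sq T w)},
   L1 P sqL &
   forall B, Fs n B -> \int[P]_(w in B) sqL w <= rew_var / (1 - gamma) * fine (P B)].
Proof.
have [||||h1 h2 h3] := @beppo_levi _ _ _ P sq (rew_var / (1 - gamma) * fine (P setT)).
- exact: L1_sq.
- by move=> T w; apply: sumr_ge0 => t _; rewrite mulr_ge0 ?sqr_ge0 ?exprn_ge0//.
- move=> T w; rewrite /sq big_ord_recr/= lerDl.
  by rewrite mulr_ge0 ?sqr_ge0 ?exprn_ge0//.
- by move=> T; apply: sq_le; exact: sigma_setT.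
- split=> // B FB; apply: h3; first exact: gen_m FB.
  by move=> T; exact: sq_le.
Qed.

Let mG : measurable_fun setT G.
Proof.
apply/meas_wrt_measurable; apply: meas_wrt_ret; first exact: sigma_algebra_measurable.
by move=> t; apply/meas_wrt_measurable.
Qed.

Let sq_nd w : nondecreasing_seq (fun T => sq T w).
Proof.
apply/nondecreasing_seqP => T; rewrite /sq big_ord_recr/= lerDl.
by rewrite mulr_ge0 ?sqr_ge0 ?exprn_ge0//.
Qed.

Let part_ae : {ae P, forall w, (fun T => part T w) @ \oo --> G w /\
   forall T, part T w ^+ 2 <= sqL w / (1 - gamma)}.
Proof.
have [cv _ _] := sqP; apply: filterS cv => w cw; split; last first.
  move=> T; apply: le_trans (discounted_sq_le (fun t => Rs (n + t) w) T) _.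
  rewrite ler_pM2r ?invr_gt0//.
  exact: (nondecreasing_cvgn_le (sq_nd w) cw T).
have : cvgn (series (fun t => gamma ^+ t * Rs (n + t) w)).
  apply: normed_cvg.
  pose a := series (fun t => gamma ^+ t) : nat -> R.
  have ca : cvgn a.
    have := @is_cvg_geometric_series R 1 gamma; rewrite ger0_norm// => /(_ _).
    rewrite (_ : geometric 1 gamma = (fun t => gamma ^+ t)); last first.
      by apply/funext => t /=; rewrite mul1r.
    by apply; case/andP: gamma01.
  have cs : cvgn (series (fun t => gamma ^+ t * Rs (n + t) w ^+ 2)).
    by rewrite (_ : series _ = (fun T => sq T w))//; apply/funext => T; rewrite seriesEord.
  have cc := is_cvg_seriesD ca cs.
  apply: series_le_cvg cc.
  - by move=> t; exact: normr_ge0.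
  - move=> t; apply: addr_ge0; first exact: exprn_ge0.
    by apply: mulr_ge0; [exact: exprn_ge0|exact: sqr_ge0].
  - move=> t /=; rewrite normrM ger0_norm ?exprn_ge0// -[leRHS]/(_ ^+ _ + _ * _).
    rewrite -[X in X + _]mulr1 -mulrDr ler_wpM2l ?exprn_ge0// ler_norml.
    by apply/andP; split; nra.
by rewrite /G /ret seriesEord.
Qed.

Lemma return_L1 : L1 P G /\ forall B, measurable B ->
  (fun T => \int[P]_(w in B) part T w) @ \oo --> \int[P]_(w in B) G w.
Proof.
have [cv L h] := sqP.
apply: (@Rint_dominated _ _ _ P part G (fun w => 1 + sqL w / (1 - gamma))) => //.
- by move=> T; exact: L1_measurable.
- by apply: filterS part_ae => w [].
- apply: L1D; first by apply: L1_bnd => //; exact: bnd_cst.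
  by under eq_fun do rewrite mulrC; exact: L1Z.
- apply: filterS part_ae => w [_ hw] T; have := hw T.
  rewrite ler_norml => hT; apply/andP; split; nra.
Qed.

(** One factor [1 / (1 - gamma)] comes from the convexity bound, the other from the sum of the
    geometric weights. *)
Lemma return_sq : L1 P (fun w => G w ^+ 2) /\ forall B, Fs n B ->
  \int[P]_(w in B) G w ^+ 2 <= rew_var / (1 - gamma) ^+ 2 * fine (P B).
Proof.
have [cv L h] := sqP.
pose b w := (1 - gamma)^-1 * sqL w.
have Lb : L1 P b by exact: L1Z.
have Gb : {ae P, forall w, G w ^+ 2 <= b w}.
  apply: filterS part_ae => w [cw hw]; rewrite /b mulrC.
  have c2 : (fun T => part T w ^+ 2) @ \oo --> G w ^+ 2.
    by under eq_fun do rewrite expr2; rewrite expr2; apply: cvgM.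
  rewrite -(cvg_lim _ c2)//; apply: limr_le; first by apply/cvg_ex; eexists; exact: c2.
  exact: nearW.
(* The bound by [b] holds almost everywhere only; the maximum holds everywhere and has the same
   integrals. *)
pose b' w := Num.max (b w) (G w ^+ 2).
have mG2 : measurable_fun setT (fun w => G w ^+ 2) by exact: measurable_funX.
have bb' : {ae P, forall w, b w = b' w}.
  by apply: filterS Gb => w hw; rewrite /b' max_l.
have mb' : measurable_fun setT b' by apply: measurable_maxr => //; exact: (L1_measurable Lb).
have Lb' : L1 P b' by exact: L1_ae bb' Lb.
have LG2 : L1 P (fun w => G w ^+ 2).
  apply: (L1_le (g := b')) => // w; rewrite ger0_norm ?sqr_ge0//.
  by rewrite /b' le_max lexx orbT.
split=> // B FB; have mB : measurable B by exact: gen_m FB.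
apply: (@le_trans _ _ (\int[P]_(w in B) b' w)).
  apply: le_Rintegral => //; [exact: L1S|exact: L1S|].
  by move=> w _; rewrite /b' le_max lexx orbT.
rewrite -(Rint_ae mB (L1_measurable Lb) mb' bb') RintegralZl//; last exact: L1S.
have := h B FB; rewrite -(ler_pM2l (_ : 0 < (1 - gamma)^-1)) ?invr_gt0//.
move=> /le_trans; apply.
by rewrite le_eqVlt; apply/orP; left; apply/eqP; rewrite expr2 invfM; ring.
Qed.

Section Values.
Variables (v : Omega -> X -> R) (B : set Omega).
Hypothesis FB : Fs n B.
Hypothesis mv : forall y, meas_wrt <<s G0 >> (fun w => v w y).
Hypothesis bv : forall y, bnd (fun w => v w y).

Let q w x a := qval gamma (v w) x a.
Let Z : Omega -> R := \1_B.

Let mq t x a : meas_wrt (Fs t) (fun w => q w x a).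
Proof.
apply: meas_wrtD => //; first exact: meas_wrt_cst.
apply: meas_wrtM => //; first exact: meas_wrt_cst.
apply: meas_wrt_sum => // y _; apply: meas_wrtM => //; first exact: meas_wrt_cst.
by apply: meas_wrtS (mv y); exact: gen_base.
Qed.

Let bq x a : bnd (fun w => q w x a).
Proof.
apply: bndD; first exact: bnd_cst.
apply: bndM; first exact: bnd_cst.
by apply: bnd_sum => y _; apply: bndM => //; exact: bnd_cst.
Qed.

Let mZ T : meas_wrt (Fs (n + T)) Z.
Proof. by apply: meas_wrt_indic => //; exact: Fs_mono FB. Qed.

Let bZ : bnd Z. Proof. exact: bnd_indic. Qed.

Let mB : measurable B. Proof. exact: gen_m FB. Qed.

Let qnT T := \int[P]_w (Z w * q w (Xs (n + T) w) (As (n + T) w)).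
(** The rewards of the first [T] steps, with the action value as a forecast of the rest: [val] leads
    from the forecast at time [n] to the full return. *)
Let val T := \int[P]_(w in B) part T w + gamma ^+ T * qnT T.

Let qnT_bound : exists K, forall T, `|qnT T| <= K.
Proof.
have [K hK] : exists K, forall x a w, `|q w x a| <= K.
  have [c hc] := choice (fun z : X * A => bq z.1 z.2).
  exists (\sum_z c z) => x a w; apply: le_trans (hc (x, a) w) _.
  rewrite (bigD1 (x, a))//= lerDl; apply: sumr_ge0 => z _.
  exact: le_trans (hc z w).
exists K => T; have mqT : measurable_fun setT (fun w => Z w * q w (Xs (n + T) w) (As (n + T) w)).
  apply/meas_wrt_measurable; apply: (meas_wrtS (F := Fs (n + T))); first exact: gen_m.
  apply: meas_wrtM => //.
  apply: (@meas_wrt_fin_comp _ _ _ _ _ (SA (n + T)) (fun z w => q w z.1 z.2)) => //.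
have bqT w : `|Z w * q w (Xs (n + T) w) (As (n + T) w)| <= K.
  rewrite normrM -[leRHS]mul1r ler_pM// /Z indicE.
  by case: (_ \in _); rewrite ?normr1 ?normr0.
have LT : L1 P (fun w => Z w * q w (Xs (n + T) w) (As (n + T) w)) by apply: L1_bnd => //; exists K.
apply: le_trans (le_normr_Rintegral measurableT LT) _.
rewrite -[leRHS](Rint_cst P); apply: le_Rintegral => //.
- exact: L1_norm.
- by apply: L1_bnd => //; exact: bnd_cst.
Qed.

Let val_cvg : val @ \oo --> \int[P]_(w in B) G w.
Proof.
rewrite -[X in _ --> X]addr0; apply: cvgD.
  by have [_] := return_L1; apply.
have [K hK] := qnT_bound.
apply/cvgr0Pnorm_le => e e0.
have : geometric K gamma @ \oo --> 0.
  by apply: cvg_geometric; rewrite ger0_norm//; case/andP: gamma01.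
move=> /cvgr0Pnorm_le/(_ _ e0); apply: filterS => T /= hT.
apply: le_trans hT; rewrite !normrM mulrC ler_wpM2r//.
exact: le_trans (hK T) (ler_norm _).
Qed.

(** The increment measures the failure of the Bellman equation by [v]: it is 0 for the value of the
    policy itself and at most 0 for a supersolution such as [vopt]. *)
Let val_step T : val T.+1 = val T + gamma ^+ T.+1 *
  (\int[P]_w (Z w * \sum_a p (n + T).+1 w a * q w (Xs (n + T).+1 w) a)
   - \int[P]_w (Z w * v w (Xs (n + T).+1 w))).
Proof.
rewrite /val /qnT addnS.
have h1 := @transition_value (n + T) Z v (@mZ T) bZ
  (fun y => meas_wrtS (@gen_base _ _ _ _ _ _ _ _ _ _ _ _) (mv y)) bv.
have h2 := @action_value (n + T) Z q (@mZ T) bZ (@mq (n + T)) bq.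
rewrite h2 /q -h1 -(Rint_indic P (part T.+1) mB) -(Rint_indic P (part T) mB).
have mI : measurable_fun setT (\1_B : Omega -> R) by exact: measurable_indic.
have -> : \int[P]_w (\1_B w * part T.+1 w) =
    \int[P]_w (\1_B w * part T w) + gamma ^+ T * \int[P]_w (Z w * Rs (n + T) w).
  rewrite -RintegralZl//; last by apply: L1M.
  rewrite -RintegralD//; last 2 first.
  - by apply: L1M.
  - by apply: L1Z; apply: L1M.
  by apply: eq_Rintegral => w _; rewrite /part big_ord_recr/= /Z; ring.
by rewrite exprS; ring.
Qed.

Lemma return_value : (forall t w, \sum_a p t.+1 w a * q w (Xs t.+1 w) a = v w (Xs t.+1 w)) ->
  \int[P]_(w in B) G w = \int[P]_(w in B) q w (Xs n w) (As n w).
Proof.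
move=> pq; have val0 T : val T = val 0.
  elim: T => // T IH; rewrite val_step IH.
  by under eq_Rintegral do rewrite pq; rewrite subrr mulr0 addr0.
rewrite -(cvg_lim _ val_cvg)// (_ : val = fun=> val 0); last by apply/funext => T.
rewrite lim_cst// /val /qnT addn0 expr0 mul1r Rint_indic//.
rewrite /part; under eq_Rintegral do rewrite big_ord0.
by rewrite Rintegral_cst// mul0r add0r.
Qed.

Lemma return_value_le : (forall t w, \sum_a p t.+1 w a * q w (Xs t.+1 w) a <= v w (Xs t.+1 w)) ->
  \int[P]_(w in B) G w <= \int[P]_(w in B) q w (Xs n w) (As n w).
Proof.
move=> pq; have val0 T : val T <= val 0.
  elim: T => // T IH; rewrite val_step; apply: le_trans IH; rewrite gerDl.
  rewrite mulr_ge0_le0 ?exprn_ge0// subr_le0.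
  have mI : measurable_fun setT (\1_B : Omega -> R) by exact: measurable_indic.
  have GTm (f : Omega -> R) : meas_wrt (Ga (n + T)) f -> measurable_fun setT f.
    by move=> mf; apply/meas_wrt_measurable; apply: meas_wrtS mf; exact: gen_m.
  have sGa : sigma_algebra setT (Ga (n + T)) by exact: sigma_algebra_gen.
  have XGa y : Ga (n + T) (Xs (n + T).+1 @^-1` [set y]) by exact: gen_X.
  have mqX a : measurable_fun setT (fun w => q w (Xs (n + T).+1 w) a).
    apply: GTm; apply: (@meas_wrt_fin_comp _ _ _ _ _ (Xs (n + T).+1) (fun x w => q w x a)) => // x.
    by apply: (meas_wrtS (F := Fs (n + T))) => //; exact: Fs_Ga.
  have bqX a : bnd (fun w => q w (Xs (n + T).+1 w) a).
    by apply: (@bnd_fin_comp _ _ _ _ (Xs (n + T).+1) (fun x w => q w x a)) => x.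
  apply: le_Rintegral => //.
  - apply: L1M => //; apply: L1_sum => a _; apply: L1M => //; exact: L1_bnd.
  - apply: L1M => //; apply: L1_bnd; last first.
      by apply: (@bnd_fin_comp _ _ _ _ (Xs (n + T).+1) (fun y w => v w y)).
    apply: GTm; apply: (@meas_wrt_fin_comp _ _ _ _ _ (Xs (n + T).+1) (fun y w => v w y)) => // y.
    by apply: meas_wrtS (mv y); exact: gen_base.
  - by move=> w _; apply: ler_wpM2l; [rewrite /Z indicE ler0n|exact: pq].
rewrite -(cvg_lim _ val_cvg)//; apply: (@le_trans _ _ (val 0)).
  by apply: limr_le; [apply/cvg_ex; eexists; exact: val_cvg|exact: nearW].
rewrite /val /qnT addn0 expr0 mul1r Rint_indic//.
rewrite /part; under eq_Rintegral do rewrite big_ord0.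
by rewrite Rintegral_cst// mul0r add0r.
Qed.

End Values.
End Returns.
End MDPProcess.

(** * Simulation of a policy on the unit interval *)

Lemma prob_restrict {R : realType} {d : measure_display} {Omega : measurableType d}
    (P : probability Omega R) (I A : set Omega) :
  measurable I -> P I = 1%E -> measurable A -> P A = P (A `&` I).
Proof.
move=> mI PI mA; transitivity (P (A `&` I) + P (A `&` ~` I))%E.
  rewrite -measureU//.
  - by rewrite -setIUr setUv setIT.
  - exact: measurableI.
  - by apply: measurableI => //; exact: measurableC.
  - by apply/seteqP; split => // u [[_ h] [_]].
rewrite [X in (_ + X)%E](_ : _ = 0%E) ?adde0//.
have PC : P (~` I) = 0%E by rewrite probability_setC// PI subee.
apply/eqP; rewrite eq_le measure_ge0 andbT -PC; apply: le_measure;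
  rewrite ?inE//; [apply: measurableI => //|]; exact: measurableC.
Qed.

Section RayLaw.
Context {R : realType} {d : measure_display} {Omega : measurableType d}.
Variables (P : probability Omega R) (Y : Omega -> R) (mu : probability R R) (B : set Omega).
Hypothesis mY : measurable_fun setT Y.
Hypothesis mB : measurable B.
Hypothesis rays : forall x, P (B `&` Y @^-1` `]-oo, x]%classic) = (P B * mu `]-oo, x]%classic)%E.

(** Two finite measures that agree on a generating pi-system coincide; the open rays []x, +oo[] form
    one, and are reached from the hypothesis by complement. *)
Lemma law_of_rays D : measurable D -> P (B `&` Y @^-1` D) = (P B * mu D)%E.
Proof.
have r0 : 0 <= fine (P B) by exact: fine_ge0.
pose m1f : {measure set R -> \bar R} := pushforward (mrestr P mB) Y.
pose m1 := m1f mY.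
pose m2 : {measure set R -> \bar R} := mscale (NngNum r0) mu.
have m1E A : m1 A = P (B `&` Y @^-1` A) by rewrite /m1/= /pushforward /mrestr setIC.
have m2E A : m2 A = (P B * mu A)%E by rewrite /m2/= /mscale/= fineK// fin_num_measure.
rewrite -m1E -m2E => mD.
pose G : set (set R) := [set A | exists x, A = `]x, +oo[%classic].
have Gm : G `<=` measurable by move=> _ [x ->]; exact: measurable_itv.
have mT : m1 setT = m2 setT.
  by rewrite m1E m2E preimage_setT setIT probability_setT mule1.
have fT : (m1 setT < +oo)%E.
  by rewrite m1E preimage_setT setIT (le_lt_trans (probability_le1 P mB))// ltry.
have H1 : [set X | G X /\ X `<=` setT] = G.
  by apply/seteqP; split => A; [case|split].
have := @g_sigma_algebra_measure_unique_trace _ R R G setT measurableT; rewrite H1.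
move=> /(_ Gm _ m1 m2 mT _ fT _ D); apply.
- move=> _ _ [x ->] [y ->]; exists (Num.max x y); apply/seteqP; split => z /=;
    rewrite !in_itv/= !andbT gt_max; first by move=> [-> ->].
  by move=> /andP[].
- move=> _ [x ->]; rewrite -[X in m1 X]setCK -[X in m2 X]setCK setCitvr.
  rewrite -[X in m1 X]setTD -[X in m2 X]setTD.
  rewrite !measureD ?setTI//.
  + have er : m1 `]-oo, x]%classic = m2 `]-oo, x]%classic by rewrite m1E m2E rays.
    by congr (_ - _)%E; [exact: mT|exact: er].
  + by apply: le_lt_trans fT; rewrite mT.
- by [].
- have : (@RGenOInfty.G R).-sigma.-measurable D by rewrite -RGenOInfty.measurableE.
  exact.
Qed.

End RayLaw.

(** * Binary digits of a uniform variable *)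

Section Bits.
Variable R : realType.

Let idR : measurableTypeR R -> R := idfun.
Let measurable_idR : measurable_fun setT idR.
Proof. by move=> _ D mD; rewrite setTI. Qed.
HB.instance Definition _ := isMeasurableFun.Build _ _ _ _ idR measurable_idR.

(* The library puts [uniform_prob] on [measurableTypeR R], whose display is not
   the canonical one of [R]. *)
Lemma uniform_on_R : {mu : probability R R |
  forall A : set R, measurable A -> mu A = lebesgue_measure (A `&` `[0, 1]%classic)}.
Proof.
pose unif0 : probability (measurableTypeR R) R := uniform_prob (@ltr01 R).
exists (distribution unif0 idR) => A mA.
have mi : measurable_fun setT (EFin \o \1_A : measurableTypeR R -> \bar R).
  by apply/measurable_EFinP; exact: measurable_indic.
have := integral_uniform (@ltr01 R) mi.
rewrite integral_indic// setIT subr0 invr1 mul1e integral_indic// => <- //.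
by move=> x; rewrite lee_fin.
Qed.

Definition unif : probability R R := sval uniform_on_R.

Lemma unifE (A : set R) : measurable A ->
  unif A = lebesgue_measure (A `&` `[0, 1]%classic).
Proof. exact: (svalP uniform_on_R). Qed.

Lemma unif_itv (A : set R) (i : interval R) : measurable A ->
  A `&` `[0, 1]%classic = [set` i] ->
  unif A = (if i.1 < i.2 then (i.2 : \bar R) - i.1 else 0)%E.
Proof. by move=> mA Ai; rewrite unifE// Ai lebesgue_measure_itv. Qed.

(** The distribution function of the uniform law on [[0, 1]]. *)
Definition clip (x : R) : R := Num.min (Num.max x 0) 1.

Lemma unif_ray x : unif `]-oo, x]%classic = (clip x)%:E.
Proof.
rewrite (@unif_itv _ `[0, (Num.min x 1)])//=; last first.
  apply/seteqP; split => u /=; rewrite !in_itv/= le_min; first by move=> [-> /andP[-> ->]].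
  by move=> /and3P[-> -> ->].
rewrite lte_fin -EFinB subr0 /clip lt_min ltr01 andbT.
by case: ltP => x0 //; rewrite min_l.
Qed.

Lemma unif_lt_half : unif `]-oo, 1 / 2[%classic = (1 / 2)%:E.
Proof.
rewrite (@unif_itv _ `[0, (1 / 2)[)//=; last first.
  apply/seteqP; split => u /=; rewrite !in_itv/=; first by move=> [-> /andP[->]].
  by move=> /andP[-> uh]; split=> //; rewrite (le_trans (ltW uh))// ler_pdivrMr// mul1r ler1n.
by rewrite lte_fin divr_gt0// -EFinB subr0.
Qed.

(** On [[0, 1[] this is multiplication by 2 modulo 1, so [bit k] reads the binary digit of weight
    [2^-(k + 1)]. *)
Definition doubling (u : R) : R := if 1 / 2 <= u then 2 * u - 1 else 2 * u.

Definition bit (k : nat) (u : R) : bool := 1 / 2 <= iter k doubling u.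

Lemma measurable_doubling : measurable_fun setT doubling.
Proof.
apply: measurable_fun_ifT => //; first exact: measurable_fun_ler.
by apply: measurable_funB => //; exact: measurable_funM.
Qed.

Let half (c : bool) : set R := [set u | (1 / 2 <= u) = c].

Let half_true : half true = `[1 / 2, +oo[%classic.
Proof. by apply/seteqP; split => u /=; rewrite in_itv/= andbT. Qed.

Let half_false : half false = `]-oo, 1 / 2[%classic.
Proof.
by apply/seteqP; split => u /=; rewrite in_itv/= ltNge; [move=> ->|move=> /negbTE].
Qed.

Let mhalf c : measurable (half c).
Proof. by case: c; rewrite ?half_true ?half_false; exact: measurable_itv. Qed.

Let unif_half c : unif (half c) = (1 / 2)%:E.
Proof.
case: c; last by rewrite half_false unif_lt_half.
rewrite half_true -[X in unif X]setCK setCitvr probability_setC//.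
by rewrite [X in (1 - X)%E](_ : _ = (1 / 2)%:E) ?unif_lt_half// -EFinB; congr EFin; lra.
Qed.

Let unif_half_ray c x : unif (half c `&` doubling @^-1` `]-oo, x]%classic) =
  (unif (half c) * unif `]-oo, x]%classic)%E.
Proof.
rewrite unif_half unif_ray -EFinM.
have h12 : 1 / 2 < 1 :> R by lra.
case: c.
  have -> : half true `&` doubling @^-1` `]-oo, x]%classic =
     if x < 0 then set0 else `]-oo, (x + 1) / 2]%classic `\` `]-oo, 1 / 2[%classic.
    apply/seteqP; split => u /=; rewrite /half/= !in_itv/= /doubling.
      move=> [h]; rewrite h /=; case: ifPn => /=; first by move=> x0 h'; move: h; lra.
      rewrite -leNgt !in_itv/= => x0 h'; split; first by move: h'; lra.
      by apply/negP; rewrite -leNgt.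
    case: ifPn => //= _; rewrite !in_itv/= => -[h1 /negP]; rewrite -leNgt => h2.
    by rewrite h2; split => //; lra.
  case: ltP => x0.
    by rewrite measure0 /clip max_r ?ltW// min_l// mulr0.
  rewrite measureD//=; last first.
    by rewrite (le_lt_trans (probability_le1 unif _))// ltry.
  rewrite (setIidr (_ : `]-oo, 1/2[%classic `<=` `]-oo, (x + 1) / 2]%classic)); last first.
    by move=> u /=; rewrite !in_itv/=; lra.
  rewrite unif_ray unif_lt_half -EFinB /clip; congr EFin.
  rewrite (max_l x0) (@max_l _ _ ((x + 1) / 2) 0); last by lra.
  by case: (leP x 1) => x1; case: (leP ((x + 1) / 2) 1) => x2; lra.
have -> : half false `&` doubling @^-1` `]-oo, x]%classic =
     if x < 1 then `]-oo, x / 2]%classic else `]-oo, 1 / 2[%classic.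
  apply/seteqP; split => u /=; rewrite /half/= !in_itv/= /doubling.
    move=> [h]; rewrite h /=; case: ifPn => x1; rewrite /= in_itv/= => h'; first lra.
    by rewrite ltNge h.
  case: ifPn => x1; rewrite /= in_itv/= => h.
    have h' : (1 / 2 <= u) = false by apply/negbTE; rewrite -ltNge; lra.
    by rewrite h'; split => //; lra.
  rewrite -leNgt in x1; have h' : (1 / 2 <= u) = false by apply/negbTE; rewrite -ltNge.
  by rewrite h'; split => //; lra.
case: ltP => x1; last first.
  by rewrite unif_lt_half /clip max_l ?(le_trans ler01)// min_r// mulr1.
rewrite unif_ray /clip; congr EFin.
case: (leP x 0) => x0.
  by rewrite !max_r ?min_l ?mulr0//; lra.
by rewrite !max_l ?min_l//; lra.
Qed.

(** Each half of the interval is stretched onto the whole, so the first digit is independent of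
    [doubling], whose law is again uniform. [f] tells which digits are allowed: none, one or
    both. *)
Lemma unif_doubling (f : bool -> bool) (B : set R) : measurable B ->
  unif ([set u | f (1 / 2 <= u)] `&` doubling @^-1` B) =
  ((((f true)%:R + (f false)%:R) / 2)%:E * unif B)%E.
Proof.
move=> mB; have mDB : measurable (doubling @^-1` B).
  by rewrite -[_ @^-1` _]setTI; exact: measurable_doubling.
have hc c : unif (half c `&` doubling @^-1` B) = ((1 / 2)%:E * unif B)%E.
  by rewrite (law_of_rays measurable_doubling (mhalf c) (unif_half_ray c))// unif_half.
case ft : (f true); case ff : (f false); rewrite /= ?addr0 ?add0r ?mul0r ?mul0e.
- rewrite (_ : [set _ | _] = setT); last first.
    by apply/seteqP; split => u //= _; case: (1 / 2 <= u).
  rewrite setTI (_ : _ @^-1` _ = (half true `&` doubling @^-1` B) `|` (half false `&` doubling @^-1` B)).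
    transitivity (unif (half true `&` doubling @^-1` B) + unif (half false `&` doubling @^-1` B))%E.
      apply: measureU; [exact: (measurableI _ _ (mhalf _) mDB)|exact: (measurableI _ _ (mhalf _) mDB)|].
      by apply/seteqP; split => // u [[h1 _] [h2 _]]; move: h1 h2; rewrite /half/= => ->.
    rewrite !hc -(fineK (fin_num_measure unif B mB)) -!EFinM -EFinD; congr EFin; lra.
  rewrite -setIUl (_ : _ `|` _ = setT) ?setTI//.
  by apply/seteqP; split => u //= _; case h : (1 / 2 <= u); [left|right].
- rewrite -(hc true); congr (unif (_ `&` _)); apply/seteqP; split => u /=;
    by rewrite /half/=; case: (1 / 2 <= u); rewrite ?ft ?ff.
- rewrite -(hc false); congr (unif (_ `&` _)); apply/seteqP; split => u /=;
    by rewrite /half/=; case: (1 / 2 <= u); rewrite ?ft ?ff.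
- rewrite (_ : [set _ | _] = set0) ?set0I ?measure0//.
  by apply/seteqP; split => u //=; case: (1 / 2 <= u); rewrite ?ft ?ff.
Qed.

End Bits.

(** * Independent uniform variables from disjoint rows of digits *)

Section IndependentUniforms.
Variable R : realType.
Local Notation unif := (unif R).
Local Notation dbl := (@doubling R).
Local Notation bit := (@bit R).

(** Cylinders are given by predicates on digits rather than by values: a free digit is one whose
    predicate is always true, and intersections keep the same form. *)
Definition bits_ev (N : nat) (S : nat -> bool -> bool) : set R :=
  [set u | forall k, (k < N)%N -> S k (bit k u)].

Definition wt (f : bool -> bool) : R := ((f true)%:R + (f false)%:R) / 2.

Lemma bits_evS N S : bits_ev N.+1 S =
  [set u | S 0%N (1 / 2 <= u)] `&` dbl @^-1` bits_ev N (fun k => S k.+1).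
Proof.
apply/seteqP; split => u /=.
  move=> h; split; first exact: (h 0%N).
  by move=> k kN; have := h k.+1 kN; rewrite /bit iterSr.
by move=> [h0 h] [|k] //= kN; have := h k kN; rewrite /bit -iterSr.
Qed.

Lemma measurable_bits_ev N S : measurable (bits_ev N S).
Proof.
elim: N S => [|N IH] S.
  by rewrite (_ : bits_ev 0 S = setT)//; apply/seteqP; split.
rewrite bits_evS; apply: measurableI; last first.
  by rewrite -[_ @^-1` _]setTI; apply: measurable_doubling.
rewrite (_ : [set _ | _] = (fun u => 1 / 2 <= u) @^-1` [set c | S 0%N c])//.
rewrite -[_ @^-1` _]setTI; apply: (@measurable_fun_ler _ _ R setT (fun=> 1 / 2) id) => //.
Qed.

Lemma unif_bits_ev N S : unif (bits_ev N S) = (\prod_(k < N) wt (S k))%:E.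
Proof.
elim: N S => [|N IH] S.
  rewrite big_ord0 (_ : bits_ev 0 S = setT) ?probability_setT//.
  by apply/seteqP; split.
rewrite bits_evS (unif_doubling (S 0%N)); last exact: measurable_bits_ev.
by rewrite IH -EFinM big_ord_recl.
Qed.

Definition trunc_sum (row : nat -> nat) (m : nat) (u : R) : R :=
  \sum_(j < m) (bit (row j) u)%:R * 2^-1 ^+ j.+1.

(** The distribution function of [m] independent fair digits summed with weights [2^-1, ..., 2^-m],
    by splitting on the last digit. *)
Fixpoint dyadic_cdf (m : nat) (x : R) : R :=
  if m is m'.+1 then (dyadic_cdf m' x + dyadic_cdf m' (x - 2^-1 ^+ m)) / 2
  else (0 <= x)%R%:R.

Definition fix_bit (N : nat) (S : nat -> bool -> bool) (i : nat) (c : bool) (k : nat) (b : bool) :=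
  ((k < N)%N ==> S k b) && ((k == i) ==> (b == c)).

Lemma fix_bit_ev N S i c : bits_ev N S `&` [set u | bit i u = c] =
  bits_ev (N + i.+1) (fix_bit N S i c).
Proof.
apply/seteqP; split => u /=.
  move=> [h hc] k _; rewrite /fix_bit; apply/andP; split; apply/implyP; first by move=> kN; exact: h.
  by move=> /eqP ->; exact/eqP.
move=> h; split; last first.
  have := h i; rewrite addnS ltnS leq_addl => /(_ isT) /andP[_].
  by rewrite eqxx => /eqP.
by move=> k kN; have := h k (leq_trans kN (leq_addr _ _)); rewrite /fix_bit kN => /andP[].
Qed.

Lemma unif_fix_bit N (S : nat -> bool -> bool) i c : (forall b, S i b) ->
  unif (bits_ev (N + i.+1) (fix_bit N S i c)) = ((1 / 2)%:E * unif (bits_ev N S))%E.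
Proof.
move=> Si; rewrite !unif_bits_ev -EFinM; congr EFin.
have wT : wt (fun=> true) = 1 by rewrite /wt/=; lra.
have iN : (i < N + i.+1)%N by rewrite addnS ltnS leq_addl.
rewrite (bigD1 (Ordinal iN))//=.
have -> : wt (fix_bit N S i c i) = 1 / 2.
  by rewrite /wt /fix_bit eqxx !Si !implybT; case: c; rewrite /= ?add0r ?addr0.
congr (_ * _).
have -> : \prod_(k < N) wt (S k) = \prod_(k < N + i.+1 | (k < N)%N) wt (S k).
  by rewrite (big_ord_widen _ (fun k => wt (S k)) (leq_addr i.+1 N)).
rewrite [LHS]big_mkcond [RHS]big_mkcond/=; apply: eq_bigr => k _.
rewrite -val_eqE/=; case: eqP => [ki|/eqP ki]/=.
  case: ifP => // _; rewrite -wT; congr wt; apply/funext => b.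
  by rewrite ki Si.
rewrite /fix_bit; case: ifP => kN; last first.
  by rewrite -wT; congr wt; apply/funext => b; rewrite ?kN (negbTE ki).
by congr wt; apply/funext => b; rewrite ?kN (negbTE ki) andbT.
Qed.

Lemma measurable_bit k : measurable_fun setT (bit k).
Proof.
apply: (@measurable_fun_ler _ _ R setT (fun=> 1 / 2) (iter k dbl)) => //.
elim: k => [|k IH]; first exact: measurable_id.
by apply: measurableT_comp => //; exact: measurable_doubling.
Qed.

Lemma measurable_trunc_sum row m : measurable_fun setT (trunc_sum row m).
Proof.
apply: measurable_sum => j; apply: measurable_funM => //.
rewrite (_ : (fun u => _) = \1_[set u | bit (row j) u]).
  apply: measurable_indic; rewrite -[X in measurable X]setTI.
  exact: (@measurable_bit (row j) measurableT [set true]).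
apply/funext => u; rewrite indicE; case h : (bit _ _); first by rewrite mem_set.
by rewrite memNset//= h.
Qed.

(** Induction splits on the digit [row m], which [S] leaves free and which injectivity keeps apart
    from the earlier ones. The resulting law depends on [m] but not on [row]. *)
Lemma trunc_sum_law row m N (S : nat -> bool -> bool) x : injective row ->
  (forall j b, (j < m)%N -> S (row j) b) ->
  unif (bits_ev N S `&` trunc_sum row m @^-1` `]-oo, x]%classic) =
  (unif (bits_ev N S) * (dyadic_cdf m x)%:E)%E.
Proof.
move=> irow; elim: m N S x => [|m IH] N S x SI.
  rewrite (_ : trunc_sum row 0 @^-1` _ = if 0 <= x then setT else set0); last first.
    apply/seteqP; split => u /=; rewrite in_itv/= /trunc_sum big_ord0; first by move=> ->.
    by case: ifP.
  by rewrite /=; case: ifP => _; rewrite ?setIT ?mule1 ?setI0 ?measure0 ?mule0.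
have mT c y : measurable (bits_ev (N + (row m).+1) (fix_bit N S (row m) c)
    `&` trunc_sum row m @^-1` `]-oo, y]%classic).
  apply: measurableI; first exact: measurable_bits_ev.
  by rewrite -[_ @^-1` _]setTI; apply: measurable_trunc_sum => //; exact: measurable_itv.
have IHc c y : unif (bits_ev (N + (row m).+1) (fix_bit N S (row m) c)
    `&` trunc_sum row m @^-1` `]-oo, y]%classic) =
    ((1 / 2)%:E * unif (bits_ev N S) * (dyadic_cdf m y)%:E)%E.
  rewrite IH; last first.
    move=> j b jm; rewrite /fix_bit SI ?implybT//=; last exact: ltnW.
    by apply/implyP => /eqP /irow jE; rewrite jE ltnn in jm.
  by rewrite unif_fix_bit// => b; exact: SI.
transitivity (unif (bits_ev (N + (row m).+1) (fix_bit N S (row m) false)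
      `&` trunc_sum row m @^-1` `]-oo, x]%classic)
  + unif (bits_ev (N + (row m).+1) (fix_bit N S (row m) true)
      `&` trunc_sum row m @^-1` `]-oo, (x - 2^-1 ^+ m.+1)%R]%classic))%E.
  rewrite -measureU//; last first.
    apply/seteqP; split => // u; rewrite -!fix_bit_ev /=.
    by move=> [[[_ ->] _] [[_]]].
  congr (unif _); rewrite -!fix_bit_ev; apply/seteqP; split => u /=.
    rewrite !in_itv/= /trunc_sum big_ord_recr/= => -[hu].
    case h : (bit (row m) u) => /= hx; [right|left]; split => //; move: hx.
      by rewrite mul1r lerBrDr.
    by rewrite mul0r addr0.
  rewrite !in_itv/= /trunc_sum big_ord_recr/= => -[[[hu ->]]|[[hu ->]]] /=.
    by rewrite mul0r addr0.
  by rewrite mul1r lerBrDr.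
rewrite !IHc -(fineK (fin_num_measure unif _ (measurable_bits_ev N S))) -!EFinM -EFinD.
by rewrite /=; congr EFin; lra.
Qed.

Lemma trunc_sum_nd row u : nondecreasing_seq (fun m => trunc_sum row m u).
Proof.
apply/nondecreasing_seqP => m; rewrite /trunc_sum big_ord_recr/= lerDl.
by rewrite mulr_ge0// exprn_ge0.
Qed.

Lemma trunc_sum_cvg row u : cvgn (fun m => trunc_sum row m u).
Proof.
apply: nondecreasing_is_cvgn; first exact: trunc_sum_nd.
exists 1 => _ [m _ <-]; suff : trunc_sum row m u <= 1 - 2^-1 ^+ m.
  by move=> /le_trans; apply; rewrite gerBl exprn_ge0.
elim: m => [|m IH]; first by rewrite /trunc_sum big_ord0 expr0 subrr.
rewrite /trunc_sum big_ord_recr/= -/(trunc_sum row m u).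
have h0 : 0 <= (2^-1 : R) ^+ m by rewrite exprn_ge0.
rewrite exprS; case: (bit _ _) => /=; lra.
Qed.

Definition row_sum (row : nat -> nat) (u : R) : R := limn (fun m => trunc_sum row m u).

Lemma row_sum_le row u x : (row_sum row u <= x) <-> forall m, trunc_sum row m u <= x.
Proof.
split=> [h m|h].
  by apply: le_trans h; apply: nondecreasing_cvgn_le; [exact: trunc_sum_nd|exact: trunc_sum_cvg].
by apply: limr_le; [exact: trunc_sum_cvg|exact: nearW].
Qed.

Lemma measurable_row_sum row : measurable_fun setT (row_sum row).
Proof. by apply: measurable_limn_real => m; exact: measurable_trunc_sum. Qed.

(** After [m] digits the remainder is the [m]-th iterate of [doubling], still in [[0, 1[], scaled by
    [2^-m]. *)
Lemma row_sum_id (u : R) : 0 <= u < 1 -> row_sum id u = u.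
Proof.
move=> u01; have inv m : 0 <= iter m dbl u < 1 /\
    u = trunc_sum id m u + iter m dbl u * 2^-1 ^+ m.
  elim: m => [|m [/andP[IH0 IH1] IH2]]; first by rewrite /trunc_sum big_ord0 add0r mulr1.
  rewrite iterS; set z := iter m dbl u in IH0 IH1 IH2 *.
  have -> : trunc_sum id m.+1 u = trunc_sum id m u + (1 / 2 <= z)%R%:R * 2^-1 ^+ m.+1.
    by rewrite /trunc_sum big_ord_recr.
  split.
    rewrite /doubling; case: ifPn => hz; last rewrite -ltNge in hz;
      by apply/andP; split; lra.
  by rewrite [LHS]IH2 exprS /doubling; case: (1 / 2 <= z) => /=; field.
suff h : (fun m => trunc_sum id m u) @ \oo --> u by rewrite /row_sum (cvg_lim _ h).
apply/cvgrPdist_le => e e0.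
have : geometric (1 : R) 2^-1 @ \oo --> 0.
  by apply: cvg_geometric; rewrite ger0_norm// invf_lt1// ltr1n.
move=> /cvgr0Pnorm_le/(_ _ e0); apply: filterS => m /= hm.
have [/andP[h0 h1] h2] := inv m.
rewrite {1}h2 addrAC subrr add0r normrM (ger0_norm h0).
apply: le_trans hm; rewrite mul1r ler_piMl//; exact: ltW.
Qed.

(** Truncated sums increase to the row sum, so with closed rays the events decrease exactly to the
    event of the limit. *)
Let ray_cvg (B : set R) row x : measurable B ->
  (fun m => unif (B `&` trunc_sum row m @^-1` `]-oo, x]%classic)) @ \oo
    --> unif (B `&` row_sum row @^-1` `]-oo, x]%classic).
Proof.
move=> mB.
have mT m : measurable (B `&` trunc_sum row m @^-1` `]-oo, x]%classic).
  apply: measurableI => //.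
  by rewrite -[_ @^-1` _]setTI; apply: measurable_trunc_sum => //; exact: measurable_itv.
have -> : B `&` row_sum row @^-1` `]-oo, x]%classic =
    \bigcap_m (B `&` trunc_sum row m @^-1` `]-oo, x]%classic).
  apply/seteqP; split => u /=; rewrite ?in_itv/=.
    by move=> [Bu /row_sum_le h] m _ /=; rewrite in_itv/=.
  move=> h; split; first by have [] := h 0%N I.
  by apply/row_sum_le => m; have [_ /=] := h m I; rewrite in_itv.
apply: nonincreasing_cvg_mu => //.
- by rewrite (le_lt_trans (probability_le1 unif (mT 0%N)))// ltry.
- exact: bigcap_measurable.
- apply/nonincreasing_seqP => m; apply/subsetPset => u /= [Bu]; rewrite !in_itv/= => h.
  by split => //; apply: le_trans h; apply/nondecreasing_seqP: m; exact: trunc_sum_nd.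
Qed.

Let I01 : set R := `[0, 1[%classic.

(** The limit is common to all rows, so it can be read off the identity row, whose sum is almost
    surely the uniform variable itself. *)
Lemma dyadic_cdf_cvg x : (fun m => (dyadic_cdf m x)%:E) @ \oo --> unif `]-oo, x]%classic.
Proof.
have -> : unif `]-oo, x]%classic = unif (setT `&` row_sum id @^-1` `]-oo, x]%classic).
  have m01 : measurable I01 by exact: measurable_itv.
  have u01 : unif I01 = 1%E.
    rewrite (@unif_itv _ _ `[0, 1[)//= ?lte01 ?sube0//.
    apply/seteqP; split => u; rewrite /I01 /= !in_itv/=; first by case.
    by move=> /andP[h0 h1]; rewrite h0 h1 ltW.
  have restr := prob_restrict m01 u01.
  rewrite setTI [LHS]restr; last exact: measurable_itv.
  rewrite [RHS]restr; last first.
    by rewrite -[_ @^-1` _]setTI; apply: measurable_row_sum => //; exact: measurable_itv.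
  congr (unif _); apply/seteqP; rewrite /I01; split => u /= [h h01]; split => //;
    by move: h; rewrite !in_itv/= row_sum_id//; move: h01; rewrite in_itv.
have := @ray_cvg setT id x measurableT; apply: cvg_trans.
apply: near_eq_cvg; apply: nearW => m.
have T : bits_ev 0 (fun _ _ => true) = setT by apply/seteqP; split.
have := @trunc_sum_law id m 0 (fun _ _ => true) x (fun _ _ => id) (fun _ _ _ => isT).
by rewrite T probability_setT mul1e.
Qed.

Lemma row_sum_law row N (S : nat -> bool -> bool) D : injective row ->
  (forall j b, S (row j) b) -> measurable D ->
  unif (bits_ev N S `&` row_sum row @^-1` D) = (unif (bits_ev N S) * unif D)%E.
Proof.
move=> irow Sr mD; have mE := measurable_bits_ev N S.
apply: law_of_rays => //; first exact: measurable_row_sum.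
move=> x; have h1 := @ray_cvg _ row x mE.
have h2 : (fun m => unif (bits_ev N S) * (dyadic_cdf m x)%:E)%E @ \oo -->
    (unif (bits_ev N S) * unif `]-oo, x]%classic)%E.
  apply: cvgeZl; first exact: fin_num_measure.
  exact: dyadic_cdf_cvg.
rewrite -(cvg_lim _ h1)// -(cvg_lim _ h2)//; congr (limn _); apply/funext => m.
by apply: trunc_sum_law => // j b _.
Qed.

(** [pickle] is injective on pairs, so distinct rows use disjoint sets of digits. *)
Definition uniform_seq (n : nat) : R -> R := row_sum (fun j => pickle (n, j)).

Let row_inj (n : nat) : injective (fun j : nat => pickle (n, j)).
Proof. by move=> i j /(pcan_inj pickleK) []. Qed.

(** Cylinders that leave row [n] free form a pi-system generating a sigma-algebra that contains all
    earlier variables. Independence holds on them by [row_sum_law] and extends by uniqueness of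
    measures. *)
Lemma uniform_seq_indep n (B D : set R) :
  <<s [set E | exists2 i, (i < n)%N & gen_real (uniform_seq i) E] >> B ->
  measurable D ->
  unif (B `&` uniform_seq n @^-1` D) = (unif B * unif D)%E.
Proof.
move=> GB mD.
pose Pi : set (set R) := [set E | exists N (S : nat -> bool -> bool),
  (forall (j : nat) b, S (pickle (n, j)) b) /\ E = bits_ev N S].
have Pim : Pi `<=` measurable by move=> _ [N [S [_ ->]]]; exact: measurable_bits_ev.
have PiI : setI_closed Pi.
  move=> _ _ [N [S [hS ->]]] [N' [S' [hS' ->]]].
  exists (N + N')%N, (fun k b => ((k < N)%N ==> S k b) && ((k < N')%N ==> S' k b)); split.
    by move=> j b; rewrite hS hS' !implybT.
  apply/seteqP; split => u /=.
    move=> [h h'] k _; apply/andP; split; apply/implyP => kN; [exact: h|exact: h'].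
  move=> h; split => k kN.
    by have := h k (leq_trans kN (leq_addr _ _)); rewrite kN => /andP[].
  by have := h k (leq_trans kN (leq_addl _ _)); rewrite kN => /andP[_].
have sPi := sigma_algebra_gen Pi.
have GPi : [set E | exists2 i, (i < n)%N & gen_real (uniform_seq i) E] `<=` <<s Pi >>.
  move=> E [i ilt [D' mD' <-]].
  have : meas_wrt <<s Pi >> (uniform_seq i).
    apply: meas_wrt_limn => // m; apply: meas_wrt_sum => // j _.
    apply: meas_wrtM => //; last exact: meas_wrt_cst.
    set k := pickle (i, val j).
    rewrite (_ : (fun u => _) = \1_[set u | bit k u]); last first.
      apply/funext => u; rewrite indicE; case h : (bit _ _); first by rewrite mem_set.
      by rewrite memNset//= h.
    apply: meas_wrt_indic => //; apply: sub_sigma_algebra.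
    exists k.+1, (fun k' b => (k' == k) ==> b); split.
      move=> j' b; apply/implyP => /eqP /(pcan_inj pickleK) [] ni _.
      by rewrite ni ltnn in ilt.
    apply/seteqP; split => u /=.
      by move=> h k' _; apply/implyP => /eqP ->.
    by move=> /(_ k (leqnn _)); rewrite eqxx.
  by apply.
have {GPi GB} PB : <<s Pi >> B.
  by apply: (smallest_sub _ GPi) GB; exact: sigma_algebra_gen.
have mUD : measurable (uniform_seq n @^-1` D).
  by rewrite -[_ @^-1` _]setTI; exact: measurable_row_sum.
have r0 : 0 <= fine (unif D) by exact: fine_ge0.
pose m1 : {measure set R -> \bar R} := mrestr unif mUD.
pose m2 : {measure set R -> \bar R} := mscale (NngNum r0) unif.
have m2E A : m2 A = (unif A * unif D)%E.
  by rewrite /m2/= /mscale/= fineK ?fin_num_measure// muleC.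
have Pi_law N (S : nat -> bool -> bool) : (forall (j : nat) b, S (pickle (n, j)) b) ->
    m1 (bits_ev N S) = m2 (bits_ev N S).
  by move=> hS; rewrite m2E -(row_sum_law N (@row_inj n) hS mD).
have T : bits_ev 0 (fun _ _ => true) = setT by apply/seteqP; split.
have mT : m1 setT = m2 setT by rewrite -T Pi_law.
have fT : (m1 setT < +oo)%E.
  rewrite mT m2E probability_setT mul1e.
  by rewrite (le_lt_trans (probability_le1 unif mD))// ltry.
have H1 : [set X | Pi X /\ X `<=` setT] = Pi.
  by apply/seteqP; split => A; [case|split].
have := @g_sigma_algebra_measure_unique_trace _ R R Pi setT measurableT; rewrite H1.
move=> /(_ Pim PiI m1 m2 mT _ fT _ B PB); rewrite m2E; apply.
- by move=> _ [N [S [hS ->]]]; exact: Pi_law.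
- by [].
Qed.

Lemma measurable_uniform_seq n : measurable_fun setT (uniform_seq n).
Proof. exact: measurable_row_sum. Qed.

End IndependentUniforms.

(** * Quantile transform *)

Section Quantile.
Variables (R : realType) (mu : probability R R).
Local Notation unif := (unif R).

Let F (z : R) : R := fine (mu `]-oo, z]%classic).

Let muF z : mu `]-oo, z]%classic = (F z)%:E.
Proof. by rewrite /F fineK// fin_num_measure. Qed.

Let F_nd x y : x <= y -> F x <= F y.
Proof.
move=> xy; rewrite -lee_fin -!muF; apply: le_measure; rewrite ?inE//.
by move=> u /=; rewrite !in_itv/= => /le_trans; apply.
Qed.

Let F01 z : 0 <= F z <= 1.
Proof. by rewrite -!lee_fin -muF measure_ge0 probability_le1. Qed.

Let F_top u : u < 1 -> exists z, u <= F z.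
Proof.
move=> u1; have cv : mu (`]-oo, n%:R]%classic) @[n --> \oo] --> mu setT.
  rewrite (_ : setT = \bigcup_n `]-oo, n%:R]%classic); last first.
    apply/seteqP; split => // x _; exists (Num.bound x) => //=.
    rewrite in_itv/=; case: (leP 0 x) => x0; first exact/ltW/archi_boundP.
    exact: le_trans (ltW x0) _.
  apply: nondecreasing_cvg_mu => //; first exact: bigcup_measurable.
  apply/nondecreasing_seqP => n; apply/subsetPset => x /=; rewrite !in_itv/=.
  by move=> /le_trans; apply; rewrite ler_nat.
rewrite probability_setT in cv.
have {}cv : (fun n => F n%:R) @ \oo --> (1 : R).
  by have /fine_cvg := cv; apply.
have /cvgrPdist_lt/(_ (1 - u)) := cv; rewrite subr_gt0 => /(_ u1)[n _ /(_ n (leqnn n))]; move=> /= h.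
by exists n%:R; move: h; rewrite ltr_norml => /andP[_]; lra.
Qed.

Let F_bot u : 0 < u -> exists z, F z < u.
Proof.
move=> u0; have cv : mu (`]-oo, - n%:R]%classic) @[n --> \oo] --> mu set0.
  rewrite (_ : set0 = \bigcap_n `]-oo, - n%:R]%classic); last first.
    apply/seteqP; split => // x /= h; have := h (Num.bound (- x)).+1 I.
    rewrite /= in_itv/= => h'; have : - x <= (Num.bound (- x))%:R.
      case: (leP 0 (- x)) => x0; first exact/ltW/archi_boundP.
      exact: le_trans (ltW x0) _.
    by move: h'; rewrite -natr1; lra.
  apply: nonincreasing_cvg_mu => //.
  - by rewrite (le_lt_trans (probability_le1 mu _))// ltry.
  - exact: bigcap_measurable.
  - apply/nonincreasing_seqP => n; apply/subsetPset => x /=; rewrite !in_itv/=.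
    by move=> /le_trans; apply; rewrite lerN2 ler_nat.
rewrite measure0 in cv.
have {}cv : (fun n => F (- n%:R)) @ \oo --> (0 : R).
  by have /fine_cvg := cv; apply.
have /cvgrPdist_lt/(_ u u0)[n _ /(_ n (leqnn n))] := cv; move=> /= h.
by exists (- n%:R); move: h; rewrite sub0r normrN ltr_norml => /andP[_].
Qed.

Let F_right u z : (forall k, u <= F (z + k.+1%:R^-1)) -> u <= F z.
Proof.
move=> h; have cv : mu (`]-oo, (z + k.+1%:R^-1)%R]%classic) @[k --> \oo] --> mu `]-oo, z]%classic.
  rewrite (itvNycEbigcap false); apply: nonincreasing_cvg_mu => //.
  - by rewrite (le_lt_trans (probability_le1 mu _))// ltry.
  - by apply: bigcap_measurable => // k _; exact: measurable_itv.
  - apply/nonincreasing_seqP => n; apply/subsetPset => x /=; rewrite !in_itv/=.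
    by move=> /le_trans; apply; rewrite lerD2l lef_pV2 ?posrE// ler_nat.
rewrite -lee_fin -muF -(cvg_lim _ cv)//; apply: lime_ge; first by apply/cvg_ex; eexists; exact: cv.
by apply: nearW => k; rewrite muF lee_fin.
Qed.

(** The generalised inverse of the distribution function. The default 0 covers a null set, where the
    infimum could be over an empty or unbounded set. *)
Definition quantile (u : R) : R :=
  if (0 < u) && (u < 1) then inf [set z | u <= F z] else 0.

(** Right continuity of [F] makes the infimum a minimum. *)
Let quantile_le u z : 0 < u < 1 -> (quantile u <= z) = (u <= F z).
Proof.
move=> u01; rewrite /quantile u01; have /andP[u0 u1] := u01.
set S := [set z | u <= F z].
have S0 : S !=set0 by have [y] := F_top u1; exists y.
have Slb : has_lbound S.
  have [y Fy] := F_bot u0; exists y => x /= ux; rewrite leNgt; apply/negP => /ltW xy.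
  by have := F_nd xy; rewrite leNgt (lt_le_trans Fy ux).
apply/idP/idP => [h|uF]; last by apply: ge_inf.
apply: le_trans (F_nd h); apply: F_right => k.
have e0 : 0 < (k.+1%:R^-1 : R) by rewrite invr_gt0.
have [y Sy yk] := inf_adherent e0 (conj S0 Slb).
exact: le_trans Sy (F_nd (ltW yk)).
Qed.

Let I : set R := `]0, 1[%classic.

Let quantile_ray z : quantile @^-1` `]-oo, z]%classic =
  (I `&` `]-oo, F z]%classic) `|` (if 0 <= z then ~` I else set0).
Proof.
apply/seteqP; split => u /=; rewrite /I /= !in_itv/=.
  have [u01|u01] := boolP (0 < u < 1); first by rewrite quantile_le// => h; left.
  by rewrite /quantile (negbTE u01) => ->; right => /=; rewrite in_itv/=; exact/negP.
move=> [[u01]|]; first by rewrite quantile_le.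
case: ifPn => //= z0; rewrite in_itv/= => /negP u01.
by rewrite /quantile (negbTE u01).
Qed.

Lemma measurable_quantile : measurable_fun setT quantile.
Proof.
apply: (measurability _ (RGenOInfty.measurableE R)) => //.
move=> _ [_ [a ->] <-]; rewrite setTI.
rewrite (_ : _ @^-1` _ = ~` (quantile @^-1` `]-oo, a]%classic)); last first.
  by apply/seteqP; split => u /=; rewrite !in_itv/= andbT ltNge => /negP.
rewrite quantile_ray.
apply: measurableC; apply: measurableU.
  by apply: measurableI; exact: measurable_itv.
by case: ifP => // _; apply: measurableC; exact: measurable_itv.
Qed.

Lemma quantile_law D : measurable D -> unif (quantile @^-1` D) = mu D.
Proof.
move=> mD; have mI : measurable I by exact: measurable_itv.
have uI : unif I = 1%E.
  rewrite (@unif_itv _ _ `]0, 1[)//= ?lte01 ?sube0//.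
  apply/seteqP; split => u; rewrite /I /= !in_itv/=; first by case.
  by move=> /andP[h0 h1]; rewrite h0 h1 !ltW.
have restr := prob_restrict mI uI.
have uT z : (unif setT * z)%E = z.
  by rewrite [X in (X * _)%E](_ : _ = 1%E) ?mul1e//; exact: probability_setT.
suff rays x : unif (setT `&` quantile @^-1` `]-oo, x]%classic) =
    (unif setT * mu `]-oo, x]%classic)%E.
  have := law_of_rays measurable_quantile measurableT rays mD.
  by rewrite setTI uT.
rewrite setTI uT.
have mq : measurable (quantile @^-1` `]-oo, x]%classic).
  by rewrite -[_ @^-1` _]setTI; apply: measurable_quantile => //; exact: measurable_itv.
rewrite restr// quantile_ray.
rewrite (_ : _ `&` I = `]-oo, F x]%classic `&` I); last first.
  apply/seteqP; split => u /=; last by move=> [h hI]; split => //; left.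
  by case=> -[[]//|]; case: ifP.
rewrite -restr; last exact: measurable_itv.
rewrite unif_ray muF /clip; have /andP[F0 F1] := F01 x.
by rewrite max_l// min_l.
Qed.

End Quantile.

(** * Sampling from a finite law *)

Section Pick.
Variables (R : realType) (T : finType) (t0 : T) (p : T -> R).
Local Notation unif := (unif R).
Hypothesis p0 : forall t, 0 <= p t.
Hypothesis p1 : \sum_t p t = 1.

Let c (t : T) : R := \sum_(s | (enum_rank s < enum_rank t)%N) p s.

Let slot (t : T) : set R := `[c t, (c t + p t)[%classic.

Definition pick_at (u : R) : T :=
  if [pick t | (c t <= u) && (u < c t + p t)] is Some t then t else t0.

Let c_ge0 t : 0 <= c t. Proof. exact: sumr_ge0. Qed.

Let c_le s t : (enum_rank s < enum_rank t)%N -> c s + p s <= c t.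
Proof.
move=> st; rewrite /c addrC (bigD1 (P := fun r => (enum_rank r < enum_rank t)%N) s)//=.
rewrite lerD2l big_mkcond [leRHS]big_mkcond/=; apply: ler_sum => r _.
case: ifPn => rs; last by case: ifP.
by rewrite (ltn_trans rs st)/=; case: eqP => // rE; rewrite rE ltnn in rs.
Qed.

Let c_le1 t : c t + p t <= 1.
Proof.
rewrite -p1 /c addrC (bigD1 (P := xpredT) t)//= lerD2l big_mkcond [leRHS]big_mkcond/=.
apply: ler_sum => r _; case: ifPn => rt; last by case: ifP.
by case: eqP => // rE; rewrite rE ltnn in rt.
Qed.

Let slot_uniq s t u : slot s u -> slot t u -> s = t.
Proof.
rewrite /slot/= !in_itv/= => /andP[s1 s2] /andP[t1 t2].
apply: enum_rank_inj; apply: val_inj => /=; case: (ltngtP (enum_rank s) (enum_rank t)) => // h.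
- by have := c_le h; rewrite leNgt (le_lt_trans t1 s2).
- by have := c_le h; rewrite leNgt (le_lt_trans s1 t2).
Qed.

Let pick_slot t u : slot t u -> pick_at u = t.
Proof.
move=> tu; rewrite /pick_at; case: pickP => [s h|/(_ t)].
  by apply: slot_uniq tu; rewrite /slot/= in_itv.
by move: tu; rewrite /slot/= in_itv/= => ->.
Qed.

Lemma pick_at_supp u : pick_at u = t0 \/ p (pick_at u) != 0.
Proof.
rewrite /pick_at; case: pickP => [s /andP[h1 h2]|_]; last by left.
by right; apply: contraTneq h2 => ->; rewrite addr0 -leNgt.
Qed.

Let pick_preimage t : pick_at @^-1` [set t] =
  slot t `|` (if t == t0 then \bigcap_(s in [set: T]) ~` slot s else set0).
Proof.
apply/seteqP; split => u /=.
  move=> h; have [tu|tu] := pselect (slot t u); first by left.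
  right; case: (pselect (exists s, slot s u)) => [[s su]|ns].
    by case: tu; rewrite -h (pick_slot su).
  have -> : t == t0.
    rewrite -h /pick_at; case: pickP => [s hs|//].
    by case: ns; exists s; rewrite /slot/= in_itv.
  by move=> s _ /= su; apply: ns; exists s.
move=> [/pick_slot//|]; case: eqP => // -> h.
rewrite /pick_at; case: pickP => // s hs.
by have := h s Logic.I; rewrite /slot/= in_itv/= hs.
Qed.

Let mslot t : measurable (slot t). Proof. exact: measurable_itv. Qed.

Lemma measurable_pick_at t : measurable (pick_at @^-1` [set t]).
Proof.
rewrite pick_preimage; apply: measurableU => //; case: ifP => // _.
apply: fin_bigcap_measurable => // s _; exact: measurableC.
Qed.

Let unif_slot t : unif (slot t) = (p t)%:E.
Proof.
rewrite (@unif_itv _ _ `[c t, (c t + p t)[)//=.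
  rewrite lte_fin ltrDl; case: ifPn => [_|]; first by rewrite -EFinB addrC addKr.
  by rewrite -leNgt => h; congr EFin; apply/eqP; rewrite eq_le h p0.
apply/seteqP; split => u; rewrite /slot /= !in_itv/=; first by case.
move=> /andP[h1 h2]; rewrite h1 h2 (le_trans (c_ge0 t) h1); split => //.
exact: le_trans (ltW h2) (c_le1 t).
Qed.

(** A slot bounds the probability from below, since the default [t0] can only add mass; both
    families sum to 1, so every bound is an equality. *)
Lemma pick_at_law t : unif (pick_at @^-1` [set t]) = (p t)%:E.
Proof.
have ge s : p s <= fine (unif (pick_at @^-1` [set s])).
  rewrite -lee_fin fineK ?fin_num_measure//; last exact: measurable_pick_at.
  rewrite -unif_slot; apply: le_measure; rewrite ?inE//; first exact: measurable_pick_at.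
  by move=> u /pick_slot.
have tot : \sum_s fine (unif (pick_at @^-1` [set s])) = 1.
  under eq_bigr do rewrite -(Rint_indic1 unif (measurable_pick_at _)).
  rewrite -Rint_sum; last first.
    move=> s _; apply: L1_bnd; last exact: bnd_indic.
    by apply: measurable_indic; exact: measurable_pick_at.
  rewrite -[RHS](Rint_cst unif); apply: eq_Rintegral => u _.
  rewrite -[RHS](sum_fin_comp pick_at (fun _ _ => 1) u).
  by apply: eq_bigr => s _; rewrite mulr1.
have eqs : forall s, p s = fine (unif (pick_at @^-1` [set s])).
  move=> s; apply/eqP; rewrite eq_sym -subr_eq0.
  have : \sum_r (fine (unif (pick_at @^-1` [set r])) - p r) == 0.
    by rewrite sumrB tot p1 subrr.
  rewrite psumr_eq0; last by move=> r _; rewrite subr_ge0.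
  by move=> /allP/(_ s); rewrite mem_index_enum => /(_ isT)/implyP; apply.
by rewrite eqs fineK// fin_num_measure//; exact: measurable_pick_at.
Qed.

End Pick.

(** * Simulated trajectories of a stationary policy *)

Section Simulation.
Variable R : realType.
Local Notation unif := (unif R).
Local Notation U := (@uniform_seq R).

Definition past (n : nat) : set (set R) :=
  <<s [set E | exists2 i, (i < n)%N & gen_real (U i) E] >>.

Let sP n : sigma_algebra setT (past n). Proof. exact: sigma_algebra_gen. Qed.

Let past_m n : past n `<=` measurable.
Proof.
apply: gen_sigma_measurable => E [i _ [D mD <-]].
by rewrite -[_ @^-1` _]setTI; exact: measurable_uniform_seq.
Qed.

Let past_le m n : (m <= n)%N -> past m `<=` past n.
Proof.
move=> mn; apply: sub_sigma_algebra2 => E [i im hE]; exists i => //.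
exact: leq_trans mn.
Qed.

Let past_U n : meas_wrt (past n.+1) (U n).
Proof. by move=> D mD; apply: sub_sigma_algebra; exists n => //; exists D. Qed.

Lemma past_step n (T : finType) (V : R -> T) (W : T -> set R) :
  (forall v, past n (V @^-1` [set v])) -> (forall v, measurable (W v)) ->
  past n.+1 [set w | W (V w) (U n w)].
Proof.
move=> FV mW.
rewrite (_ : [set _ | _] = \big[setU/set0]_v (V @^-1` [set v] `&` U n @^-1` W v)).
  elim/big_ind: _.
  - by have [] := @sP n.+1.
  - by move=> A B; exact: (sigma_setU (@sP _)).
  - by move=> v _; apply: (sigma_setI (@sP _)) => //; [apply: past_le (FV v)|exact: past_U].
apply/seteqP; split => w /=; rewrite -bigcup_seq_cond.
  by move=> h; exists (V w) => //=; rewrite mem_index_enum.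
by move=> [v _ [/= -> h]].
Qed.

(** The uniform [U n] is independent of the past, so on each value [v] of [V] the random event
    [W (V w)] becomes the fixed event [W v]. *)
Lemma step_law n (T : finType) (V : R -> T) (W : T -> set R) B :
  (forall v, past n (V @^-1` [set v])) -> (forall v, measurable (W v)) -> past n B ->
  unif (B `&` [set w | W (V w) (U n w)]) =
  (\int[unif]_(w in B) (fine (unif (W (V w))))%:E)%E.
Proof.
move=> FV mW FB; have mB := past_m FB.
have mS : measurable [set w | W (V w) (U n w)] by apply: past_m; exact: past_step FV mW.
have mV v : measurable (V @^-1` [set v]) by exact: past_m (FV v).
have mUW v : measurable (U n @^-1` W v).
  by rewrite -[_ @^-1` _]setTI; exact: measurable_uniform_seq.
have mBV v : measurable (B `&` V @^-1` [set v]) by exact: measurableI.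
pose K v := fine (unif (W v)).
have Li (A : set R) : measurable A -> L1 unif (\1_A).
  by move=> mA; apply: L1_bnd; [exact: measurable_indic|exact: bnd_indic].
have LK : L1 unif (fun w => K (V w)).
  apply: L1_bnd; last by apply: (@bnd_fin_comp _ _ _ _ V (fun v _ => K v)) => v; exact: bnd_cst.
  apply/meas_wrt_measurable; apply: (@meas_wrt_fin_comp _ _ _ _ _ V (fun v _ => K v)) => //.
    exact: sigma_algebra_measurable.
  by move=> v; apply/meas_wrt_measurable.
rewrite EFin_Rint// -[LHS]fineK ?fin_num_measure//; last exact: measurableI.
congr EFin; rewrite -Rint_indic1; last exact: measurableI.
rewrite -[RHS]Rint_indic//.
transitivity (\int[unif]_w \sum_v \1_(V @^-1` [set v]) w * (\1_B w * \1_(U n @^-1` W v) w)).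
  apply: eq_Rintegral => w _.
  by rewrite (sum_fin_comp V (fun v w => \1_B w * \1_(U n @^-1` W v) w)) indicI !indicE.
transitivity (\int[unif]_w \sum_v \1_(V @^-1` [set v]) w * (\1_B w * K v)); last first.
  apply: eq_Rintegral => w _.
  by rewrite (sum_fin_comp V (fun v w => \1_B w * K v)).
have h1 v w : \1_(V @^-1` [set v]) w * (\1_B w * \1_(U n @^-1` W v) w) =
    \1_((B `&` V @^-1` [set v]) `&` U n @^-1` W v) w :> R.
  by rewrite !indicI/= mulrCA mulrA.
have h2 v w : \1_(V @^-1` [set v]) w * (\1_B w * K v) =
    \1_(B `&` V @^-1` [set v]) w * K v by rewrite !indicI/= mulrCA mulrA.
rewrite !Rint_sum; last 2 first.
- move=> v _; under eq_fun do rewrite h2.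
  by apply: L1M; [exact: measurable_indic|exact: bnd_indic|apply: L1_bnd => //; exact: bnd_cst].
- by move=> v _; under eq_fun do rewrite h1; apply: Li; exact: measurableI.
apply: eq_bigr => v _.
under eq_Rintegral do rewrite h1; under [RHS]eq_Rintegral do rewrite h2.
rewrite RintegralZr//; last exact: Li.
rewrite !Rint_indic1//; last exact: measurableI.
rewrite uniform_seq_indep//; last exact: (sigma_setI (@sP _)).
by rewrite fineM ?fin_num_measure.
Qed.

Section SMPolicy.
Variables (M : mdp R) (pi : st M -> ac M -> R) (x0 : st M).
Local Notation X := (st M).
Local Notation A := (ac M).
Hypothesis pol : policy pi.

Let act (x : X) (u : R) : A := pick_at (some_act x) (pi x) u.
(** For an inadmissible action [trans x a] need not be a probability vector; staying at [x] keeps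
    the map measurable. *)
Let next (x : X) (a : A) (u : R) : X :=
  if a \in acts x then pick_at x (trans x a) u else x.

(** Stage [t] consumes the uniforms of index [3t], [3t + 1] and [3t + 2] for the action, the next
    state and the reward, so each draw is fresh. *)
Fixpoint simX (t : nat) (w : R) : X :=
  if t is t'.+1 then
    next (simX t' w) (act (simX t' w) (U (3 * t') w)) (U (3 * t').+1 w)
  else x0.

Definition simA (t : nat) (w : R) : A := act (simX t w) (U (3 * t) w).

Definition simR (t : nat) (w : R) : R :=
  quantile (rew (simX t w) (simA t w) (simX t.+1 w)) (U (3 * t).+2 w).

Let pi_sum1 x : \sum_a pi x a = 1.
Proof.
have [_ [h1 h2]] := pol x; rewrite -h2 [RHS]big_mkcond/=; apply: eq_bigr => a _.
by case: ifPn => // /h1.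
Qed.

Let act_law x a : unif (act x @^-1` [set a]) = (pi x a)%:E.
Proof. by apply: pick_at_law => //; have [] := pol x. Qed.

Let act_in x u : act x u \in acts x.
Proof.
rewrite /act; have [->|] := pick_at_supp (some_act x) (pi x) u; first exact: some_act_in.
by apply: contraNT => h; have [_ [-> //]] := pol x.
Qed.

Let simA_in t w : simA t w \in acts (simX t w). Proof. exact: act_in. Qed.

Let next_law x a y : a \in acts x -> unif (next x a @^-1` [set y]) = (trans x a y)%:E.
Proof.
move=> aA; rewrite /next aA; apply: pick_at_law; last exact: trans_sum1.
by move=> z; exact: trans_ge0.
Qed.

Let mact x a : measurable (act x @^-1` [set a]).
Proof. by apply: measurable_pick_at => //; have [] := pol x. Qed.
Let mnext x a y : measurable (next x a @^-1` [set y]).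
Proof.
rewrite /next; case aA: (a \in acts x).
  by apply: measurable_pick_at => z; exact: trans_ge0.
have [->|h] := eqVneq x y.
  by rewrite (_ : _ @^-1` _ = setT)//; apply/seteqP; split.
rewrite (_ : _ @^-1` _ = set0)//; apply/seteqP; split => // w /= /eqP.
by rewrite (negbTE h).
Qed.

Let pairE (S T : finType) (Y : R -> S) (Z : R -> T) n :
  (forall y, past n (Y @^-1` [set y])) -> (forall z, past n (Z @^-1` [set z])) ->
  forall p, past n ((fun w => (Y w, Z w)) @^-1` [set p]).
Proof.
move=> hY hZ [y z]; rewrite (_ : _ @^-1` _ = Y @^-1` [set y] `&` Z @^-1` [set z]).
  exact: (sigma_setI (@sP _)).
by apply/seteqP; split => w /= [-> ->].
Qed.

Lemma simX_past t x : past (3 * t) (simX t @^-1` [set x]).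
Proof.
elim: t x => [|t IH] x.
  have [->|h] := eqVneq x x0.
    by rewrite (_ : _ @^-1` _ = setT); [exact: sigma_setT|apply/seteqP; split].
  rewrite (_ : _ @^-1` _ = set0); first by have [] := @sP (3 * 0).
  by apply/seteqP; split => // w /= /esym/eqP; rewrite (negbTE h).
have hA a : past (3 * t).+1 (simA t @^-1` [set a]).
  exact: (@past_step _ _ (simX t) (fun x => act x @^-1` [set a])).
have hX x' : past (3 * t).+1 (simX t @^-1` [set x']) by apply: past_le (IH x').
have := @past_step (3 * t).+1 _ (fun w => (simX t w, simA t w))
  (fun z => next z.1 z.2 @^-1` [set x]) (pairE hX hA) (fun z => mnext z.1 z.2 x).
by apply: past_le; rewrite mulnS addnC !addnS addn0.
Qed.

Lemma simA_past t a : past (3 * t).+1 (simA t @^-1` [set a]).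
Proof.
exact: (@past_step _ _ (simX t) (fun x => act x @^-1` [set a]) (@simX_past t)).
Qed.

Let SA_past t z : past (3 * t).+1 ((fun w => (simX t w, simA t w)) @^-1` [set z]).
Proof.
apply: pairE => [x|a]; last exact: simA_past.
by apply: past_le (@simX_past t x).
Qed.

Lemma simX_past2 t x : past (3 * t).+2 (simX t.+1 @^-1` [set x]).
Proof.
exact: (@past_step (3 * t).+1 _ (fun w => (simX t w, simA t w))
  (fun z => next z.1 z.2 @^-1` [set x]) (@SA_past t) (fun z => mnext z.1 z.2 x)).
Qed.

Let SAX_past t z :
  past (3 * t).+2 ((fun w => (simX t w, simA t w, simX t.+1 w)) @^-1` [set z]).
Proof.
apply: pairE => [p|x]; last exact: simX_past2.
by apply: past_le (@SA_past t p).
Qed.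

Lemma simR_past t : meas_wrt (past (3 * t).+3) (simR t).
Proof.
move=> D mD; apply: (@past_step (3 * t).+2 _ (fun w => (simX t w, simA t w, simX t.+1 w))
  (fun z => quantile (rew z.1.1 z.1.2 z.2) @^-1` D) (@SAX_past t)) => z.
by rewrite -[_ @^-1` _]setTI; exact: measurable_quantile.
Qed.

Let fin_gen n (T : finType) (Y : R -> T) : (forall y, past n (Y @^-1` [set y])) ->
  gen_fin Y `<=` past n.
Proof.
move=> hY E [B _ <-].
rewrite (_ : Y @^-1` B = \big[setU/set0]_(y | y \in B) (Y @^-1` [set y])).
  elim/big_ind: _ => //; first by have [] := @sP n.
  by move=> ? ?; exact: (sigma_setU (@sP _)).
apply/seteqP; split => w /=; rewrite -bigcup_seq_cond.
  by move=> Bw; exists (Y w) => //=; rewrite mem_index_enum mem_set.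
by move=> [y /= /andP[_]]; rewrite inE => By ->.
Qed.

(** A state of positive time [t] is known after [3 * (t - 1) + 2] uniforms, and the initial state
    after none. The cruder count [3 * t] would be too late for the reward, which is drawn right
    after the next state. *)
Lemma sim_gen nx na nr n :
  (forall t, (t < nx)%N -> (3 * t.-1 + (t != 0%N).*2 <= n)%N) ->
  (forall t, (t < na)%N -> ((3 * t).+1 <= n)%N) ->
  (forall t, (t < nr)%N -> ((3 * t).+3 <= n)%N) ->
  <<s traj_gen simX simA simR nx na nr >> `<=` past n.
Proof.
move=> hx ha hr; apply: smallest_sub => // E [[t tn hE]|[[t tn hE]|[t tn [D mD <-]]]].
- apply: fin_gen hE => y; apply: past_le (hx t tn) _ _.
  case: t tn => [|t] _ /=; first exact: (@simX_past 0).
  by rewrite addn2; exact: simX_past2.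
- by apply: fin_gen hE => y; apply: past_le (ha t tn) _ _; exact: simA_past.
- by apply: past_le (hr t tn) _ _; exact: simR_past.
Qed.

Lemma sim_realizes : realizes (sm pi) x0 unif simX simA simR.
Proof.
have mX t x : measurable (simX t @^-1` [set x]) by apply: past_m; exact: simX_past.
have mA t a : measurable (simA t @^-1` [set a]) by apply: past_m; exact: simA_past.
split=> //; split=> //; split.
  move=> t; apply/meas_wrt_measurable; apply: meas_wrtS (@simR_past t); exact: past_m.
split.
  move=> t a; rewrite /sm; apply/meas_wrt_measurable.
  apply: (@meas_wrt_fin_comp _ _ _ _ _ (simX t) (fun x _ => pi x a)) => //.
    exact: sigma_algebra_measurable.
  by move=> x; apply/meas_wrt_measurable.
split.
  rewrite (_ : _ @^-1` _ = setT); first exact: probability_setT.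
  by apply/seteqP; split.
split=> [t B a GB|].
  have FB : past (3 * t) B.
    apply: sim_gen GB => [[|i] it|i it|i it] /=; lia.
  have := @step_law _ _ (simX t) (fun x => act x @^-1` [set a]) B (@simX_past t)
    (fun x => mact x a) FB.
  rewrite (_ : [set _ | _] = simA t @^-1` [set a])// => ->.
  by apply: eq_integral => w _; rewrite act_law.
split=> [t B y GB|t B D GB mD].
  have FB : past (3 * t).+1 B.
    apply: sim_gen GB => [[|i] it|i it|i it] /=; lia.
  have := @step_law _ _ (fun w => (simX t w, simA t w)) (fun z => next z.1 z.2 @^-1` [set y]) B
    (@SA_past t) (fun z => mnext z.1 z.2 y) FB.
  rewrite (_ : [set _ | _] = simX t.+1 @^-1` [set y])// => ->.
  by apply: eq_integral => w _ /=; rewrite next_law.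
have FB : past (3 * t).+2 B.
  apply: sim_gen GB => [[|i] it|i it|i it] /=; lia.
have := @step_law _ _ (fun w => (simX t w, simA t w, simX t.+1 w))
  (fun z => quantile (rew z.1.1 z.1.2 z.2) @^-1` D) B (@SAX_past t) _ FB.
rewrite (_ : [set _ | _] = simR t @^-1` D)// => ->.
  by apply: eq_integral => w _ /=; rewrite quantile_law// fineK// fin_num_measure.
by move=> z; rewrite -[_ @^-1` _]setTI; exact: measurable_quantile.
Qed.

End SMPolicy.
End Simulation.

(** * Values of policies *)

Section PolicyValues.
Variables (R : realType) (M : mdp R) (gamma : R).
Local Notation X := (st M).
Local Notation A := (ac M).
Hypothesis gamma01 : 0 <= gamma < 1.

Lemma cond_law_fin_supp {d : measure_display} {Omega : measurableType d}
    (P : probability Omega R) (G : set (set Omega)) (T : finType) (Y : Omega -> T)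
    (p : Omega -> T -> R) (bad : Omega -> T -> bool) :
  <<s G >> `<=` measurable -> (forall y, measurable (Y @^-1` [set y])) ->
  (forall y, <<s G >> [set w | bad w y]) ->
  cond_law_fin P G Y p -> (forall w y, bad w y -> p w y = 0) ->
  {ae P, forall w, ~~ bad w (Y w)}.
Proof.
move=> Gm mY Gbad law p0.
have bad0 y : P.-negligible ([set w | bad w y] `&` Y @^-1` [set y]).
  apply/negligibleP; first by apply: measurableI => //; exact: Gm.
  apply: etrans (law _ y (Gbad y)) _; apply: integral0_eq => w /= bw.
  by rewrite p0.
have : P.-negligible (\big[setU/set0]_y ([set w | bad w y] `&` Y @^-1` [set y])).
  elim/big_ind: _ => //; first exact: negligible_set0.
  by move=> U V; exact: negligibleU.
apply: negligibleS => w /= /negP; rewrite negbK => bw; rewrite -bigcup_seq_cond.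
by exists (Y w) => //=; rewrite mem_index_enum.
Qed.

Section Realization.
Variables (Pi : hpolicy M) (x0 : X).
Hypothesis valid : valid_hpolicy Pi.
Context {d : measure_display} {Omega : measurableType d}.
Variables (P : probability Omega R) (Xs : nat -> Omega -> X)
          (As : nat -> Omega -> A) (Rs : nat -> Omega -> R).
Hypothesis real : realizes Pi x0 P Xs As Rs.

Let p (t : nat) (w : Omega) (a : A) : R := Pi (hist Xs As Rs t w) (Xs t w) a.

Let mX t y : measurable (Xs t @^-1` [set y]). Proof. by have [] := real. Qed.
Let mA t a : measurable (As t @^-1` [set a]). Proof. by have [_ []] := real. Qed.
Let mR t : measurable_fun setT (Rs t). Proof. by have [_ [_ []]] := real. Qed.
Let mp t a : measurable_fun setT (fun w => p t w a).
Proof. by have [_ [_ [_ [h _]]]] := real; exact: h. Qed.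
Let X0 : P (Xs 0 @^-1` [set x0]) = 1%E. Proof. by have [_ [_ [_ [_ [h _]]]]] := real. Qed.
Let law0 : forall t, cond_law_fin P (traj_gen Xs As Rs t.+1 t t) (As t) (p t).
Proof. by have [_ [_ [_ [_ [_ [h _]]]]]] := real. Qed.
Let lawX : forall t, cond_law_fin P (set0 `|` traj_gen Xs As Rs t.+1 t.+1 t) (Xs t.+1)
  (fun w y => trans (Xs t w) (As t w) y).
Proof. by have [_ [_ [_ [_ [_ [_ [h _]]]]]]] := real; move=> t; rewrite set0U. Qed.
Let lawR : forall t, cond_law_real P (set0 `|` traj_gen Xs As Rs t.+2 t.+1 t) (Rs t)
  (fun w => rew (Xs t w) (As t w) (Xs t.+1 w)).
Proof. by have [_ [_ [_ [_ [_ [_ [_ h]]]]]]] := real; move=> t; rewrite set0U. Qed.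
Let lawA : forall t, cond_law_fin P (set0 `|` traj_gen Xs As Rs t.+2 t.+1 t.+1) (As t.+1) (p t.+1).
Proof. by move=> t; rewrite set0U; exact: law0. Qed.

Let p_acts t w a : a \notin acts (Xs t w) -> p t w a = 0.
Proof. by have [_ [h _]] := valid (hist Xs As Rs t w) (Xs t w) => /h. Qed.

Let p_sum t w (f : A -> R) :
  \sum_a p t w a * f a = \sum_(a in acts (Xs t w)) p t w a * f a.
Proof.
rewrite [RHS]big_mkcond/=; apply: eq_bigr => a _; case: ifPn => // /p_acts ->.
by rewrite mul0r.
Qed.

Let p_sum1 t w : \sum_(a in acts (Xs t w)) p t w a = 1.
Proof. by have [_ [_ h]] := valid (hist Xs As Rs t w) (Xs t w). Qed.

Let p_ge0 t w a : 0 <= p t w a.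
Proof. by have [h _] := valid (hist Xs As Rs t w) (Xs t w); exact: h. Qed.

Let bp t a : bnd (fun w => p t w a).
Proof.
exists 1 => w; rewrite ger0_norm//.
have [aA|/p_acts ->//] := boolP (a \in acts (Xs t w)).
by rewrite -(p_sum1 t w) (bigD1 a)//= lerDl sumr_ge0.
Qed.

Let gm nx na nr : <<s traj_gen Xs As Rs nx na nr >> `<=` measurable.
Proof. by apply: gen_sigma_measurable; exact: traj_gen_measurable. Qed.

Let A0_acts : {ae P, forall w, As 0 w \in acts (Xs 0 w)}.
Proof.
have := @cond_law_fin_supp _ _ P _ _ (As 0) (p 0) (fun w a => a \notin acts (Xs 0 w))
  (@gm _ _ _) (mA 0) _ (@law0 0) (fun w a => @p_acts 0 w a).
move=> h; apply: filterS (h _) => [w|a]; first by rewrite negbK.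
rewrite (_ : [set _ | _] = Xs 0 @^-1` [set x | a \notin acts x])//.
by apply: sub_sigma_algebra; left; exists 0%N => //; exists [set x | a \notin acts x].
Qed.

Lemma realization_return :
  (\int[P]_w (ret gamma Rs w)%:E = (\int[P]_w ret gamma Rs w)%R%:E)%E.
Proof.
apply: EFin_Rint => //.
have [] := @return_L1 _ _ _ M gamma P gamma01 Xs As Rs set0 p (@sub0set _ _) mX mA mR
  p_acts A0_acts lawA lawR 0.
by rewrite (_ : (fun t => Rs (0 + t)) = Rs).
Qed.

(** The controlled process has a free initial pair, because episodes start from [nu]; for a policy
    the first action is therefore averaged separately. *)
Let first_action (v : X -> R) :
  \int[P]_w qval gamma v (Xs 0 w) (As 0 w) =
  \int[P]_w \sum_a p 0 w a * qval gamma v (Xs 0 w) a.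
Proof.
apply: (cond_fin_comp (Z := fun a w => qval gamma v (Xs 0 w) a) (@gm _ _ _) (mA 0) (mp 0) (bp 0) (@law0 0)).
- move=> a; apply: (@meas_wrt_fin_comp _ _ _ _ _ (Xs 0) (fun x _ => qval gamma v x a)).
  + exact: sigma_algebra_gen.
  + by move=> x; apply: sub_sigma_algebra; left; exists 0%N => //; exists [set x].
  + by move=> x; apply: meas_wrt_cst; exact: sigma_algebra_gen.
- move=> a; apply: (@bnd_fin_comp _ _ _ _ (Xs 0) (fun x _ => qval gamma v x a)) => x.
  exact: bnd_cst.
Qed.

Let mfin (f : X -> R) : measurable_fun setT (fun w => f (Xs 0 w)).
Proof.
apply/meas_wrt_measurable; apply: (@meas_wrt_fin_comp _ _ _ _ _ (Xs 0) (fun x _ => f x)) => //.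
  exact: sigma_algebra_measurable.
by move=> x; apply/meas_wrt_measurable.
Qed.

Let start_value (v : X -> R) : \int[P]_w v (Xs 0 w) = v x0.
Proof.
rewrite (Rint_ae (g := fun=> v x0)) ?Rint_cst//.
have : P.-negligible (~` (Xs 0 @^-1` [set x0])).
  apply/negligibleP; first exact: measurableC.
  by apply: etrans (probability_setC P (mX 0 x0)) _; rewrite X0 subee.
by apply: negligibleS => w /= h hx; apply: h; rewrite hx.
Qed.

Let sum_q_L1 (v : X -> R) : L1 P (fun w => \sum_a p 0 w a * qval gamma v (Xs 0 w) a).
Proof.
apply: L1_sum => a _; apply: L1M => //; apply: L1_bnd; first exact: (@mfin (fun x => qval gamma v x a)).
by apply: (@bnd_fin_comp _ _ _ _ (Xs 0) (fun x _ => qval gamma v x a)) => x; exact: bnd_cst.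
Qed.

Lemma realization_value_eq (v : X -> R) :
  (forall t w, \sum_a p t w a * qval gamma v (Xs t w) a = v (Xs t w)) ->
  \int[P]_w ret gamma Rs w = v x0.
Proof.
move=> hv.
have := @return_value _ _ _ M gamma P gamma01 Xs As Rs set0 p (@sub0set _ _) mX mA mR
  mp bp p_acts A0_acts lawA lawX lawR 0 (fun _ => v) setT
  (sigma_setT (sigma_algebra_gen _)) (fun y => meas_wrt_cst (sigma_algebra_gen _) _)
  (fun y => bnd_cst _) (fun t w => hv t.+1 w).
rewrite (_ : (fun t => Rs (0 + t)) = Rs)// => ->.
by rewrite first_action; under eq_Rintegral do rewrite hv; exact: start_value.
Qed.

Lemma realization_value_le (v : X -> R) :
  (forall t w, \sum_a p t w a * qval gamma v (Xs t w) a <= v (Xs t w)) ->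
  \int[P]_w ret gamma Rs w <= v x0.
Proof.
move=> hv.
have := @return_value_le _ _ _ M gamma P gamma01 Xs As Rs set0 p (@sub0set _ _) mX mA mR
  mp bp p_acts A0_acts lawA lawX lawR 0 (fun _ => v) setT
  (sigma_setT (sigma_algebra_gen _)) (fun y => meas_wrt_cst (sigma_algebra_gen _) _)
  (fun y => bnd_cst _) (fun t w => hv t.+1 w).
rewrite (_ : (fun t => Rs (0 + t)) = Rs)// => /le_trans; apply.
rewrite first_action -(start_value v); apply: le_Rintegral => //; first exact: sum_q_L1.
apply: L1_bnd; first exact: (@mfin v).
by apply: (@bnd_fin_comp _ _ _ _ (Xs 0) (fun x _ => v x)) => x; exact: bnd_cst.
Qed.

Lemma realization_le_vopt : \int[P]_w ret gamma Rs w <= vopt gamma x0.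
Proof.
apply: realization_value_le => t w; rewrite p_sum -[leRHS]mul1r -(p_sum1 t w) mulr_suml.
by apply: ler_sum => a aA; rewrite ler_wpM2l// qval_le_vopt.
Qed.

End Realization.

Lemma sm_valid (pi : X -> A -> R) : policy pi -> valid_hpolicy (sm pi).
Proof. by move=> pol h x; exact: pol. Qed.

(** Every realization gives the same value, and the simulated one excludes the empty supremum
    [-oo]. *)
Lemma Vpol_sm (pi : X -> A -> R) x : policy pi ->
  Vpol gamma (sm pi) x = (vpi gamma pi x)%:E.
Proof.
move=> pol; have val (d : measure_display) (Omega : measurableType d) (P : probability Omega R) Xs As Rs :
    realizes (sm pi) x P Xs As Rs -> (\int[P]_w (ret gamma Rs w)%:E = (vpi gamma pi x)%:E)%E.
  move=> real; rewrite (realization_return (sm_valid pol) real); congr EFin.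
  apply: (realization_value_eq (sm_valid pol) real) => t w; rewrite [RHS]vpiE// /sm.
  rewrite [RHS]big_mkcond/=; apply: eq_bigr => a _; case: ifPn => // aA.
  by have [_ [-> //]] := pol (Xs t w); rewrite mul0r.
rewrite /Vpol (_ : [set _ | _] = [set (vpi gamma pi x)%:E]) ?ereal_sup1//.
apply/seteqP; split => z.
  by move=> [d [W [P [Xs [As [Rs [real ->]]]]]]]; exact: val real.
move=> ->; exists _, _, (unif R), (simX pi x), (simA pi x), (simR pi x).
have real := sim_realizes x pol; split; first exact: real.
by rewrite /= (val _ _ _ _ _ _ real).
Qed.

Lemma Vstar_vopt (x : X) : Vstar gamma x = (vopt gamma x)%:E :> \bar R.
Proof.
apply/eqP; rewrite eq_le; apply/andP; split.
  apply: ge_ereal_sup => _ [Pi valid <-].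
  apply: ge_ereal_sup => _ [d [W [P [Xs [As [Rs [real ->]]]]]]].
  by rewrite (realization_return valid real) lee_fin (realization_le_vopt valid real).
(* For the supremum to be attained, the deterministic choice of optimal actions is used: its
   one-step loss is 0, so its value is [vopt]. *)
pose pi (y : X) (a : A) : R := (a == best_act gamma (@vopt _ M gamma) y)%:R.
have bP y := (best_actP gamma (@vopt _ M gamma) y).1.
have pol : policy pi.
  move=> y; split; first by move=> a; rewrite /pi ler0n.
  split => [a|]; first by rewrite /pi; case: (a =P _) => // ->; rewrite bP.
  rewrite (bigD1 (best_act gamma (@vopt _ M gamma) y))//= /pi eqxx big1 ?addr0// => a /andP[_].
  by move=> /negbTE ->.
have <- : vpi gamma pi x = vopt gamma x.
  apply/eqP; rewrite eq_le vpi_le_vopt//= -subr_le0 -(mul0r (1 - gamma)^-1).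
  apply: vopt_vpi_le => // y; rewrite subr_le0 [leLHS]voptE// /bellman_opt /bellman.
  rewrite (bigD1 (best_act gamma (@vopt _ M gamma) y))//= /pi eqxx mul1r lerDl big1//.
  by move=> a /andP[_ /negbTE ->]; rewrite mul0r.
rewrite -Vpol_sm//; apply: ereal_sup_ubound; exists (sm pi) => //; exact: sm_valid.
Qed.

End PolicyValues.

(** * Noise of the algorithm *)

Section StoppedSigma.
Context {d : measure_display} {Omega : measurableType d}.
Variables (Fn : nat -> set (set Omega)) (Finf : set (set Omega)) (T : Omega -> option nat).
Hypothesis Fn_mono : forall m n, (m <= n)%N -> <<s Fn m >> `<=` <<s Fn n >>.
Hypothesis Fn_inf : forall n, <<s Fn n >> `<=` <<s Finf >>.
Hypothesis T_stop : forall n, <<s Fn n >> (T @^-1` [set Some n]).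

Let upto n := [set w | exists2 m, T w = Some m & (m <= n)%N].

Let upto_stop n : <<s Fn n >> (upto n).
Proof.
elim: n => [|n IH].
  rewrite (_ : upto 0 = T @^-1` [set Some 0%N])//; apply/seteqP; split => w /=.
    by move=> [m ->]; rewrite leqn0 => /eqP ->.
  by move=> Tw; exists 0%N.
rewrite (_ : upto n.+1 = upto n `|` T @^-1` [set Some n.+1]).
  by apply: (sigma_setU (sigma_algebra_gen _)) => //; exact: Fn_mono IH.
apply/seteqP; split => w /=.
  by move=> [m Tm]; rewrite leq_eqVlt ltnS => /predU1P[mn|mn]; [right; rewrite -mn|left; exists m].
by move=> [[m Tm mn]|Tw]; [exists m => //; exact: leqW|exists n.+1].
Qed.

Lemma stop_sigma_algebra : sigma_algebra setT (stop_sigma Fn Finf T).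
Proof.
have sG G : sigma_algebra setT <<s G : set (set Omega) >> by exact: sigma_algebra_gen.
split.
- split; first by have [] := sG Finf.
  by move=> n; rewrite set0I; have [] := sG (Fn n).
- move=> B [FB stB]; split; first by rewrite setTD; apply: (sigma_setC (sG _)).
  move=> n; rewrite setTD (_ : _ `&` _ = upto n `\` (B `&` upto n)).
    by apply: (sigma_setD (sG _)) => //; exact: stB.
  apply/seteqP; split => w /= [h1 h2]; split => //; first by case.
  by move=> Bw; apply: h2.
- move=> B stB; split; first by apply: (sigma_bigcup (sG _)) => n; have [] := stB n.
  move=> n; rewrite setI_bigcupl; apply: (sigma_bigcup (sG _)) => k.
  by have [_] := stB k; apply.
Qed.

Lemma stop_sigma_at B n : stop_sigma Fn Finf T B -> <<s Fn n >> (B `&` T @^-1` [set Some n]).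
Proof.
move=> [_ /(_ n) FB]; rewrite (_ : _ `&` _ = (B `&` upto n) `&` T @^-1` [set Some n]).
  by apply: (sigma_setI (sigma_algebra_gen _)).
apply/seteqP; split => w /= [].
  by move=> Bw Tw; split => //; split => //; exists n.
by move=> [].
Qed.

Lemma stop_sigma_base (G : set (set Omega)) : (forall n, <<s G >> `<=` <<s Fn n >>) ->
  <<s G >> `<=` stop_sigma Fn Finf T.
Proof.
move=> GF B GB; split; first by apply: (@Fn_inf 0); exact: GF.
by move=> n; apply: (sigma_setI (sigma_algebra_gen _)) => //; exact: GF.
Qed.

Lemma stop_sigma_sub : stop_sigma Fn Finf T `<=` <<s Finf >>.
Proof. by move=> B []. Qed.

Lemma stop_sigma_finite : stop_sigma Fn Finf T [set w | T w].
Proof.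
split.
  rewrite (_ : [set w | T w] = \bigcup_n T @^-1` [set Some n]).
    by apply: (sigma_bigcup (sigma_algebra_gen _)) => n; exact: Fn_inf.
  apply/seteqP; split => w /=; first by case Tw: (T w) => [n|//] _; exists n.
  by move=> [n _ /= ->].
move=> n; rewrite (_ : _ `&` _ = upto n)//; apply/seteqP; split => w /=; first by case.
by move=> h; split => //; case: h => m ->.
Qed.

Section StoppedValue.
Context {R : realType}.
Variables (P : probability Omega R) (f : nat -> Omega -> R) (C : R).
Hypothesis Fm : <<s Finf >> `<=` measurable.
Hypothesis mf : forall n, meas_wrt <<s Finf >> (f n).
Hypothesis f1 : forall n, L1 P (f n).
Hypothesis f2 : forall n, L1 P (fun w => f n w ^+ 2).
Hypothesis f_centered : forall n B, <<s Fn n >> B -> B `<=` T @^-1` [set Some n] ->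
  \int[P]_(w in B) f n w = 0.
Hypothesis C0 : 0 <= C.
Hypothesis f_var : forall n B, <<s Fn n >> B -> B `<=` T @^-1` [set Some n] ->
  \int[P]_(w in B) f n w ^+ 2 <= C * fine (P B).

Definition stopped (w : Omega) : R := if T w is Some n then f n w else 0.

Let At n := T @^-1` [set Some n].
(** The stopped value cut off at [T < N], a finite sum over the values of [T]. At each point it is
    eventually constant in [N], so results for fixed times pass to the limit. *)
Let part (g : nat -> Omega -> R) N w := \sum_(i < N) \1_(At i) w * g i w.

Let indE n w : \1_(At n) w = (T w == Some n)%:R :> R.
Proof. by rewrite indicE; congr (nat_of_bool _)%:R; apply/idP/eqP; rewrite inE. Qed.

Let partE g N w : part g N w = if T w is Some n then (n < N)%:R * g n w else 0.
Proof.
rewrite /part; case Tw: (T w) => [n|]; last first.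
  by rewrite big1// => i _; rewrite indE Tw mul0r.
case: (ltnP n N) => nN; last first.
  rewrite mul0r big1// => i _; rewrite indE Tw; have [[ni]|_] := eqVneq (Some n) (Some (i : nat)).
    by move: (ltn_ord i); rewrite -ni ltnNge nN.
  by rewrite mul0r.
rewrite (bigD1 (Ordinal nN))//= indE Tw eqxx big1 ?addr0// => i /eqP ni.
rewrite indE Tw; have [[h]|_] := eqVneq (Some n) (Some (i : nat)); last by rewrite mul0r.
by exfalso; apply: ni; apply/val_inj; rewrite /= h.
Qed.

Let part_cvg g w : (fun N => part g N w) @ \oo --> (if T w is Some n then g n w else 0).
Proof.
under eq_fun do rewrite partE.
case: (T w) => [n|]; last exact: cvg_cst.
apply: cvg_near_cst; near=> N; rewrite (_ : (n < N)%N) ?mul1r//; near: N; exact: nbhs_infty_gt.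
Unshelve. all: by end_near. Qed.

Let sF : sigma_algebra setT <<s Finf >>. Proof. exact: sigma_algebra_gen. Qed.

Let mAt n : measurable (At n). Proof. by apply: Fm; apply: Fn_inf; exact: T_stop. Qed.

Let L1_part g N : (forall n, L1 P (g n)) -> L1 P (part g N).
Proof.
move=> g1; apply: L1_sum => i _; apply: L1M => //; exact: bnd_indic.
Qed.

Lemma stopped_meas : meas_wrt <<s Finf >> stopped.
Proof.
apply: (meas_wrt_cvg sF (h := part f)) => [N|w]; last exact: part_cvg.
apply: meas_wrt_sum => // i _.
by apply: meas_wrtM => //; apply: meas_wrt_indic => //; apply: Fn_inf; exact: T_stop.
Qed.

Let int_part g N B : measurable B -> (forall n, L1 P (g n)) ->
  \int[P]_(w in B) part g N w = \sum_(i < N) \int[P]_(w in B `&` At i) g i w.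
Proof.
move=> mB g1; rewrite -Rint_indic//; under eq_Rintegral do rewrite mulr_sumr.
rewrite Rint_sum => [|i _]; last first.
  apply: L1M; [exact: measurable_indic|exact: bnd_indic|].
  by apply: L1M => //; exact: bnd_indic.
apply: eq_bigr => i _; rewrite -[RHS]Rint_indic; last exact: measurableI.
by apply: eq_Rintegral => w _; rewrite indicI/= mulrA.
Qed.

Let sum_prob N B : measurable B -> \sum_(i < N) fine (P (B `&` At i)) <= fine (P B).
Proof.
move=> mB.
have h : \sum_(i < N) fine (P (B `&` At i)) = \int[P]_w part (fun _ => \1_B) N w.
  rewrite Rint_sum => [|i _]; last first.
    by apply: L1_bnd; [apply: measurable_funM; exact: measurable_indic|apply: bndM; exact: bnd_indic].
  apply: eq_bigr => i _; rewrite -Rint_indic1; last exact: measurableI.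
  by apply: eq_Rintegral => w _; rewrite indicI/= mulrC.
rewrite h -Rint_indic1//.
have LB : L1 P (\1_B : Omega -> R).
  by apply: L1_bnd; [exact: measurable_indic|exact: bnd_indic].
apply: le_Rintegral => //; first exact: L1_part.
move=> w _; rewrite partE; have B0 : 0 <= \1_B w :> R by rewrite indicE ler0n.
by case: (T w) => [n|//]; case: (n < N)%N; rewrite ?mul1r ?mul0r.
Qed.

Let sq_part_le N B : stop_sigma Fn Finf T B ->
  \int[P]_(w in B) part (fun n w => f n w ^+ 2) N w <= C * fine (P B).
Proof.
move=> SB; have mB : measurable B by apply: Fm; exact: stop_sigma_sub.
rewrite int_part//; apply: le_trans (ler_wpM2l C0 (sum_prob N mB)).
rewrite mulr_sumr; apply: ler_sum => i _; apply: f_var; first exact: stop_sigma_at.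
by move=> w [].
Qed.

Let stopped_sqE w : limn (fun N => part (fun n w => f n w ^+ 2) N w) = stopped w ^+ 2.
Proof.
rewrite (cvg_lim _ (@part_cvg _ w))//; rewrite /stopped; case: (T w) => //.
by rewrite expr0n.
Qed.

Let stop_setT : stop_sigma Fn Finf T setT.
Proof. by apply: sigma_setT; exact: stop_sigma_algebra. Qed.

Let stopped_sq_bl : L1 P (fun w => stopped w ^+ 2) /\
  forall B, stop_sigma Fn Finf T B -> \int[P]_(w in B) stopped w ^+ 2 <= C * fine (P B).
Proof.
have [|||N|_ L h] := @beppo_levi _ _ _ P (part (fun n w => f n w ^+ 2)) (C * fine (P setT)).
- by move=> N; exact: L1_part.
- move=> N w; rewrite partE; case: (T w) => // n; rewrite mulr_ge0 ?ler0n ?sqr_ge0//.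
- move=> N w; rewrite !partE; case: (T w) => // n; rewrite ler_wpM2r ?sqr_ge0//.
  by rewrite ler_nat; have [nN|//] := ltnP n N; rewrite (leqW nN).
- exact: sq_part_le.
have E : (fun w => limn (fun N => part (fun n w => f n w ^+ 2) N w)) = (fun w => stopped w ^+ 2).
  by apply/funext => w; exact: stopped_sqE.
rewrite E in L; split => // B SB.
have := h B (C * fine (P B)) (Fm (stop_sigma_sub SB)) (fun N => sq_part_le N SB).
by under eq_Rintegral do rewrite stopped_sqE.
Qed.

Lemma stopped_sq_L1 : L1 P (fun w => stopped w ^+ 2).
Proof. by case: stopped_sq_bl. Qed.

Lemma stopped_var B : stop_sigma Fn Finf T B ->
  \int[P]_(w in B) stopped w ^+ 2 <= C * fine (P B).
Proof. by case: stopped_sq_bl => _; apply. Qed.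

(** By [|z| <= 1 + z ^+ 2], the square, integrable by monotone convergence, dominates all
    truncations. *)
Let stopped_dom : L1 P stopped /\ forall B, measurable B ->
    (fun n => \int[P]_(w in B) part f n w) @ \oo --> \int[P]_(w in B) stopped w.
Proof.
apply: (@Rint_dominated _ _ _ P (part f) stopped (fun w => 1 + stopped w ^+ 2)).
- by move=> N; apply: L1_measurable (L1_part _ _).
- by apply/meas_wrt_measurable; apply: meas_wrtS stopped_meas.
- by apply: aeW => w; exact: part_cvg.
- by apply: L1D stopped_sq_L1; apply: L1_bnd => //; exact: bnd_cst.
- apply: aeW => w N; rewrite partE /stopped; case: (T w) => [n|]; last first.
    by rewrite normr0 expr0n addr0.
  case: (n < N)%N; rewrite ?mul1r ?mul0r; last by rewrite normr0 addr_ge0// sqr_ge0.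
  rewrite ler_norml; have := sqr_ge0 (f n w); move=> s0; apply/andP; split; nra.
Qed.

Lemma stopped_L1 : L1 P stopped.
Proof. by case: stopped_dom. Qed.

Lemma stopped_centered B : stop_sigma Fn Finf T B -> \int[P]_(w in B) stopped w = 0.
Proof.
move=> SB; have mB : measurable B by apply: Fm; exact: stop_sigma_sub.
have [_ /(_ B mB) h] := stopped_dom; rewrite -(cvg_lim _ h)//.
rewrite (_ : (fun _ => _) = fun=> 0) ?lim_cst//; apply/funext => N.
rewrite int_part// big1// => i _; apply: f_centered; first exact: stop_sigma_at.
by move=> w [].
Qed.

End StoppedValue.
End StoppedSigma.

Lemma sigma_forall {d : measure_display} {Omega : measurableType d} (F : set (set Omega))
    (I : finType) (p : pred I) (E : I -> set Omega) :
  sigma_algebra setT F -> (forall i, p i -> F (E i)) -> F [set w | forall i, p i -> E i w].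
Proof.
move=> sF FE.
suff h (s : seq I) : F [set w | forall i, i \in s -> p i -> E i w].
  rewrite (_ : [set w | _] = [set w | forall i, i \in enum I -> p i -> E i w])//.
  by apply/seteqP; split => w /= hw i => [_|]; apply: hw; rewrite mem_enum.
elim: s => [|i s IH].
  by rewrite (_ : [set _ | _] = setT); [exact: sigma_setT|apply/seteqP; split].
rewrite (_ : [set _ | _] = [set w | p i -> E i w] `&` [set w | forall i, i \in s -> p i -> E i w]).
  apply: (sigma_setI sF) => //; have [pi|pi] := boolP (p i).
    rewrite (_ : [set w | _] = E i); first exact: FE.
    by apply/seteqP; split => w /=; [apply|].
  by rewrite (_ : [set _ | _] = setT); [exact: sigma_setT|apply/seteqP; split].
apply/seteqP; split => w /=.
  by move=> h; split => [|j js]; apply: h; rewrite inE ?eqxx// js orbT.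
by move=> [h1 h2] j; rewrite inE => /predU1P[->//|]; exact: h2.
Qed.

(** * First visit times *)

Section VisitTime.
Context {d : measure_display} {Omega : measurableType d} {S A : finType}.
Variables (Xs : nat -> Omega -> S) (As : nat -> Omega -> A) (x : S) (a : A).

Lemma tauP w n : tau Xs As x a w = Some n <->
  (Xs n w = x /\ As n w = a) /\ forall m, (m < n)%N -> ~ (Xs m w = x /\ As m w = a).
Proof.
rewrite /tau; case: pselect => [h|h]; last first.
  by split=> [//|[[Xn An] _]]; case: h; exists n; rewrite Xn An.
case: ex_minnP => k /eqP[Xk Ak] kmin; split => [[<-]|[[Xn An] nmin]].
  split => // m mk [Xm Am]; have := kmin m; rewrite Xm Am eqxx => /(_ isT).
  by rewrite leqNgt mk.
congr Some; apply/eqP; rewrite eqn_leq kmin ?Xn ?An//= leqNgt.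
by apply/negP => /nmin; apply.
Qed.

Lemma tau_measurable F n : sigma_algebra setT F ->
  (forall m y, (m <= n)%N -> F (Xs m @^-1` [set y])) ->
  (forall m b, (m <= n)%N -> F (As m @^-1` [set b])) ->
  F (tau Xs As x a @^-1` [set Some n]).
Proof.
move=> sF FX FA.
have FZ m : (m <= n)%N -> F [set w | Xs m w = x /\ As m w = a].
  by move=> mn; apply: (sigma_setI sF); [exact: FX|exact: FA].
rewrite (_ : _ @^-1` _ = [set w | Xs n w = x /\ As n w = a] `&`
  [set w | forall m : 'I_n, true -> ~ (Xs m w = x /\ As m w = a)]).
  apply: (sigma_setI sF); first exact: FZ.
  apply: (sigma_forall sF) => m _; apply: (sigma_setC sF (A := [set w | Xs m w = x /\ As m w = a])).
  by apply: FZ; exact: ltnW.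
apply/seteqP; split => w /=; rewrite tauP => -[h1 h2]; split => //.
  by move=> m _; exact: h2.
by move=> m mn; exact: (h2 (Ordinal mn)).
Qed.

End VisitTime.

(** * Measurability and boundedness of policy values *)

Section PolicyMeasurability.
Variables (R : realType) (M : mdp R) (gamma : R).
Context {d : measure_display} {Omega : measurableType d}.
Hypothesis gamma01 : 0 <= gamma < 1.
Local Notation X := (st M).
Local Notation A := (ac M).

Lemma policy_le1 (pi : X -> A -> R) x a : policy pi -> `|pi x a| <= 1.
Proof.
move=> pol; have [pi0 [piN pi1]] := pol x; rewrite ger0_norm//.
have [aA|/piN ->//] := boolP (a \in acts x).
by rewrite -pi1 (bigD1 a)//= lerDl sumr_ge0.
Qed.

(** Every value lies between [vopt - c / (1 - gamma)] and [vopt]. The bound is uniform in the policy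
    because the policies of the algorithm are random. *)
Lemma vpi_bounded : exists K, forall (pi : X -> A -> R) x, policy pi -> `|vpi gamma pi x| <= K.
Proof.
pose c := \sum_(x : X) \sum_(a : A) `|vopt gamma x - qval gamma (vopt gamma) x a|.
have cP (x : X) (a : A) : vopt gamma x - qval gamma (vopt gamma) x a <= c.
  apply: le_trans (ler_norm _) _; rewrite /c (bigD1 x)//= (bigD1 a)//= -addrA lerDl.
  by rewrite addr_ge0 ?sumr_ge0// => y _; rewrite sumr_ge0.
pose b := \sum_(x : X) `|vopt gamma x|.
have bP (x : X) : `|vopt gamma x| <= b by rewrite /b (bigD1 x)//= lerDl sumr_ge0.
have g1 : 0 < 1 - gamma by rewrite subr_gt0; case/andP: gamma01.
exists (b + `|c / (1 - gamma)|) => pi x pol.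
have lo := vopt_vpi_le gamma01 pol _ x; have hi := vpi_le_vopt gamma01 x pol.
have /lo {}lo : forall y, vopt gamma y - bellman gamma pi (vopt gamma) y <= c.
  move=> y; have [pi0 [_ pi1]] := pol y.
  rewrite -[X in X - _]mul1r -pi1 mulr_suml -sumrB -[leRHS]mul1r -pi1 mulr_suml.
  by apply: ler_sum => a aA; rewrite -mulrBr ler_wpM2l// cP.
have := bP x; have := ler_norm (c / (1 - gamma)); have := normr_ge0 (c / (1 - gamma)).
by move: lo hi; rewrite !ler_norml => lo hi h0 h1 /andP[h2 h3]; apply/andP; split; lra.
Qed.

Lemma qval_bounded : exists K, forall (pi : X -> A -> R) x a, policy pi ->
  `|qval gamma (vpi gamma pi) x a| <= K.
Proof.
have [K KP] := vpi_bounded.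
pose q (x : X) (a : A) := `|@mean_rew _ M x a| + `|gamma| * \sum_(y : X) (`|trans x a y| * K).
have q0 x a : 0 <= q x a.
  rewrite addr_ge0// mulr_ge0// sumr_ge0// => y _; rewrite mulr_ge0//.
  (* An arbitrary policy, used to see that [K] is nonnegative. *)
  apply: le_trans (KP (pihat (fun=> 0) (fun _ _ => 0)) y _) => //; apply: pihat_policy => z.
  by rewrite lexx ler01.
exists (\sum_(x : X) \sum_(a : A) q x a) => pi x a pol.
apply: (@le_trans _ _ (q x a)).
  apply: le_trans (ler_normD _ _) _; rewrite lerD2l normrM ler_wpM2l//.
  apply: le_trans (ler_norm_sum _ _ _) _; apply: ler_sum => y _.
  by rewrite normrM ler_wpM2l// KP.
rewrite (bigD1 x)//= (bigD1 a)//= -addrA lerDl.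
by rewrite addr_ge0 ?sumr_ge0// => y _; rewrite sumr_ge0.
Qed.

Section Sigma.
Variable F : set (set Omega).
Hypothesis sF : sigma_algebra setT F.

(** [pihat] depends on [Q] only through the set of maximisers, which takes finitely many values,
    each determined by finitely many comparisons. *)
Lemma amax_measurable (Q : Omega -> X -> A -> R) x (B : {set A}) :
  (forall a, meas_wrt F (fun w => Q w x a)) ->
  F ((fun w => amax (Q w) x) @^-1` [set B]).
Proof.
move=> mQ.
have Fmem a : F [set w | a \in amax (Q w) x].
  have [aA|aA] := boolP (a \in acts x); last first.
    rewrite (_ : [set _ | _] = set0); first by case: sF.
    by apply/seteqP; split => w //= /amaxP[]; rewrite (negbTE aA).
  rewrite (_ : [set _ | _] = [set w | forall b, b \in acts x -> Q w x b <= Q w x a]).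
    by apply: (sigma_forall sF) => b _; exact: meas_wrt_ler.
  by apply/seteqP; split => w /=; [move=> /amaxP[]|move=> h; apply/amaxP].
rewrite (_ : _ @^-1` _ = [set w | forall a, true -> (a \in amax (Q w) x) = (a \in B)]).
  apply: (sigma_forall sF (E := fun a w => (a \in amax (Q w) x) = (a \in B))) => a _.
  case: (a \in B); first exact: Fmem.
  rewrite (_ : (fun w => _) = ~` [set w | a \in amax (Q w) x]); first exact: sigma_setC.
  by apply/seteqP; split => w /=; [move=> ->|move=> /negP /negbTE].
apply/seteqP; split => w /= h; first by move=> a _; rewrite h.
by apply/setP => a; exact: (h a isT).
Qed.

Lemma pihat_measurable (e : Omega -> X -> R) (Q : Omega -> X -> A -> R) x a :
  meas_wrt F (fun w => e w x) -> (forall b, meas_wrt F (fun w => Q w x b)) ->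
  meas_wrt F (fun w => pihat (e w) (Q w) x a).
Proof.
move=> me mQ; have mc (c : R) : meas_wrt F (fun=> c) by exact: meas_wrt_cst.
rewrite /pihat; apply: meas_wrtD => //; first by apply: meas_wrtM => //; exact: meas_wrtM.
apply: (@meas_wrt_fin_comp _ _ _ _ _ (fun w => amax (Q w) x)
  (fun B w => (a \in B)%:R * ((1 - e w x) / #|B|%:R))) => //.
  by move=> B; exact: amax_measurable.
move=> B; apply: meas_wrtM => //; apply: meas_wrtM => //; exact: meas_wrtB.
Qed.

Lemma qval_measurable (v : Omega -> X -> R) x a :
  (forall y, meas_wrt F (fun w => v w y)) -> meas_wrt F (fun w => qval gamma (v w) x a).
Proof.
move=> mv; have mc (c : R) : meas_wrt F (fun=> c) by exact: meas_wrt_cst.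
apply: meas_wrtD => //; apply: meas_wrtM => //; apply: meas_wrt_sum => // y _.
exact: meas_wrtM.
Qed.

(** The value is a pointwise limit of Bellman iterates, which are polynomials in the action
    probabilities. *)
Lemma vpi_measurable (pi : Omega -> X -> A -> R) y : (forall w, policy (pi w)) ->
  (forall x a, meas_wrt F (fun w => pi w x a)) -> meas_wrt F (fun w => vpi gamma (pi w) y).
Proof.
move=> pol mpi.
apply: (meas_wrt_cvg sF (h := fun n w => iter n (bellman gamma (pi w)) (fun=> 0) y)) => [n|w].
  elim: n y => [|n IH] y /=; first exact: meas_wrt_cst.
  apply: meas_wrt_sum => // a _; apply: meas_wrtM => //.
  exact: (qval_measurable (v := fun w => iter n (bellman gamma (pi w)) (fun=> 0))).
exact: vpi_cvg.
Qed.

End Sigma.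
End PolicyMeasurability.

(** * Episodes and their target noise *)

Section Episodes.
Variables (R : realType) (M : mdp R) (gamma : R).
Context {d : measure_display} {Omega : measurableType d}.
Local Notation X := (st M).
Local Notation A := (ac M).
Variables (P : probability Omega R)
  (Xe : nat -> nat -> Omega -> X) (Ae : nat -> nat -> Omega -> A)
  (Re : nat -> nat -> Omega -> R) (Q0 : X -> A -> R)
  (eps : nat -> Omega -> X -> R) (nu : nat -> Omega -> X -> A -> R)
  (alpha : nat -> Omega -> X -> A -> R).
Hypothesis gamma01 : 0 <= gamma < 1.
Hypothesis run : alg_run gamma Xe Ae Re Q0 eps nu alpha P.

Local Notation past k := (past_gen Xe Ae Re k).
Local Notation epi k n := (epi_gen Xe Ae Re k n).
Local Notation hit k x a := (tau (Xe k) (Ae k) x a).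
Local Notation Qh := (Qhat gamma Xe Ae Re Q0 alpha).

Let mX k t y : measurable (Xe k t @^-1` [set y]). Proof. by have [] := run. Qed.
Let mA k t a : measurable (Ae k t @^-1` [set a]). Proof. by have [_ []] := run. Qed.
Let mR k t : measurable_fun setT (Re k t). Proof. by have [_ [_ []]] := run. Qed.
Let eps01 k w x : 0 <= eps k w x <= 1. Proof. by have [_ [_ [_ []]]] := run. Qed.
Let meps k x : meas_wrt <<s past k >> (fun w => eps k w x).
Proof. by have [_ [_ [_ [_ []]]]] := run. Qed.
Let nu_acts k w x a : a \notin acts x -> nu k w x a = 0.
Proof. by have [_ [_ [_ [_ [_ [_ [h _]]]]]]] := run; exact: h. Qed.
Let alpha01 k w x a : 0 <= alpha k w x a <= 1.
Proof. by have [_ [_ [_ [_ [_ [_ [_ [_ [_ [h _]]]]]]]]]] := run; exact: h. Qed.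
Let malpha k x a : meas_wrt (stop_sigma (epi_gen Xe Ae Re k) (past k.+1) (hit k x a))
  (fun w => alpha k w x a).
Proof. by have [_ [_ [_ [_ [_ [_ [_ [_ [_ [_ [h _]]]]]]]]]]] := run; exact: h. Qed.
Let law0 k : cond_law_fin P (past k) (fun w => (Xe k 0 w, Ae k 0 w)) (fun w z => nu k w z.1 z.2).
Proof. by have [_ [_ [_ [_ [_ [_ [_ [_ [_ [_ [_ [h _]]]]]]]]]]]] := run; exact: h. Qed.
Let lawA k t : cond_law_fin P (past k `|` traj_gen (Xe k) (Ae k) (Re k) t.+2 t.+1 t.+1)
  (Ae k t.+1) (fun w a => pihat (eps k w) (Qh k w) (Xe k t.+1 w) a).
Proof. by have [_ [_ [_ [_ [_ [_ [_ [_ [_ [_ [_ [_ [h _]]]]]]]]]]]]] := run; exact: h. Qed.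
Let lawX k t : cond_law_fin P (past k `|` traj_gen (Xe k) (Ae k) (Re k) t.+1 t.+1 t)
  (Xe k t.+1) (fun w y => trans (Xe k t w) (Ae k t w) y).
Proof. by have [_ [_ [_ [_ [_ [_ [_ [_ [_ [_ [_ [_ [_ [h _]]]]]]]]]]]]]] := run; exact: h. Qed.
Let lawR k t : cond_law_real P (past k `|` traj_gen (Xe k) (Ae k) (Re k) t.+2 t.+1 t)
  (Re k t) (fun w => rew (Xe k t w) (Ae k t w) (Xe k t.+1 w)).
Proof. by have [_ [_ [_ [_ [_ [_ [_ [_ [_ [_ [_ [_ [_ [_ h]]]]]]]]]]]]]] := run; exact: h. Qed.

Let sF k : sigma_algebra setT <<s past k >>. Proof. exact: sigma_algebra_gen. Qed.

Let past_m k : past k `<=` measurable.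
Proof. by move=> E [j _ [n]]; apply: traj_gen_measurable. Qed.

Let Fm k : <<s past k >> `<=` measurable.
Proof. by apply: gen_sigma_measurable; exact: past_m. Qed.

Let past_epi k n : <<s past k >> `<=` <<s epi k n >>.
Proof. by move=> B; apply: gen_base. Qed.

Let epi_mono k m n : (m <= n)%N -> <<s epi k m >> `<=` <<s epi k n >>.
Proof.
move=> mn; apply: sub_sigma_algebra2 => E [|h]; [by left|right].
by apply: traj_genS h.
Qed.

Let epi_past k n : <<s epi k n >> `<=` <<s past k.+1 >>.
Proof.
apply: sub_sigma_algebra2 => E [[j jk h]|h]; first by exists j => //; exact: leqW.
by exists k => //; exists n.+1; apply: traj_genS h.
Qed.

Let hit_stop k x a n : <<s epi k n >> (hit k x a @^-1` [set Some n]).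
Proof.
apply: tau_measurable; first exact: sigma_algebra_gen.
  by move=> m y mn; apply: gen_X.
by move=> m b mn; apply: gen_A.
Qed.

Let mret k n : meas_wrt <<s past k.+1 >> (ret gamma (fun t => Re k (n + t))).
Proof.
apply: (meas_wrt_ret (sF _)) => t; apply: meas_wrtS (@epi_past k (n + t).+1) _.
exact: gen_R.
Qed.

Let mQ k x a : meas_wrt <<s past k >> (fun w => Qh k w x a).
Proof.
elim: k x a => [|k IH] x a; first exact: meas_wrt_cst.
have IH' : meas_wrt <<s past k.+1 >> (fun w => Qh k w x a).
  by apply: meas_wrtS (IH x a); apply: subset_trans (@epi_past k 0); exact: past_epi.
(* [stopped] is 0 without a visit, so one formula covers both branches of the update and
   [stopped_meas] applies. *)
rewrite (_ : (fun w => _) = (fun w => Qh k w x a + alpha k w x a *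
  stopped (hit k x a) (fun n w => ret gamma (fun t => Re k (n + t)) w - Qh k w x a) w)).
  apply: meas_wrtD => //; apply: meas_wrtM => //.
    by apply: meas_wrtS (malpha k x a); exact: stop_sigma_sub.
  apply: (stopped_meas (Fn := epi_gen Xe Ae Re k)) => // n; exact: meas_wrtB.
apply/funext => w /=; rewrite /stopped; case: (tau _ _ _ _ _) => [n|]; last by rewrite mulr0 addr0.
ring.
Qed.

Let pol k w : policy (pihat (eps k w) (Qh k w)).
Proof. by apply: pihat_policy => x; exact: eps01. Qed.

Let v k w := vpi gamma (pihat (eps k w) (Qh k w)).

Let mpihat k x a : meas_wrt <<s past k >> (fun w => pihat (eps k w) (Qh k w) x a).
Proof. exact: pihat_measurable. Qed.

Let mv k y : meas_wrt <<s past k >> (fun w => v k w y).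
Proof. exact: vpi_measurable. Qed.

Let p k t w a := pihat (eps k w) (Qh k w) (Xe k t w) a.

Let mp k t a : measurable_fun setT (fun w => p k t w a).
Proof.
apply/meas_wrt_measurable.
apply: (@meas_wrt_fin_comp _ _ _ _ _ (Xe k t) (fun x w => pihat (eps k w) (Qh k w) x a)) => //.
  exact: sigma_algebra_measurable.
by move=> x; apply: meas_wrtS (@mpihat k x a); exact: Fm.
Qed.

Let bp k t a : bnd (fun w => p k t w a).
Proof. by exists 1 => w; exact: policy_le1. Qed.

Let p_acts k t w a : a \notin acts (Xe k t w) -> p k t w a = 0.
Proof. by have [_ [h _]] := pol k w (Xe k t w) => /h. Qed.

Let bv k y : bnd (fun w => v k w y).
Proof. by have [K KP] := vpi_bounded M gamma01; exists K => w; exact: KP. Qed.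

Let A0_acts k : {ae P, forall w, Ae k 0 w \in acts (Xe k 0 w)}.
Proof.
have := @cond_law_fin_supp _ _ _ P (past k) _ (fun w => (Xe k 0 w, Ae k 0 w))
  (fun w z => nu k w z.1 z.2) (fun _ z => z.2 \notin acts z.1) (@Fm k) _ _ (@law0 k)
  (fun w z => @nu_acts k w z.1 z.2).
move=> h; apply: filterS (h _ _) => [w|[x a]|[x a]] /=; first by rewrite negbK.
  rewrite (_ : _ @^-1` _ = Xe k 0 @^-1` [set x] `&` Ae k 0 @^-1` [set a]).
    exact: measurableI.
  by apply/seteqP; split => w /=; [move=> [-> ->]|move=> [-> ->]].
have [aA|aA] := boolP (a \notin acts x).
  rewrite (_ : [set _ | _] = setT); first exact: sigma_setT.
  by apply/seteqP; split.
rewrite (_ : [set _ | _] = set0); first by case: (sF k).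
by apply/seteqP; split.
Qed.

Let Gk k n : Omega -> R := ret gamma (fun t => Re k (n + t)).

Let G_L1 k n : L1 P (Gk k n).
Proof.
by have [] := @return_L1 _ _ _ M gamma P gamma01 (Xe k) (Ae k) (Re k) (past k) (p k)
  (@past_m k) (@mX k) (@mA k) (@mR k) (@p_acts k) (A0_acts k) (@lawA k) (@lawR k) n.
Qed.

Let G_sq k n : L1 P (fun w => Gk k n w ^+ 2) /\ forall B, <<s epi k n >> B ->
  \int[P]_(w in B) Gk k n w ^+ 2 <= rew_var M / (1 - gamma) ^+ 2 * fine (P B).
Proof. exact: (@return_sq _ _ _ M gamma P gamma01 (Xe k) (Ae k) (Re k) (past k) (p k)
  (@past_m k) (@mX k) (@mA k) (@mR k) (@p_acts k) (A0_acts k) (@lawA k) (@lawR k) n). Qed.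

Let G_value k n B : <<s epi k n >> B ->
  \int[P]_(w in B) Gk k n w = \int[P]_(w in B) qval gamma (v k w) (Xe k n w) (Ae k n w).
Proof.
move=> FB; apply: (@return_value _ _ _ M gamma P gamma01 (Xe k) (Ae k) (Re k) (past k) (p k)
  (@past_m k) (@mX k) (@mA k) (@mR k) (@mp k) (@bp k) (@p_acts k) (A0_acts k) (@lawA k)
  (@lawX k) (@lawR k) n (v k) B FB (@mv k) (@bv k)) => t w.
rewrite [RHS]vpiE// [RHS]big_mkcond/=; apply: eq_bigr => a _; case: ifPn => // aA.
by rewrite p_acts// mul0r.
Qed.

Variables (x : X) (a : A).

Definition target_noise k : Omega -> R :=
  stopped (hit k x a) (fun n w =>
    ret gamma (fun t => Re k (n + t)) w
    - qval gamma (vpi gamma (pihat (eps k w) (Qh k w))) x a).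

Let q k w := qval gamma (v k w) x a.

Let mq k : meas_wrt <<s past k >> (q k).
Proof. exact: qval_measurable. Qed.

Let H k := stop_sigma (epi_gen Xe Ae Re k) (past k.+1) (hit k x a).

Let HF k : H k `<=` <<s past k.+1 >>. Proof. exact: stop_sigma_sub. Qed.

Let sH k : sigma_algebra setT (H k).
Proof. by apply: stop_sigma_algebra; [exact: epi_mono|exact: hit_stop]. Qed.

Let FH k : <<s past k >> `<=` H k.
Proof.
apply: stop_sigma_base; [exact: epi_mono|exact: epi_past|exact: hit_stop|].
by move=> n; exact: past_epi.
Qed.

Let FF k : <<s past k >> `<=` <<s past k.+1 >>.
Proof. exact: subset_trans (@HF k). Qed.

Let mq' k : measurable_fun setT (q k).
Proof. by apply/meas_wrt_measurable; apply: (meas_wrtS (F := <<s past k >>)) => //; exact: Fm. Qed.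

Let f k n w := Gk k n w - q k w.

Lemma target_noise_cvg :
  {ae P, forall w, (exists K, forall n,
      \sum_(i < n) (alpha i w x a * visited Xe Ae i w x a) ^+ 2 <= K) ->
    cvgn (series (fun k => alpha k w x a * visited Xe Ae k w x a * target_noise k w))}.
Proof.
have [K KP] := qval_bounded M gamma01.
have qK k w : `|q k w| <= K by exact: KP.
have q1 k : L1 P (q k) by apply: L1_bnd => //; exists K.
have g1 : 0 < 1 - gamma by rewrite subr_gt0; case/andP: gamma01.
(* From [(G - q)^2 <= 2 G^2 + 2 q^2], with the conditional second moment of the return and the
   uniform bound [K] on action values. *)
pose C := 2 * (rew_var M / (1 - gamma) ^+ 2) + 2 * K ^+ 2.
have C0 : 0 <= C.
  by apply: addr_ge0; apply: mulr_ge0; rewrite ?sqr_ge0// divr_ge0 ?sqr_ge0// rew_var_ge0.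
have fF k n : meas_wrt <<s past k.+1 >> (f k n).
  by apply: meas_wrtB => //; [exact: mret|apply: meas_wrtS (@mq k)].
have mfk k n : measurable_fun setT (f k n).
  by apply/meas_wrt_measurable; apply: meas_wrtS (fF k n); exact: Fm.
have f1 k n : L1 P (f k n) by exact: L1B.
have fle k n w : f k n w ^+ 2 <= 2 * Gk k n w ^+ 2 + 2 * K ^+ 2.
  have := qK k w; rewrite ler_norml => /andP[h1 h2].
  have : q k w ^+ 2 <= K ^+ 2 by nra.
  by have := sqr_ge0 (Gk k n w + q k w); rewrite /f; nra.
have L1b k n : L1 P (fun w => 2 * Gk k n w ^+ 2 + 2 * K ^+ 2).
  apply: L1D; first by apply: L1Z; case: (G_sq k n).
  by apply: L1_bnd => //; exact: bnd_cst.
have f2 k n : L1 P (fun w => f k n w ^+ 2).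
  apply: (L1_le _ _ (L1b k n)); first exact: measurable_funX.
  by move=> w; rewrite ger0_norm ?sqr_ge0// fle.
have f_var k n B : <<s epi k n >> B -> B `<=` hit k x a @^-1` [set Some n] ->
    \int[P]_(w in B) f k n w ^+ 2 <= C * fine (P B).
  move=> FB _; have mB : measurable B by apply: (@Fm k.+1); exact: epi_past FB.
  apply: (@le_trans _ _ (\int[P]_(w in B) (2 * Gk k n w ^+ 2 + 2 * K ^+ 2))).
    by apply: le_Rintegral => //; [exact: L1S|exact: L1S].
  have [LG /(_ _ FB) hG] := G_sq k n.
  rewrite RintegralD//; last 2 first.
  - by apply: L1S => //; exact: L1Z.
  - by apply: L1S => //; apply: L1_bnd => //; exact: bnd_cst.
  rewrite RintegralZl//; last exact: L1S.
  rewrite Rintegral_cst// /C [leRHS]mulrDl lerD// -mulrA ler_wpM2l//.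
have f_centered k n B : <<s epi k n >> B -> B `<=` hit k x a @^-1` [set Some n] ->
    \int[P]_(w in B) f k n w = 0.
  move=> FB BT; have mB : measurable B by apply: (@Fm k.+1); exact: epi_past FB.
  rewrite RintegralB//; [|exact: L1S|exact: L1S].
  rewrite G_value//; apply/eqP; rewrite subr_eq0; apply/eqP.
  (* On the event of a first visit at time [n] the current pair is [(x, a)], so the mean of the
     return is the very action value subtracted in [f]. *)
  by apply: eq_Rintegral => w; rewrite inE => /BT/tauP[[-> ->] _].
apply: (@transform_cvg _ _ _ P (fun k => <<s past k >>) H
  (fun k => stopped (hit k x a) (f k)) C) => //.
- by move=> k; apply: (stopped_meas (@epi_past k) (@hit_stop k x a)).
- move=> k; apply: (stopped_L1 (@epi_mono k) (@epi_past k) (@hit_stop k x a) (C := C)) => //.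
  exact: f_var.
- move=> k; apply: (stopped_sq_L1 (@epi_mono k) (@epi_past k) (@hit_stop k x a) (C := C)) => //.
  exact: f_var.
- move=> k; apply: (stopped_centered (@epi_mono k) (@epi_past k) (@hit_stop k x a) (C := C)) => //.
    exact: f_centered.
  exact: f_var.
- move=> k; apply: (stopped_var (@epi_mono k) (@epi_past k) (@hit_stop k x a) (C := C)) => //.
  exact: f_var.
- move=> k; apply: meas_wrtM => //; first exact: malpha.
  rewrite (_ : (fun w => visited Xe Ae k w x a) = \1_[set w | hit k x a w]).
    apply: meas_wrt_indic => //.
    by apply: stop_sigma_finite; [exact: epi_mono|exact: epi_past|exact: hit_stop].
  apply/funext => w; rewrite indicE /visited; case hw: (tau _ _ _ _ _) => [n|].
    by rewrite mem_set//= hw.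
  by rewrite memNset//= hw.
- move=> k w; have := alpha01 k w x a; rewrite /visited.
  by case: (tau _ _ _ _ _) => [_|]; rewrite ?mulr1// mulr0 lexx ler01.
Qed.

End Episodes.

(** * From extended series to the convergence theorem *)

Lemma eseries_infty_block {R : realType} (u : nat -> R) : (forall k, 0 <= u k) ->
  (\sum_(1 <= k <oo) (u k)%:E = +oo)%E ->
  forall k (B : R), exists n, B <= \sum_(k <= i < k + n) u i.
Proof.
move=> u0 uoo k B; apply: contrapT => noB.
(* If all blocks starting at [k] stayed below [B], the first [k] terms plus [B] would bound every
   partial sum. *)
have le_s n : \sum_(1 <= i < n) u i <= \sum_(0 <= i < k) u i + B.
  apply: (@le_trans _ _ (\sum_(0 <= i < k + n) u i)).
    case: n => [|n]; first by rewrite big_geq// sumr_ge0.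
    apply: (@le_trans _ _ (\sum_(0 <= i < n.+1) u i)); first by rewrite [leRHS]big_ltn// lerDr.
    by rewrite [leRHS](big_cat_nat (n := n.+1))//= ?leq_addl// lerDl sumr_ge0.
  rewrite (big_cat_nat (n := k))//= ?leq_addr// lerD2l leNgt.
  by apply/negP => /ltW h; apply: noB; exists n.
have : (\sum_(1 <= k <oo) (u k)%:E <= (\sum_(0 <= i < k) u i + B)%:E)%E.
  apply: lime_le; first by apply: is_cvg_nneseries => i _ _; rewrite lee_fin.
  by apply: nearW => n; rewrite sumEFin lee_fin.
by rewrite uoo leNgt ltry.
Qed.

Lemma eseries_lty_bound {R : realType} (u : nat -> R) : (forall k, 0 <= u k) ->
  (\sum_(1 <= k <oo) (u k)%:E < +oo)%E ->
  exists K, forall n, \sum_(i < n) u i <= K.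
Proof.
move=> u0 uoo; set s := (X in (X < _)%E) in uoo.
have s0 : (0 <= s)%E by apply: nneseries_ge0 => i _ _; rewrite lee_fin.
(* The series starts at index 1 and the finite sums at 0, hence the extra term. *)
exists (u 0%N + fine s) => n.
have le_s m : \sum_(1 <= i < m) u i <= fine s.
  rewrite -lee_fin fineK ?ge0_fin_numE// -sumEFin.
  by apply: nneseries_lim_ge => i _; rewrite lee_fin.
case: n => [|n]; first by rewrite big_ord0 addr_ge0// fine_ge0.
by rewrite -(big_mkord predT u) big_ltn// lerD2l.
Qed.

Theorem theorem2p3 (R : realType) (M : mdp R) (gamma : R)
  (d : measure_display) (Omega : measurableType d) (P : probability Omega R)
  (Xe : nat -> nat -> Omega -> st M) (Ae : nat -> nat -> Omega -> ac M)
  (Re : nat -> nat -> Omega -> R) (Q0 : st M -> ac M -> R)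
  (eps : nat -> Omega -> st M -> R) (nu : nat -> Omega -> st M -> ac M -> R)
  (alpha : nat -> Omega -> st M -> ac M -> R) :
  0 <= gamma < 1 / 2 ->
  alg_run gamma Xe Ae Re Q0 eps nu alpha P ->
  {ae P, forall w, forall (x : st M) (a : ac M), a \in acts x ->
     (fun k => eps k w x) @ \oo --> 0 /\
     (\sum_(1 <= k <oo) (alpha k w x a * visited Xe Ae k w x a)%:E = +oo)%E /\
     (\sum_(1 <= k <oo) (alpha k w x a ^+ 2 * visited Xe Ae k w x a)%:E < +oo)%E} ->
  {ae P, forall w, forall x : st M,
     (fun k => Vpol gamma (sm (pihat (eps k w)
                 (Qhat gamma Xe Ae Re Q0 alpha k w))) x) @ \oo
       --> Vstar gamma x}.
Proof.
move=> /andP[g0 g2] run hyp.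
have gamma01 : 0 <= gamma < 1 by apply/andP; split => //; lra.
have [_ [_ [_ [eps01 [_ [_ [_ [_ [_ [alpha01 _]]]]]]]]]] := run.
have noise : {ae P, forall w, forall x a, (exists K, forall n,
      \sum_(i < n) (alpha i w x a * visited Xe Ae i w x a) ^+ 2 <= K) ->
    cvgn (series (fun k => alpha k w x a * visited Xe Ae k w x a *
      target_noise gamma Xe Ae Re Q0 eps alpha x a k w))}.
  apply: filter_forall => x; apply: filter_forall => a.
  exact: target_noise_cvg gamma01 run x a.
apply: filterS2 hyp noise => w hw nw x.
pose b k x a := alpha k w x a * visited Xe Ae k w x a.
have v01 k y a : (visited Xe Ae k w y a == 0) || (visited Xe Ae k w y a == 1).
  by rewrite /visited; case: (tau _ _ _ _ _); rewrite eqxx ?orbT.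
have b01 k y a : 0 <= b k y a <= 1.
  rewrite /b; have /orP[/eqP->|/eqP->] := v01 k y a; rewrite ?mulr1 ?alpha01//.
  by rewrite mulr0 lexx ler01.
have pol k : policy (pihat (eps k w) (Qhat gamma Xe Ae Re Q0 alpha k w)).
  by apply: pihat_policy => y; exact: eps01.
rewrite Vstar_vopt//; under eq_fun do rewrite Vpol_sm//.
apply: cvg_EFin; first exact: nearW.
apply: (greedy_iteration_cvg gamma01 g2 (e := fun k => eps k w)
  (Q := fun k => Qhat gamma Xe Ae Re Q0 alpha k w) (b := b)
  (m := fun k x a => target_noise gamma Xe Ae Re Q0 eps alpha x a k w)).
- by move=> k y; exact: eps01.
- by move=> y; have [] := hw y _ (some_act_in y).
- by move=> k y a _; exact: b01.
- move=> y a aA; have [_ [h _]] := hw y a aA.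
  by apply: eseries_infty_block => // k; have /andP[] := b01 k y a.
- move=> k y a aA; rewrite /b /visited /target_noise /stopped /=.
  by case: (tau _ _ _ _ _) => [n|]; ring.
- move=> y a aA; apply: nw; have [_ [_ h]] := hw y a aA.
  have u0 k : 0 <= alpha k w y a ^+ 2 * visited Xe Ae k w y a.
    by have /orP[/eqP->|/eqP->] := v01 k y a; rewrite ?mulr0// mulr1 sqr_ge0.
  have [K KP] := eseries_lty_bound u0 h.
  exists K => n; apply: le_trans (KP n).
  (* [visited] is 0 or 1, hence equal to its square: the squared weights are the summands of the
     hypothesis. *)
  apply: ler_sum => i _; rewrite exprMn.
  by have /orP[/eqP->|/eqP->] := v01 i y a; rewrite ?expr1n ?expr0n.
Qed.
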